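(* Given a tight map $f\colon G\to H$ of finite connected graphs, the following problems are algorithmically solvable: (1) determine whether $f$ is $\pi_1$-injective; (2) determine whether $f$ is a homotopy equivalence. The following problem is also algorithmically solvable: (3) given an $n$-tuple of elements of the free group $F_n$ of rank $n$ (each given as a word in a fixed free basis and inverses), determine whether it is a free basis of $F_n$.
   Context: A graph is a 1-dimensional CW complex, with $0$-cells called vertices and $1$-cells called edges. An edge path is a concatenation of oriented edges; it is tight if it has no cancellation (no edge is immediately followed by its reverse). A continuous map of graphs $f\colon G\to H$ is tight if it takes vertices to vertices and its restriction to each edge is either constant or a tight edge path. Such a map between finite graphs is given by finite combinatorial data (the image of each vertex and the image edge path of each edge). $f$ is $\pi_1$-injective if the induced homomorphism on fundamental groups is injective. *)

(* Defs.v *)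
From HB Require Import structures.
From mathcomp Require Import all_boot all_order all_algebra.
From mathcomp Require Import all_classical all_reals all_analysis homotopy.
Set Implicit Arguments.
Unset Strict Implicit.
Unset Printing Implicit Defensive.
Import Order.TTheory GRing.Theory Num.Theory numFieldNormedType.Exports.

(** The model of computation is the WHILE language of N. D. Jones,
    "Computability and Complexity" (MIT Press, 1997), which is Turing complete:
    imperative programs over finite binary trees. *)

Inductive tree : Type := Nil | Cons of tree & tree.

Fixpoint tree_eqb (s t : tree) : bool :=
  match s, t with
  | Nil, Nil => true
  | Cons s1 s2, Cons t1 t2 => tree_eqb s1 t1 && tree_eqb s2 t2
  | _, _ => false
  end.

Definition tree_true : tree := Cons Nil Nil.
Definition tree_false : tree := Nil.
Definition tree_of_bool (b : bool) : tree := if b then tree_true else tree_false.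

Inductive expr : Type :=
  | EVar of nat
  | EQuote of tree
  | ECons of expr & expr
  | EHd of expr
  | ETl of expr
  | EEq of expr & expr.

Inductive cmd : Type :=
  | CAssign of nat & expr
  | CSeq of cmd & cmd
  | CWhile of expr & cmd.

Definition store : Type := nat -> tree.

Definition update (s : store) (i : nat) (t : tree) : store :=
  fun j => if j == i then t else s j.

Fixpoint eval (s : store) (e : expr) : tree :=
  match e with
  | EVar i => s i
  | EQuote t => t
  | ECons e1 e2 => Cons (eval s e1) (eval s e2)
  | EHd e1 => if eval s e1 is Cons t _ then t else Nil
  | ETl e1 => if eval s e1 is Cons _ t then t else Nil
  | EEq e1 e2 => tree_of_bool (tree_eqb (eval s e1) (eval s e2))
  end.

Inductive exec : cmd -> store -> store -> Prop :=
  | ExecAssign i e s : exec (CAssign i e) s (update s i (eval s e))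
  | ExecSeq c d s1 s2 s3 : exec c s1 s2 -> exec d s2 s3 -> exec (CSeq c d) s1 s3
  | ExecStop e c s : eval s e = Nil -> exec (CWhile e c) s s
  | ExecLoop e c s1 s2 s3 : eval s1 e <> Nil ->
      exec c s1 s2 -> exec (CWhile e c) s2 s3 -> exec (CWhile e c) s1 s3.

(** Variable 0 holds the input at the start and the output at the end; all
    other variables start with [Nil]. *)
Definition computes (p : cmd) (input output : tree) : Prop :=
  exists2 s : store, exec p (update (fun=> Nil) 0 input) s & s 0 = output.

(** On [input], the program [p] halts with the truth value of [P]. *)
Definition answers (p : cmd) (input : tree) (P : Prop) : Prop :=
  (P -> computes p input tree_true) /\ (~ P -> computes p input tree_false).

Lemma exec_det (c : cmd) (s t u : store) : exec c s t -> exec c s u -> t = u.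
Proof.
move=> ct; elim: ct u => {c s t}.
- by move=> i e s u cu; inversion cu.
- move=> c d s1 s2 s3 _ IHc _ IHd u cu; inversion cu; subst.
  by apply: IHd; rewrite (IHc s4).
- by move=> e c s es u cu; inversion cu.
- move=> e c s1 s2 s3 es _ IHc _ IHw u cu; inversion cu; subst => //.
  by apply: IHw; rewrite (IHc s4).
Qed.

Fixpoint enc_nat (n : nat) : tree :=
  if n is n'.+1 then Cons Nil (enc_nat n') else Nil.

Definition enc_seq (T : Type) (enc : T -> tree) (s : seq T) : tree :=
  foldr (fun x t => Cons (enc x) t) Nil s.

(** The letter [(a, false)] is [a], and [(a, true)] is its formal inverse. *)
Definition letter (A : Type) : Type := (A * bool)%type.

Definition linv (A : Type) (l : letter A) : letter A := (l.1, ~~ l.2).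

Definition reduced (A : eqType) (w : seq (letter A)) : bool :=
  sorted (fun l l' => l' != linv l) w.

Definition enc_word (n : nat) (w : seq (letter 'I_n)) : tree :=
  enc_seq (fun l : letter 'I_n => Cons (enc_nat l.1) (tree_of_bool l.2)) w.

Section FreeGroup.
Variable A : choiceType.
Implicit Types (l : letter A) (u v w : seq (letter A)).

Definition lcons l w : seq (letter A) :=
  if w is l' :: w' then if l' == linv l then w' else l :: w else [:: l].

Definition reduce w : seq (letter A) := foldr lcons [::] w.

Definition winv w : seq (letter A) := rev (map (@linv A) w).

Lemma linvK : involutive (@linv A).
Proof. by move=> [a b]; rewrite /linv /= negbK. Qed.

Lemma reduced_lcons l w : reduced w -> reduced (lcons l w).
Proof.
case: w => //= l' w pw; case: eqP => [_|/eqP nl]; first exact: path_sorted pw.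
by rewrite /reduced /= nl.
Qed.

Lemma reduced_foldr u w : reduced w -> reduced (foldr lcons w u).
Proof. by move=> rw; elim: u => //= l u; exact: reduced_lcons. Qed.

Lemma reduced_reduce w : reduced (reduce w).
Proof. exact: reduced_foldr. Qed.

Lemma reduce_id w : reduced w -> reduce w = w.
Proof.
elim: w => //= l w IH pw; rewrite IH; last exact: path_sorted pw.
by case: w pw {IH} => //= l' w /andP[/negPf->].
Qed.

Lemma lconsK l w : reduced w -> lcons l (lcons (linv l) w) = w.
Proof.
case: w => [|l' w] /= pw; first by rewrite eqxx.
rewrite linvK; case: eqP => [El|_] /=; last by rewrite eqxx.
by subst l'; case: w pw => //= l' w /andP[/negPf->].
Qed.

Lemma foldr_lcons l u w : reduced w ->
  foldr lcons w (lcons l u) = lcons l (foldr lcons w u).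
Proof.
move=> rw; case: u => //= l' u; case: eqP => // ->.
by rewrite lconsK // reduced_foldr.
Qed.

Lemma foldr_reduce u w : reduced w ->
  foldr lcons w (reduce u) = foldr lcons w u.
Proof. by move=> rw; elim: u => //= l u IH; rewrite foldr_lcons // IH. Qed.

Lemma reduced_winv w : reduced w -> reduced (winv w).
Proof.
rewrite /reduced /winv rev_sorted sorted_map => sw.
apply: sub_sorted sw => l l' /=; apply: contra => /eqP El.
by rewrite -(linvK l') -El.
Qed.

Lemma foldr_winv u w : reduced w -> foldr lcons (foldr lcons w u) (winv u) = w.
Proof.
move=> rw; elim: u => //= l u IH.
rewrite /winv /= rev_cons foldr_rcons -[X in lcons _ (lcons X _)]linvK.
by rewrite lconsK // reduced_foldr.
Qed.

Lemma winvK : involutive winv.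
Proof. by move=> w; rewrite /winv map_rev revK mapK //; exact: linvK. Qed.

(** The free group on [A]: reduced words, multiplied by concatenation followed
    by free reduction. *)
Record free_group : Type :=
  FreeGroup { free_word :> seq (letter A); _ : reduced free_word }.

HB.instance Definition _ := [isSub for free_word].
HB.instance Definition _ := [Choice of free_group by <:].

Definition word_elt w : free_group := FreeGroup (reduced_reduce w).

Definition free_mul (x y : free_group) : free_group := word_elt (x ++ y).
Definition free_inv (x : free_group) : free_group := word_elt (winv x).

Lemma free_mulE x y : free_mul x y = foldr lcons y x :> seq _.
Proof. by case: y => y ry; rewrite /= /reduce foldr_cat -/(reduce y) reduce_id. Qed.

Lemma free_invE x : free_inv x = winv x :> seq _.
Proof. by case: x => x rx /=; rewrite reduce_id // reduced_winv. Qed.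

Fact free_mulA : associative free_mul.
Proof.
move=> x y z; apply: val_inj; rewrite [LHS]free_mulE [RHS]free_mulE free_mulE.
by rewrite /= foldr_reduce ?foldr_cat //; exact: valP z.
Qed.

Fact free_mul1 : left_id (word_elt [::]) free_mul.
Proof. by move=> x; apply: val_inj; exact: free_mulE. Qed.

Fact free_mulr1 : right_id (word_elt [::]) free_mul.
Proof.
by move=> x; apply: val_inj; rewrite [LHS]free_mulE; exact: reduce_id (valP x).
Qed.

Fact free_mulV : left_inverse (word_elt [::]) free_inv free_mul.
Proof.
move=> x; apply: val_inj; rewrite [LHS]free_mulE free_invE /=.
by rewrite -[RHS](foldr_winv x (isT : reduced [::])) -/(reduce x) reduce_id ?(valP x).
Qed.

Fact free_mulrV : right_inverse (word_elt [::]) free_inv free_mul.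
Proof.
move=> x; apply: val_inj; rewrite [LHS]free_mulE free_invE /=.
have rx := reduced_winv (valP x).
rewrite -[RHS](foldr_winv (winv x) (isT : reduced [::])) -/(reduce (winv x)).
by rewrite reduce_id // winvK.
Qed.

HB.instance Definition _ := isGroup.Build free_group
  free_mulA free_mul1 free_mulr1 free_mulV free_mulrV.

End FreeGroup.

(** Universal property: every map from the basis to a group extends uniquely to
    a homomorphism. *)
Definition is_free_basis (F : groupType) (I : Type) (b : I -> F) : Prop :=
  forall (K : groupType) (k : I -> K), exists phi : F -> K,
    [/\ {morph phi : x y / (x * y)%g >-> (x * y)%g},
        forall i, phi (b i) = k i &
        forall psi : F -> K, {morph psi : x y / (x * y)%g >-> (x * y)%g} ->
          (forall i, psi (b i) = k i) -> psi =1 phi].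

Record graph : Type := Graph {
  nvert : nat;
  nedge : nat;
  edge_src : {ffun 'I_nedge -> 'I_nvert};
  edge_tgt : {ffun 'I_nedge -> 'I_nvert}
}.

Notation vertex G := 'I_(nvert G).
Notation edge G := 'I_(nedge G).

(** Oriented edges are letters over the edges: [(e, true)] is [e] reversed. *)
Definition dsrc (G : graph) (d : letter (edge G)) : vertex G :=
  if d.2 then edge_tgt G d.1 else edge_src G d.1.
Definition dtgt (G : graph) (d : letter (edge G)) : vertex G :=
  dsrc (linv d).

Fixpoint edge_path (G : graph) (u : vertex G) (w : seq (letter (edge G)))
    (v : vertex G) : bool :=
  if w is d :: w' then (dsrc d == u) && edge_path (dtgt d) w' v else u == v.

(** The empty edge path encodes a constant map on the edge. *)
Record tight_map (G H : graph) : Type := TightMap {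
  vmap : {ffun vertex G -> vertex H};
  emap : {ffun edge G -> seq (letter (edge H))};
  emap_path : forall e : edge G,
    edge_path (vmap (edge_src G e)) (emap e) (vmap (edge_tgt G e));
  emap_tight : forall e : edge G, reduced (emap e)
}.

Definition enc_graph (G : graph) : tree :=
  Cons (enc_nat (nvert G))
    (enc_seq (fun e : edge G =>
        Cons (enc_nat (edge_src G e)) (enc_nat (edge_tgt G e)))
      (enum (edge G))).

Definition enc_tight_map (G H : graph) (f : tight_map G H) : tree :=
  Cons (Cons (enc_graph G) (enc_graph H))
    (Cons (enc_seq (fun v : vertex G => enc_nat (vmap f v)) (enum (vertex G)))
          (enc_seq (fun e : edge G => enc_word (emap f e)) (enum (edge G)))).

Local Open Scope classical_set_scope.
Local Open Scope ring_scope.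
Local Open Scope quotient_scope.

Definition unit_interval (R : realType) : Type := set_type `[0%R : R, 1%R].

HB.instance Definition _ (R : realType) :=
  Topological.on (unit_interval R).
HB.instance Definition _ (R : realType) :=
  SubType.on (unit_interval R).

Section UnitInterval.
Variable R : realType.
Local Notation I := (unit_interval R).

Fact clamp_subproof (t : R) :
  Num.max 0 (Num.min 1 t) \in (`[0, 1]%classic : set R).
Proof.
by rewrite inE /= in_itv /= le_max lexx ge_max ler01 ge_min lexx.
Qed.

(** Nearest-point retraction of the line onto the unit interval. *)
Definition clamp (t : R) : I := Sub (Num.max 0 (Num.min 1 t)) (clamp_subproof t).

Lemma clamp_continuous : continuous clamp.
Proof.
apply: (@continuous_comp_initial _ _ _ (set_val : I -> R)) => t.
apply: continuous_max; first exact: cst_continuous.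
by apply: continuous_min; [exact: cst_continuous|exact: cvg_id].
Qed.

Lemma clamp0 : val (clamp 0) = 0.
Proof. by rewrite /= min_r ?ler01 // maxxx. Qed.

Lemma clamp1 : val (clamp 1) = 1.
Proof. by rewrite /= minxx max_r ?ler01. Qed.

Fact clamp01_neq : clamp 0 != clamp 1.
Proof. by rewrite -val_eqE clamp0 clamp1 eq_sym oner_eq0. Qed.

HB.instance Definition _ := isBiPointed.Build I clamp01_neq.

Definition coord (t : I) : R := val t.

Lemma coord0 : coord zero = 0. Proof. exact: clamp0. Qed.

Lemma coord1 : coord one = 1. Proof. exact: clamp1. Qed.

Lemma coord_continuous : continuous coord.
Proof. exact: initial_continuous. Qed.

End UnitInterval.

Section Homotopy.
Variable R : realType.
Local Notation I := (unit_interval R).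

Definition path_homotopic (X : topologicalType) (x y : X)
    (p q : {path I from x to y}) : Prop :=
  exists F : I * I -> X,
    [/\ continuous F,
        forall s, F (s, zero) = p s,
        forall s, F (s, one) = q s &
        forall t, F (zero, t) = x /\ F (one, t) = y].

(** Injectivity of [[p]] |-> [[f \o p]] on homotopy classes of loops, at every
    base point. *)
Definition pi1_injective (X Y : topologicalType) (f : continuousType X Y) : Prop :=
  forall (x : X) (p q : {path I from x to x}),
    path_homotopic (f \o p : {path I from f x to f x})
                   (f \o q : {path I from f x to f x}) ->
    path_homotopic p q.

Definition homotopic (X Y : topologicalType) (f g : X -> Y) : Prop :=
  exists F : X * I -> Y,
    [/\ continuous F, forall x, F (x, zero) = f x & forall x, F (x, one) = g x].

Definition homotopy_equivalence (X Y : topologicalType)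
    (f : continuousType X Y) : Prop :=
  exists g : continuousType Y X,
    homotopic (g \o f) idfun /\ homotopic (f \o g) idfun.

End Homotopy.

Section Realization.
Variables (R : realType) (G : graph).
Local Notation I := (unit_interval R).

(** A 0-cell for each vertex and a 1-cell for each edge. *)
Definition cell (k : vertex G + edge G) : topologicalType :=
  match k with
  | inl _ => discrete_topology unit
  | inr _ => I
  end.

Definition cells : Type := {k : vertex G + edge G & cell k}.

HB.instance Definition _ := Topological.on cells.

Definition cell0 (v : vertex G) : cells := existT cell (inl v) tt.
Definition cell1 (e : edge G) (t : I) : cells := existT cell (inr e) t.

(** The attaching maps, extended by the identity off the ends of the 1-cells. *)
Definition attach (x : cells) : cells :=
  match x with
  | existT (inl v) _ => cell0 v
  | existT (inr e) t =>
      if t == zero then cell0 (edge_src G e)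
      else if t == one then cell0 (edge_tgt G e)
      else cell1 e t
  end.

Definition glue_rel (x y : cells) : bool := attach x == attach y.

Fact glue_refl : reflexive glue_rel.
Proof. by move=> x; exact: eqxx. Qed.

Fact glue_sym : symmetric glue_rel.
Proof. by move=> x y; exact: eq_sym. Qed.

Fact glue_trans : transitive glue_rel.
Proof. by move=> x y z; rewrite /glue_rel => /eqP->. Qed.

Definition glue : equiv_rel cells := EquivRel glue_rel glue_refl glue_sym glue_trans.

Definition geom : Type := {eq_quot glue}.

HB.instance Definition _ := Topological.copy geom (quotient_topology geom).
HB.instance Definition _ := Quotient.on geom.

Definition vpoint (v : vertex G) : geom := \pi_geom (cell0 v).
Definition epoint (e : edge G) (t : I) : geom := \pi_geom (cell1 e t).

Lemma vpoint_src (e : edge G) : epoint e zero = vpoint (edge_src G e).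
Proof. by apply/eqmodP; rewrite /= /glue_rel /= eqxx. Qed.

Lemma vpoint_tgt (e : edge G) : epoint e one = vpoint (edge_tgt G e).
Proof.
by apply/eqmodP; rewrite /= /glue_rel /= (eq_sym one) (negPf zero_one_neq) !eqxx.
Qed.

Lemma epoint_continuous (e : edge G) : continuous (epoint e).
Proof.
move=> t; apply: (@continuous_comp I cells geom (cell1 e) \pi_geom).
  exact: (@existT_continuous _ cell (inr e)).
exact: pi_continuous.
Qed.

(** An oriented edge, parametrized by the unit interval of the line. *)
Definition dpoint (d : letter (edge G)) (s : R) : geom :=
  epoint d.1 (clamp (if d.2 then 1 - s else s)).

(** An edge path starting at [v], at unit speed: the concatenation of its
    oriented edges. *)
Fixpoint path_point (v : vertex G) (w : seq (letter (edge G))) (s : R) : geom :=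
  if w is d :: w' then
    if s <= 1 then dpoint d s else path_point (dtgt d) w' (s - 1)
  else vpoint v.

Lemma dpoint0 (d : letter (edge G)) : dpoint d 0 = vpoint (dsrc d).
Proof.
case: d => e [] /=; rewrite /dpoint /dsrc /= ?subr0.
  exact: vpoint_tgt.
exact: vpoint_src.
Qed.

Lemma dpoint1 (d : letter (edge G)) : dpoint d 1 = vpoint (dtgt d).
Proof.
case: d => e [] /=; rewrite /dpoint /dtgt /dsrc /= ?subrr.
  exact: vpoint_src.
exact: vpoint_tgt.
Qed.

Lemma dpoint_continuous (d : letter (edge G)) : continuous (dpoint d).
Proof.
move=> s; apply: continuous_comp; last exact: epoint_continuous.
apply: continuous_comp; last exact: clamp_continuous.
case: d.2; last exact: cvg_id.
by apply: cvgB; [exact: cvg_cst|exact: cvg_id].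
Qed.

Lemma path_point0 (u v : vertex G) (w : seq (letter (edge G))) :
  edge_path u w v -> path_point u w 0 = vpoint u.
Proof. by case: w => //= d w /andP[/eqP<- _]; rewrite ler01 dpoint0. Qed.

Lemma path_point_size (u v : vertex G) (w : seq (letter (edge G))) :
  edge_path u w v -> path_point u w (size w)%:R = vpoint v.
Proof.
elim: w u => [|d w IH] u /=; first by move/eqP->.
move=> /andP[_ pw]; rewrite -natr1 addrK gerDr; case: ifP => [|_]; last exact: IH.
rewrite lern0 size_eq0 => /eqP w0; subst w.
by move: pw => /= /eqP<-; rewrite add0r dpoint1.
Qed.

Lemma path_point_continuous (u v : vertex G) (w : seq (letter (edge G))) :
  edge_path u w v -> continuous (path_point u w).
Proof.
elim: w u => [|d w IH] u /=; first by move=> _ ?; exact: cvg_cst.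
move=> /andP[_ pw].
set g := (X in continuous X).
apply/continuous_subspace_setT.
have -> : [set: R] = [set` `]-oo, 1]] `|` [set` `[1, +oo[].
  apply/seteqP; split => // s _ /=; rewrite !in_itv /= andbT.
  by case: (leP s 1) => [|/ltW]; [left|right].
apply: withinU_continuous; try exact: interval_closed.
  have eg : {in [set` `]-oo, 1]], dpoint d =1 g}.
    by move=> s; rewrite inE /= in_itv /g /= => ->.
  apply: (subspace_eq_continuous eg).
  exact/continuous_subspaceT/dpoint_continuous.
have eg : {in [set` `[1, +oo[], (fun s => path_point (dtgt d) w (s - 1)) =1 g}.
  move=> s; rewrite inE /= in_itv /g /= andbT le_eqVlt => /predU1P[<-|s1].
    by rewrite lexx subrr dpoint1 (path_point0 pw).
  by rewrite leNgt s1.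
apply: (subspace_eq_continuous eg).
apply/continuous_subspaceT => s.
apply: (@continuous_comp _ _ _ (fun s : R => s - 1) (path_point (dtgt d) w)).
  by apply: cvgB; [exact: cvg_id|exact: cvg_cst].
exact: IH pw _.
Qed.

End Realization.

Section RealizationMap.
Variables (R : realType) (G H : graph) (f : tight_map G H).

(** Each edge runs through its image edge path at constant speed. *)
Definition cell_map (x : cells R G) : geom R H :=
  match x with
  | existT (inl v) _ => vpoint R (vmap f v)
  | existT (inr e) t =>
      path_point (vmap f (edge_src G e)) (emap f e)
        ((size (emap f e))%:R * coord t)
  end.

Definition realize : geom R G -> geom R H := cell_map \o repr.

Lemma cell_map_attach (x : cells R G) : cell_map (attach x) = cell_map x.
Proof.
case: x => -[v //|e t] /=; case: eqP => [->|_] /=.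
  by rewrite coord0 mulr0 (path_point0 _ (emap_path f e)).
case: eqP => [->|_] //=.
by rewrite coord1 mulr1 (path_point_size _ (emap_path f e)).
Qed.

Lemma cell_map_continuous : continuous cell_map.
Proof.
have cE : cell_map = (fun x => cell_map (existT (@cell R G) (tag x) (tagged x))).
  by apply/funext => -[].
rewrite cE; apply: (@sigT_continuous _ (@cell R G) _
  (fun k (t : @cell R G k) => cell_map (existT (@cell R G) k t))) => -[v|e] t /=.
  exact: cvg_cst.
apply: (@continuous_comp _ R _ (fun t : unit_interval R => (size (emap f e))%:R * coord t)).
  apply: (@cvgM _ _ (nbhs (t : unit_interval R)) _ (fun=> (size (emap f e))%:R) (@coord R)).
    exact: cvg_cst.
  exact: coord_continuous.
exact: path_point_continuous (emap_path f e) _.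
Qed.

Lemma realize_continuous : continuous realize.
Proof.
apply: repr_comp_continuous; first exact: cell_map_continuous.
move=> x y /eqP/eqmodP/eqP xy; apply/eqP.
by rewrite -(cell_map_attach x) xy cell_map_attach.
Qed.

HB.instance Definition _ := isContinuous.Build _ _ realize realize_continuous.

End RealizationMap.

Arguments realize R [G H] f.

Definition connected_graph (R : realType) (G : graph) : Prop :=
  [set: geom R G] !=set0 /\ connected [set: geom R G].

(* Main.v *)
(** Label the edges of [G] by their images in the free group on the edges of
    [H]. A step of Stallings' folding either collapses a non-loop with trivial
    label or replaces, for two edges with the same label and a common end, the
    second by a trivially labelled edge between the other ends; both preserve
    the injectivity and the image of the label map. The process stops at a graph
    that either has a loop with trivial label, so that the map is not injective,
    or is folded, so that reduced edge paths have reduced labels: then the map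
    is injective, and it is onto iff some vertex carries a loop for each letter.
    For surjectivity onto the fundamental group of [H], the edges of [H] that
    are not loops are collapsed first, and erased from the labels.

    On the topological side, [tau] is a cocycle, locally a coboundary, with
    values in the free group on the edges, and integrating it along a path gives
    the homotopy invariant [omega]. Conversely, two maps that are compatible
    with [tau] are joined by the homotopy that follows the geodesics of the
    universal cover. So paths are homotopic iff they have the same [omega]; and
    a map inducing a bijection of the edge loop groups has an inverse, which
    sends all vertices of [H] to the base vertex and is homotopic to an inverse
    by the same geodesic construction. *)

From HB Require Import structures.
From mathcomp Require Import all_boot all_order all_algebra.
From mathcomp Require Import all_classical all_reals all_analysis homotopy.
From mathcomp Require Import ring lra.
Require Import Defs.
Set Implicit Arguments.
Unset Strict Implicit.
Unset Printing Implicit Defensive.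

(** * Computable functions on trees *)

(** Both topological criteria are reduced to the label map on edge-path groupoids. Groupoids rather
    than fundamental groups spare the choice of spanning trees; each move on labelled graphs is a
    functor with an inverse up to conjugation by paths, so one transfer principle covers all moves.
    Labels that are words are subdivided into letters before folding, each chain being closed by one
    trivially labelled edge, so that a fold only has to compare letters. On the topological side no
    covering space is constructed. A point is described by a reference vertex and a position on an
    edge, and for nearby points [tau x y] is the edge path between their reference vertices. The
    obstacle is that the reference vertex jumps as a point moves: the geodesic formula must not
    depend on the vertex or the edge by which an endpoint is described, and the invariance lemmas
    for [geo] establish this. *)

Fixpoint shift_expr (e : expr) : expr :=
  match e with
  | EVar i => EVar i.+1
  | EQuote t => EQuote t
  | ECons e1 e2 => ECons (shift_expr e1) (shift_expr e2)
  | EHd e1 => EHd (shift_expr e1)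
  | ETl e1 => ETl (shift_expr e1)
  | EEq e1 e2 => EEq (shift_expr e1) (shift_expr e2)
  end.

Fixpoint shift_cmd (c : cmd) : cmd :=
  match c with
  | CAssign i e => CAssign i.+1 (shift_expr e)
  | CSeq c1 c2 => CSeq (shift_cmd c1) (shift_cmd c2)
  | CWhile e c1 => CWhile (shift_expr e) (shift_cmd c1)
  end.

Lemma eval_shift (s t : store) e : (forall i, t i.+1 = s i) ->
  eval t (shift_expr e) = eval s e.
Proof. by move=> st; elim: e => //= [e1 -> e2 ->|e1 ->|e1 ->|e1 -> e2 ->]. Qed.

Lemma exec_shift c s s' : exec c s s' -> forall t, (forall i, t i.+1 = s i) ->
  exists2 t', exec (shift_cmd c) t t' & (forall i, t' i.+1 = s' i) /\ t' 0 = t 0.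
Proof.
elim=> {c s s'} [i e s|c d s1 s2 s3 _ IHc _ IHd|e c s es|e c s1 s2 s3 es _ IHc _ IHw] t st.
- exists (update t i.+1 (eval t (shift_expr e))); first exact: ExecAssign.
  by split=> // j; rewrite /update eqSS (eval_shift _ st) st.
- have [t2 ct2 [st2 t20]] := IHc t st; have [t3 dt3 [st3 t30]] := IHd t2 st2.
  by exists t3; [exact: ExecSeq ct2 dt3|rewrite t30].
- by exists t => //; apply: ExecStop; rewrite (eval_shift _ st).
- have [t2 ct2 [st2 t20]] := IHc t st; have [t3 dt3 [st3 t30]] := IHw t2 st2.
  exists t3; last by rewrite t30.
  by apply: ExecLoop ct2 dt3; rewrite (eval_shift _ st).
Qed.

(** Values of the other variables do not matter, so programs compose. *)
Definition computable (f : tree -> tree) : Prop :=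
  exists p, forall s, exists2 s', exec p s s' & s' 0 = f (s 0).

(** This is the calling convention for subroutines: each shift frees one more low variable that the
    program cannot touch, and there the caller keeps its intermediate results. *)
Lemma computable_at f k : computable f -> exists p, forall s, exists2 s',
  exec p s s' & s' k = f (s k) /\ forall i, i < k -> s' i = s i.
Proof.
move=> [p pP]; elim: k => [|k [q qP]].
  by exists p => s; have [s' ? ?] := pP s; exists s'.
exists (shift_cmd q) => s; have [s' qs' [s'k s'i]] := qP (fun i => s i.+1).
have [t qt [tS t0]] := exec_shift qs' (fun i => erefl (s i.+1)).
by exists t => //; split=> [|[//|i] ik]; rewrite tS ?s'k ?s'i.
Qed.

Lemma eq_computable f g : f =1 g -> computable f -> computable g.
Proof.
by move=> fg [p pP]; exists p => s; have [s' ? e] := pP s; exists s'; rewrite ?e ?fg.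
Qed.

Definition thd (t : tree) : tree := if t is Cons a _ then a else Nil.
Definition ttl (t : tree) : tree := if t is Cons _ b then b else Nil.
Definition teq (s t : tree) : tree := tree_of_bool (tree_eqb s t).
Definition tif (c a b : tree) : tree := if c is Nil then b else a.
Fixpoint tfold (f : tree -> tree -> tree) (a l : tree) : tree :=
  if l is Cons x l' then tfold f (f x a) l' else a.

Lemma computable_assign e f : (forall s, eval s e = f (s 0)) -> computable f.
Proof.
move=> ef; exists (CAssign 0 e) => s; exists (update s 0 (eval s e)).
  exact: ExecAssign.
by rewrite /update /= ef.
Qed.

Lemma computable_id : computable id.
Proof. exact: (@computable_assign (EVar 0)). Qed.

Lemma computable_const t : computable (fun=> t).
Proof. exact: (@computable_assign (EQuote t)). Qed.

Lemma computable_comp f g : computable f -> computable g ->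
  computable (fun x => g (f x)).
Proof.
move=> [p pP] [q qP]; exists (CSeq p q) => s.
have [s1 ps1 s10] := pP s; have [s2 qs2 s20] := qP s1.
by exists s2; [exact: ExecSeq ps1 qs2|rewrite s20 s10].
Qed.

Lemma computable_cons f g : computable f -> computable g ->
  computable (fun x => Cons (f x) (g x)).
Proof.
move=> /(computable_at 1)[p pP] /(computable_at 2)[q qP].
exists (CSeq (CAssign 1 (EVar 0)) (CSeq p (CSeq (CAssign 2 (EVar 0)) (CSeq q
  (CAssign 0 (ECons (EVar 1) (EVar 2))))))) => s.
have [s1 ps1 [s11 s1i]] := pP (update s 1 (s 0)).
have [s2 qs2 [s22 s2i]] := qP (update s1 2 (s1 0)).
exists (update s2 0 (Cons (s2 1) (s2 2))).
  do ![apply: ExecSeq]; [exact: ExecAssign|exact: ps1|exact: ExecAssign|exact: qs2|].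
  exact: ExecAssign.
by rewrite /update /= s22 s2i //= /update /= s11 /update /= s1i.
Qed.

Lemma computable_hd f : computable f -> computable (fun x => thd (f x)).
Proof.
by move=> cf; apply: (computable_comp cf); exact: (@computable_assign (EHd (EVar 0))).
Qed.

Lemma computable_tl f : computable f -> computable (fun x => ttl (f x)).
Proof.
by move=> cf; apply: (computable_comp cf); exact: (@computable_assign (ETl (EVar 0))).
Qed.

Lemma computable_eq f g : computable f -> computable g ->
  computable (fun x => teq (f x) (g x)).
Proof.
move=> cf cg; have := computable_cons cf cg => /computable_comp.
move=> /(_ (fun z => teq (thd z) (ttl z))); apply.
exact: (@computable_assign (EEq (EHd (EVar 0)) (ETl (EVar 0)))).
Qed.

(** Two loops simulate the conditional. Variable 1 holds the condition and variable 2 a flag; either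
    branch clears both, so each loop runs at most once, and the second one only if the first did
    not. *)
Lemma computable_if c f g : computable c -> computable f -> computable g ->
  computable (fun x => tif (c x) (f x) (g x)).
Proof.
move=> /(computable_at 1)[r rP] /(computable_at 3)[p pP] /(computable_at 3)[q qP].
pose call p := CSeq (CAssign 3 (EVar 0)) (CSeq p (CSeq (CAssign 0 (EVar 3))
  (CSeq (CAssign 1 (EQuote Nil)) (CAssign 2 (EQuote Nil))))).
have callP h p' : (forall s, exists2 s', exec p' s s' &
      s' 3 = h (s 3) /\ forall i, i < 3 -> s' i = s i) ->
    forall s, exists2 s', exec (call p') s s' &
      [/\ s' 0 = h (s 0), s' 1 = Nil & s' 2 = Nil].
  move=> hP s; have [s1 ps1 [s13 s1i]] := hP (update s 3 (s 0)).
  eexists.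
    do ![apply: ExecSeq]; [exact: ExecAssign|exact: ps1|exact: ExecAssign| |];
      exact: ExecAssign.
  by rewrite /update /= s13.
exists (CSeq (CAssign 1 (EVar 0)) (CSeq r (CSeq (CAssign 2 (EQuote tree_true))
  (CSeq (CWhile (EVar 1) (call p)) (CWhile (EVar 2) (call q)))))) => s.
have [s1 rs1 [s11 s1i]] := rP (update s 1 (s 0)).
set s2 := update s1 2 tree_true.
have s20 : s2 0 = s 0 by rewrite /s2 /update /= s1i.
have s21 : s2 1 = c (s 0) by rewrite /s2 /update /= s11.
have [s3 ws3 [s30 s32]] : exists2 s3, exec (CWhile (EVar 1) (call p)) s2 s3 &
    s3 0 = tif (c (s 0)) (f (s 0)) (s 0) /\ s3 2 = tif (c (s 0)) Nil tree_true.
  case E : (c (s 0)) => [|c1 c2].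
    by exists s2; [apply: ExecStop; rewrite /= s21|rewrite s20].
  have [s3 ps3 [s30 s31 s32]] := callP f p pP s2.
  exists s3; last by rewrite s30 s20.
  by apply: ExecLoop ps3 _; [rewrite /= s21 E|apply: ExecStop].
have [s4 ws4 s40] : exists2 s4, exec (CWhile (EVar 2) (call q)) s3 s4 &
    s4 0 = tif (c (s 0)) (f (s 0)) (g (s 0)).
  move: s30 s32; case: (c (s 0)) => [|c1 c2] /= s30 s32.
    have [s4 qs4 [s40 s41 s42]] := callP g q qP s3.
    exists s4; last by rewrite s40 s30.
    by apply: ExecLoop qs4 _; [rewrite /= s32|apply: ExecStop].
  by exists s3 => //; apply: ExecStop.
exists s4 => //; do ![apply: ExecSeq]; [exact: ExecAssign|exact: rs1| | |exact: ws4].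
  exact: ExecAssign.
exact: ws3.
Qed.

(** The rest of the list is kept in variable 1; the body works in variable 2, hence cannot damage
    it. *)
Lemma computable_fold0 (f : tree -> tree) a l :
  computable f -> computable a -> computable l ->
  computable (fun i => tfold (fun x acc => f (Cons x acc)) (a i) (l i)).
Proof.
move=> /(computable_at 2)[p pP] /(computable_at 2)[q qP] /(computable_at 1)[r rP].
pose body := CSeq (CAssign 2 (ECons (EHd (EVar 1)) (EVar 2)))
  (CSeq (CAssign 1 (ETl (EVar 1))) p).
exists (CSeq (CAssign 1 (EVar 0)) (CSeq r (CSeq (CAssign 2 (EVar 0)) (CSeq q
  (CSeq (CWhile (EVar 1) body) (CAssign 0 (EVar 2))))))) => s.
have [s1 rs1 [s11 s1i]] := rP (update s 1 (s 0)).
have [s2 qs2 [s22 s2i]] := qP (update s1 2 (s1 0)).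
have loop t : exists2 t', exec (CWhile (EVar 1) body) t t' &
    t' 2 = tfold (fun x acc => f (Cons x acc)) (t 2) (t 1).
  move E : (t 1) => u; elim: u t E => [|x _ u IH] t E.
    by exists t => //; exact: ExecStop.
  set t1 := update t 2 (Cons x (t 2)); set t2 := update t1 1 u.
  have [t3 pt3 [t32 t3i]] := pP t2.
  have [t4 wt4 t42] : exists2 t', exec (CWhile (EVar 1) body) t3 t' &
    t' 2 = tfold (fun x acc => f (Cons x acc)) (t3 2) u by apply: IH; rewrite t3i.
  exists t4; last by rewrite t42 t32.
  apply: ExecLoop wt4; first by rewrite /= E.
  apply: (@ExecSeq _ _ _ t1).
    have -> : t1 = update t 2 (eval t (ECons (EHd (EVar 1)) (EVar 2))) by rewrite /= E.
    exact: ExecAssign.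
  apply: (@ExecSeq _ _ _ t2) pt3.
  have -> : t2 = update t1 1 (eval t1 (ETl (EVar 1))) by rewrite /= {2}/t1 /update /= E.
  exact: ExecAssign.
have [s3 ws3 s32] := loop s2.
exists (update s3 0 (s3 2)).
  do ![apply: ExecSeq]; [exact: ExecAssign|exact: rs1|exact: ExecAssign|exact: qs2|exact: ws3|].
  exact: ExecAssign.
by rewrite /update /= s32 s22 s2i //= /update /= s11 /update /= s1i.
Qed.

Definition computable2 (f : tree -> tree -> tree) : Prop :=
  computable (fun z => f (thd z) (ttl z)).
Definition computable3 (f : tree -> tree -> tree -> tree) : Prop :=
  computable (fun z => f (thd z) (thd (ttl z)) (ttl (ttl z))).

Lemma computable_app2 f a b : computable2 f -> computable a -> computable b ->
  computable (fun x => f (a x) (b x)).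
Proof. by move=> cf ca cb; exact: (computable_comp (computable_cons ca cb) cf). Qed.

Lemma computable_app3 f a b c : computable3 f -> computable a -> computable b ->
  computable c -> computable (fun x => f (a x) (b x) (c x)).
Proof.
move=> cf ca cb cc.
exact: (computable_comp (computable_cons ca (computable_cons cb cc)) cf).
Qed.

Lemma computable_fold (f : tree -> tree -> tree -> tree) e a l :
  computable3 f -> computable e -> computable a -> computable l ->
  computable (fun i => tfold (f (e i)) (a i) (l i)).
Proof.
move=> cf ce ca cl.
(* The body of the loop sees only the list element and the accumulator, so the parameter [e i]
   travels inside the accumulator. *)
pose g z := Cons (f (ttl (ttl z)) (thd z) (thd (ttl z))) (ttl (ttl z)).
have cg : computable g.
  have c1 := computable_hd computable_id; have c2 := computable_tl computable_id.
  apply: computable_cons; last exact: computable_tl.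
  by apply: computable_app3 => //; [exact: computable_tl|exact: computable_hd].
have := computable_hd (computable_fold0 cg (computable_cons ca ce) cl).
apply: eq_computable => i.
by elim: (l i) (a i) => //= x _ u IH b; rewrite IH.
Qed.

(** A negative answer has to be exactly [tree_false], hence the requirement that the value be a
    boolean. *)
Lemma answers_computable f : computable f -> exists p, forall i (P : Prop) b,
  f i = tree_of_bool b -> (P <-> f i = tree_true) -> answers p i P.
Proof.
move=> [p pP]; exists p => i P b fb Pf.
have [s ps s0] := pP (update (fun=> Nil) 0 i).
have fi : s 0 = f i by [].
split=> iP; exists s => //; rewrite fi; first exact/Pf.
by rewrite fb; case: b fb => // fb; case: iP; apply/Pf.
Qed.

Lemma tree_eqP : Equality.axiom tree_eqb.
Proof.
elim=> [|s1 IH1 s2 IH2] [|t1 t2] /=; try by constructor.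
apply: (iffP andP) => [[/IH1-> /IH2->]//|[<- <-]].
by split; [exact/IH1|exact/IH2].
Qed.

HB.instance Definition _ := hasDecEq.Build tree tree_eqP.
HB.instance Definition _ := gen_choiceMixin tree.

Lemma teqE s t : teq s t = tree_of_bool (s == t). Proof. by []. Qed.

Lemma tif_bool b x y : tif (tree_of_bool b) x y = if b then x else y.
Proof. by case: b. Qed.

Definition tnot b := tif b Nil tree_true.
Definition tand a b := tif a b Nil.
Definition tor a b := tif a tree_true b.

Lemma tandE a b : tand (tree_of_bool a) (tree_of_bool b) = tree_of_bool (a && b).
Proof. by case: a; case: b. Qed.
Lemma torE a b : tor (tree_of_bool a) (tree_of_bool b) = tree_of_bool (a || b).
Proof. by case: a; case: b. Qed.

Fixpoint spine (t : tree) : seq tree := if t is Cons a b then a :: spine b else [::].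

Lemma spine_enc (T : Type) (enc : T -> tree) s : spine (enc_seq enc s) = map enc s.
Proof. by elim: s => //= x s ->. Qed.

Lemma tfoldE f a l : tfold f a l = foldl (fun b x => f x b) a (spine l).
Proof. by elim: l a => //= x _ u IH a; rewrite IH. Qed.

Lemma spine_tfold_cons f a l :
  spine (tfold (fun x acc => Cons (f x) acc) a l) = rev (map f (spine l)) ++ spine a.
Proof.
elim: l a => //= x _ u IH a.
by rewrite IH rev_cons cat_rcons.
Qed.

Lemma tfold_iter f a l :
  tfold (fun _ acc => f acc) a l = iter (size (spine l)) f a.
Proof. by elim: l a => //= x _ u IH a; rewrite IH -iterSr. Qed.

Ltac comp_step :=
  first [exact: computable_const | exact: computable_id
    | apply: computable_hd | apply: computable_tl | apply: computable_cons
    | apply: computable_eq | apply: computable_if].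
Ltac comp := repeat comp_step.

(** * The folding algorithm on lists of labelled edges *)

(** The edge from [u] to [v] labelled [l]; the label [Nil] is trivial and
    [Cons a Nil] is the letter [a]. *)
Definition mk (u l v : tree) : tree := Cons u (Cons l v).
Definition esrc e := thd e.
Definition elab e := thd (ttl e).
Definition etgt e := ttl (ttl e).

Definition renm (u v w : tree) : tree := tif (teq w v) u w.
Definition rene (z e : tree) : tree :=
  mk (renm (thd z) (ttl z) (esrc e)) (elab e) (renm (thd z) (ttl z) (etgt e)).
Definition renl (u v es : tree) : tree :=
  tfold (fun e acc => Cons (rene (Cons u v) e) acc) Nil es.

Lemma computable_renl : computable3 renl.
Proof.
apply: (computable_fold (f := fun z e acc => Cons (rene z e) acc)
  (e := fun x => Cons (thd x) (thd (ttl x)))); rewrite /computable3; comp.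
Qed.

(** The state pairs the result of the search with the elements passed over. A hit is stored as
    [Cons e Nil], which differs from the empty result even if [e] is [Nil]. *)
Definition pick_step (P : tree -> tree -> tree) (env e st : tree) : tree :=
  tif (thd st) (Cons (thd st) (Cons e (ttl st)))
    (tif (P env e) (Cons (Cons e Nil) (ttl st)) (Cons Nil (Cons e (ttl st)))).
Definition pick2 P env es : tree := tfold (pick_step P env) (Cons Nil Nil) es.

Lemma computable_pick2 P : computable2 P -> computable2 (pick2 P).
Proof.
move=> cP; apply: (computable_fold (f := pick_step P)); rewrite /computable3; comp.
by apply: (computable_app2 cP); comp.
Qed.

Definition tclash (e e' : tree) : tree :=
  tand (teq (elab e) (elab e'))
    (tor (teq (esrc e) (esrc e')) (teq (etgt e) (etgt e'))).

(** Each edge is compared with those already passed over, which are free of clashes as long as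
    nothing has been found. *)
Definition pair_step (e st : tree) : tree :=
  let r := pick2 tclash e (ttl st) in
  tif (thd st) (Cons (thd st) (Cons e (ttl st)))
    (tif (thd r) (Cons (Cons (thd (thd r)) e) (ttl r)) (Cons Nil (Cons e (ttl st)))).
Definition find_pair (es : tree) : tree := tfold pair_step (Cons Nil Nil) es.

Lemma computable_find_pair : computable find_pair.
Proof.
have cp : computable2 (pick2 tclash) by apply: computable_pick2; rewrite /computable2; comp.
have cr : computable (fun z => pick2 tclash (thd (ttl z)) (ttl (ttl (ttl z)))).
  by apply: (computable_app2 cp); comp.
apply: (computable_fold (f := fun _ => pair_step) (e := fun=> Nil));
  rewrite /computable3 /pair_step; comp; exact: cr.
Qed.

Definition is_eps (_ e : tree) : tree := tnot (elab e).

(** A trivially labelled edge takes precedence; if it is a loop the process halts, the label map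
    being non-injective. The direction of the new trivial edge is the one produced by the slide
    moves, with label [x^-1 * x] or [x * x^-1]. *)
Definition fold_step (es : tree) : tree :=
  let r := pick2 is_eps Nil es in
  let e := thd (thd r) in
  let q := find_pair es in
  let e1 := thd (thd q) in
  let e2 := ttl (thd q) in
  tif (thd r)
    (tif (teq (esrc e) (etgt e)) es (renl (esrc e) (etgt e) (ttl r)))
    (tif (thd q)
      (Cons e1 (Cons (tif (teq (esrc e1) (esrc e2)) (mk (etgt e1) Nil (etgt e2))
                        (mk (esrc e2) Nil (esrc e1))) (ttl q))) es).

Lemma computable_pick_eps : computable (pick2 is_eps Nil).
Proof.
have cp : computable2 (pick2 is_eps) by apply: computable_pick2; rewrite /computable2; comp.
by apply: (computable_app2 cp); comp.
Qed.

Lemma computable_fold_step : computable fold_step.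
Proof.
have cr := computable_pick_eps; have cq := computable_find_pair.
rewrite /fold_step; comp; try exact: cr; try exact: cq.
by apply: (computable_app3 computable_renl); comp; exact: cr.
Qed.

(** The list itself serves twice as a counter, because [fold_measure] is at most twice its
    length. *)
Definition fold_all (es : tree) : tree :=
  tfold (fun _ acc => fold_step acc) (tfold (fun _ acc => fold_step acc) es es) es.

Lemma computable_fold_all : computable fold_all.
Proof.
have cs : computable3 (fun _ _ acc => fold_step acc).
  by apply: (computable_comp _ computable_fold_step); comp.
apply: (computable_fold (f := fun _ _ acc => fold_step acc) (e := fun=> Nil)) => //; comp.
by apply: (computable_fold (f := fun _ _ acc => fold_step acc) (e := fun=> Nil)) => //; comp.
Qed.

(** To be applied to a stuck graph, where a trivially labelled edge can remain only if there is a
    trivially labelled loop. *)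
Definition injective_test (es : tree) : tree := tnot (thd (pick2 is_eps Nil es)).

Lemma computable_injective_test : computable injective_test.
Proof. rewrite /injective_test; comp; exact: computable_pick_eps. Qed.

(** * Correctness of the searches *)

Section PickSpec.
Variables (P : tree -> tree -> tree) (p : tree -> tree -> bool).
Hypothesis PE : forall z e, P z e = tree_of_bool (p z e).

Lemma pick2P z es : let r := pick2 P z es in
  [/\ thd r = Nil, all (fun e => ~~ p z e) (spine es) &
      perm_eq (spine es) (spine (ttl r))] \/
  (exists e, [/\ thd r = Cons e Nil, p z e & perm_eq (spine es) (e :: spine (ttl r))]).
Proof.
rewrite /pick2 tfoldE; elim/last_ind: (spine es) => [|s x IH]; first by left.
rewrite foldl_rcons; set r := foldl _ _ s in IH *; rewrite /pick_step all_rcons.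
have cx t : perm_eq s t -> perm_eq (rcons s x) (x :: t).
  by move=> st; rewrite perm_rcons perm_cons.
case: IH => [[-> a st]|[e [-> pe st]]].
  rewrite /= PE tif_bool; case: ifP => px; last by left; rewrite a; split=> //; exact: cx.
  by right; exists x; split=> //; exact: cx.
right; exists e; split=> //=; apply: (perm_trans (cx _ st)).
by rewrite (perm_catCA [:: x] [:: e]).
Qed.

End PickSpec.

Definition clashb (e e' : tree) : bool :=
  (elab e == elab e') && ((esrc e == esrc e') || (etgt e == etgt e')).

Lemma tclashE e e' : tclash e e' = tree_of_bool (clashb e e').
Proof. by rewrite /tclash !teqE torE tandE. Qed.

Lemma clashbC e e' : clashb e e' = clashb e' e.
Proof.
by rewrite /clashb (eq_sym (elab e)) (eq_sym (esrc e)) (eq_sym (etgt e)).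
Qed.

Lemma find_pairP es : let r := find_pair es in
  (thd r = Nil /\ pairwise (fun e e' => ~~ clashb e e') (spine es)) \/
  (exists e1 e2, [/\ thd r = Cons e1 e2, clashb e1 e2 &
     perm_eq (spine es) (e1 :: e2 :: spine (ttl r))]).
Proof.
rewrite /find_pair tfoldE.
(* The failing case is strengthened by the permutation: it shows that the next edge is compared with
   all earlier ones. *)
set r := foldl _ _ _; suff: [/\ thd r = Nil, perm_eq (spine es) (spine (ttl r)) &
    pairwise (fun e e' => ~~ clashb e e') (spine es)] \/
  (exists e1 e2, [/\ thd r = Cons e1 e2, clashb e1 e2 &
     perm_eq (spine es) (e1 :: e2 :: spine (ttl r))]) by case=> [[? ? ?]|]; [left|right].
rewrite /r {r}; elim/last_ind: (spine es) => [|s x IH]; first by left.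
rewrite foldl_rcons; set r := foldl _ _ s in IH *; rewrite /pair_step pairwise_rcons.
case: IH => [[r0 st ps]|[e1 [e2 [-> ce st]]]]; last first.
  right; exists e1, e2; split=> //=.
  apply: (@perm_trans _ (x :: [:: e1, e2 & spine (ttl r)])).
    by rewrite perm_rcons perm_cons.
  by rewrite (perm_catCA [:: x] [:: e1; e2]).
have := pick2P tclashE x (ttl r); rewrite r0 /=.
set q := pick2 _ _ _; case=> [[q0 a st']|[e [qe ce st']]]; rewrite ?q0 ?qe /=.
  left; split=> //; first by rewrite perm_rcons perm_cons.
  rewrite ps andbT; apply/allP => e es'; rewrite clashbC.
  by apply: (allP a); rewrite -(perm_mem st).
right; exists e, x; split=> //; first by rewrite clashbC.
apply: (@perm_trans _ (x :: e :: spine (ttl q))).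
  by rewrite perm_rcons perm_cons; exact: perm_trans st st'.
by rewrite (perm_catCA [:: x] [:: e]).
Qed.

Local Open Scope group_scope.

(** * Free groups *)

Ltac gsimp := rewrite ?(invgM, invgK, invg1, mulg1, mul1g, mulgV, mulVg) -?mulgA
  ?(mulKg, mulVKg, mulgV, mulVg, mulg1, mul1g).

Definition is_hom (F K : groupType) (f : F -> K) : Prop :=
  {morph f : x y / x * y >-> x * y}.

Section Hom.
Variables (F K : groupType) (f : F -> K).
Hypothesis fM : is_hom f.

Lemma hom1 : f 1 = 1.
Proof. by apply: (mulgI (f 1)); rewrite mulg1 -fM mulg1. Qed.

Lemma homV x : f x^-1 = (f x)^-1.
Proof. by apply: (mulgI (f x)); rewrite -fM !mulgV hom1. Qed.

Lemma hom_comp (L : groupType) (h : K -> L) : is_hom h -> is_hom (h \o f).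
Proof. by move=> hM x y; rewrite /= fM hM. Qed.

Lemma hom_inj : (forall x, f x = 1 -> x = 1) -> injective f.
Proof.
by move=> fk x y fxy; apply: divg1_eq; apply: fk; rewrite fM homV fxy mulgV.
Qed.
End Hom.

Section FreeHom.
Variable A : choiceType.
Local Notation F := (free_group A).
Implicit Types (a : A) (l : letter A) (w u v : seq (letter A)).

Definition lgen (l : letter A) : F := word_elt [:: l].
Definition gen (a : A) : F := lgen (a, false).

Lemma free_mulgE (x y : F) : (x * y : F) = reduce (x ++ y) :> seq _.
Proof. by []. Qed.

Lemma free_invgE (x : F) : (x^-1 : F) = winv x :> seq _.
Proof. exact: free_invE. Qed.

Lemma lgen_mul (l : letter A) (x : F) : (lgen l * x : F) = lcons l x :> seq _.
Proof.
by rewrite -[LHS]/(lcons l (reduce x)) reduce_id //; exact: valP x.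
Qed.

Lemma lgenV l : (lgen l)^-1 = lgen (linv l).
Proof. by apply: val_inj; exact: free_invgE. Qed.

Lemma lgenT a : lgen (a, true) = (gen a)^-1.
Proof. by rewrite lgenV. Qed.

Lemma word_elt_cons l w : word_elt (l :: w) = lgen l * word_elt w.
Proof. by apply: val_inj; rewrite [RHS]lgen_mul. Qed.

Lemma word_elt_cat u v : word_elt (u ++ v) = word_elt u * word_elt v.
Proof.
elim: u => [|l u IH]; first by rewrite mul1g.
by rewrite cat_cons !word_elt_cons IH mulgA.
Qed.

Lemma word_eltK (x : F) : word_elt x = x.
Proof. by apply: val_inj; exact: reduce_id (valP x). Qed.

Lemma word_elt_inj_reduced w : reduced w -> word_elt w = w :> seq _.
Proof. exact: reduce_id. Qed.

Lemma free_eq1 (x : F) : (x : seq _) = [::] -> x = 1.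
Proof. by move=> x0; apply: val_inj. Qed.

Lemma free_ind (P : F -> Prop) : P 1 -> (forall l x, P x -> P (lgen l * x)) ->
  forall x, P x.
Proof.
move=> P1 PM x; rewrite -(word_eltK x); elim: (x : seq _) => // l w.
by rewrite word_elt_cons; exact: PM.
Qed.

Section Ext.
Variables (K : groupType) (f : A -> K).

Definition lval (l : letter A) : K := if l.2 then (f l.1)^-1 else f l.1.
Definition wval (w : seq (letter A)) : K := foldr (fun l k => lval l * k) 1 w.
Definition fhom (x : F) : K := wval x.

Lemma lval_linv l : lval (linv l) = (lval l)^-1.
Proof. by case: l => a []; rewrite /lval /= ?invgK. Qed.

Lemma wval_lcons l w : wval (lcons l w) = lval l * wval w.
Proof.
case: w => [|l' w] //=; case: eqP => [->|_] //=.
by rewrite lval_linv mulgA mulgV mul1g.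
Qed.

Lemma wval_reduce w : wval (reduce w) = wval w.
Proof. by elim: w => //= l w IH; rewrite wval_lcons IH. Qed.

Lemma wval_cat u v : wval (u ++ v) = wval u * wval v.
Proof. by elim: u => [|l u IH] /=; rewrite ?mul1g // IH mulgA. Qed.

Lemma fhomM : is_hom fhom.
Proof. by move=> x y; rewrite /fhom free_mulgE wval_reduce wval_cat. Qed.

Lemma fhom1 : fhom 1 = 1. Proof. by []. Qed.

Lemma fhomV x : fhom x^-1 = (fhom x)^-1. Proof. exact: homV fhomM _. Qed.

Lemma fhom_lgen l : fhom (lgen l) = lval l.
Proof. by rewrite /fhom /= mulg1. Qed.

Lemma fhom_gen a : fhom (gen a) = f a.
Proof. exact: fhom_lgen. Qed.

End Ext.

Lemma hom_ext (K : groupType) (f g : F -> K) : is_hom f -> is_hom g ->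
  (forall a, f (gen a) = g (gen a)) -> f =1 g.
Proof.
move=> fM gM fg; elim/free_ind => [|[a b] x IH]; first by rewrite !hom1.
rewrite fM gM IH; congr (_ * _); case: b => //; last exact: fg.
by rewrite lgenT !homV // fg.
Qed.

Lemma fhom_id : fhom gen =1 id.
Proof. by apply: (hom_ext (fhomM _)) => // a; exact: fhom_gen. Qed.

Lemma fhom_comp (K L : groupType) (f : A -> K) (h : K -> L) : is_hom h ->
  forall x, h (fhom f x) = fhom (h \o f) x.
Proof.
move=> hM; apply: (hom_ext (hom_comp (fhomM f) hM) (fhomM _)) => a.
by rewrite /= !fhom_gen.
Qed.

Lemma eq_fhom (K : groupType) (f g : A -> K) : f =1 g -> fhom f =1 fhom g.
Proof.
by move=> fg; apply: (hom_ext (fhomM _) (fhomM _)) => a; rewrite !fhom_gen.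
Qed.

End FreeHom.

(** An injective renaming of letters creates no cancellation, so it sends reduced words to reduced
    words of the same length. *)
Lemma fhom_map_inj (A B : choiceType) (f : A -> B) : injective f ->
  injective (fhom (fun a => gen (f a))).
Proof.
move=> fi; have E w : reduced w ->
    fhom (fun a => gen (f a)) (word_elt w) = map (fun l => (f l.1, l.2)) w :> seq _.
  elim: w => // l w IH rlw; have rw : reduced w by exact: path_sorted rlw.
  rewrite word_elt_cons fhomM fhom_lgen.
  have -> : lval (fun a => gen (f a)) l = lgen (f l.1, l.2).
    by case: l {rlw} => a []; rewrite /lval //= lgenT.
  rewrite lgen_mul IH //; case: w rlw {IH rw} => //= l' w /andP[nl _].
  by rewrite ifF //; apply: contraNF nl; case: l l' => a b [a' b'] /eqP[/fi-> ->].
apply: hom_inj; first exact: fhomM.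
move=> x; rewrite -(word_eltK x) => /(congr1 val)/=; rewrite E ?(valP x)// => h.
by apply: free_eq1; rewrite word_elt_inj_reduced ?(valP x)//; case: (x : seq _) h.
Qed.

(** * Groupoids of labelled graphs *)

Section Groupoid.
Variables (I V : choiceType).
Variables (D : I -> Prop) (s t : I -> V).

(** The edge-path groupoid: [gpd u v g] says that [g] is the class of an edge path from [u] to [v]
    through edges in [D]. Closure rules are used instead of explicit paths so that functors and
    natural transformations need only be checked on edges. *)
Inductive gpd : V -> V -> free_group I -> Prop :=
  | gpd_one u : gpd u u 1
  | gpd_gen i : D i -> gpd (s i) (t i) (gen i)
  | gpd_inv u v g : gpd u v g -> gpd v u g^-1
  | gpd_mul u v w g h : gpd u v g -> gpd v w h -> gpd u w (g * h).

Lemma gpd_gen' i u v : D i -> s i = u -> t i = v -> gpd u v (gen i).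
Proof. by move=> Di <- <-; exact: gpd_gen. Qed.

Section Label.
Variables (K : groupType) (lam : I -> K).

Definition gpd_inj : Prop := forall u g, gpd u u g -> fhom lam g = 1 -> g = 1.

(** The base vertex is existentially quantified because the moves rename vertices and the final test
    searches for a suitable one. *)
Definition gpd_onto (S : K -> Prop) : Prop :=
  exists u, forall k, S k -> exists2 g, gpd u u g & fhom lam g = k.

End Label.

Definition lsrc (l : letter I) : V := if l.2 then t l.1 else s l.1.

Fixpoint lpath (u : V) (w : seq (letter I)) (v : V) : Prop :=
  if w is l :: w' then [/\ D l.1, lsrc l = u & lpath (lsrc (linv l)) w' v]
  else u = v.

Lemma lpath_cat u v v' w w' : lpath u w v -> lpath v w' v' -> lpath u (w ++ w') v'.
Proof. by elim: w u => [|l w IH] u /=; [move->|case=> *; split=> //; exact: IH]. Qed.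

Lemma lpath_lcons l w v : D l.1 -> lpath (lsrc (linv l)) w v ->
  lpath (lsrc l) (lcons l w) v.
Proof.
case: w => [|l' w] //= Dl [Dl' E p]; case: eqP => // l'E.
by move: p; rewrite l'E linvK.
Qed.

Lemma lpath_reduce u w v : lpath u w v -> lpath u (reduce w) v.
Proof.
by elim: w u => //= l w IH u [Dl <- /IH]; exact: lpath_lcons.
Qed.

Lemma lpath_rev u w v : lpath u w v -> lpath v (winv w) u.
Proof.
elim: w u => //= l w IH u.
case=> Dl <- /IH p; rewrite /winv /= rev_cons -cats1; apply: lpath_cat p _.
by split; rewrite ?linvK.
Qed.

Lemma gpd_lpath u v g : gpd u v g -> lpath u g v.
Proof.
elim=> // {u v g} [u v g _|u v w g h _ gp _ hp].
  by rewrite free_invgE; exact: lpath_rev.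
by rewrite free_mulgE; apply/lpath_reduce/(lpath_cat gp hp).
Qed.

Lemma gpd_lgen l : D l.1 -> gpd (lsrc l) (lsrc (linv l)) (lgen l).
Proof.
case: l => i [] /= Di; rewrite /lsrc /=; last exact: gpd_gen.
by rewrite lgenT; exact/gpd_inv/gpd_gen.
Qed.

Lemma lpath_gpd_word u v w : lpath u w v -> gpd u v (word_elt w).
Proof.
elim: w u => [|l w IH] u /=; first by move->; exact: gpd_one.
by case=> Dl <- /IH p; rewrite word_elt_cons; apply: gpd_mul p; exact: gpd_lgen.
Qed.

(** Free reduction of an edge path only removes backtracking, so the reduced word is again a path
    with the same ends. *)
Lemma gpdP u v g : gpd u v g <-> lpath u g v.
Proof.
by split=> [/gpd_lpath//|/lpath_gpd_word]; rewrite word_eltK.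
Qed.

End Groupoid.

Section Functor.
Variables (I V I' V' : choiceType).
Variables (D : I -> Prop) (s t : I -> V) (D' : I' -> Prop) (s' t' : I' -> V').
Variables (r : V -> V') (a : I -> free_group I').
Hypothesis aP : forall i, D i -> gpd D' s' t' (r (s i)) (r (t i)) (a i).

Lemma gpd_map u v g : gpd D s t u v g -> gpd D' s' t' (r u) (r v) (fhom a g).
Proof.
elim=> {u v g}.
- by move=> u; rewrite fhom1; exact: gpd_one.
- by move=> i Di; rewrite fhom_gen; exact: aP.
- by move=> u v g _ IH; rewrite fhomV; exact: gpd_inv.
- by move=> u v w g h _ gp _ hp; rewrite fhomM; exact: gpd_mul gp hp.
Qed.

End Functor.

(** The elements [c] form a natural transformation; its naturality square propagates from the edges
    to all paths. *)
Lemma gpd_conj (I V : choiceType) (D : I -> Prop) (s t : I -> V)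
    (K : groupType) (f h : free_group I -> K) (c : V -> K) :
  is_hom f -> is_hom h ->
  (forall i, D i -> h (gen i) = (c (s i))^-1 * f (gen i) * c (t i)) ->
  forall u v g, gpd D s t u v g -> h g = (c u)^-1 * f g * c v.
Proof.
move=> fM hM E u v g; elim=> {u v g}.
- by move=> u; rewrite (hom1 fM) (hom1 hM); gsimp.
- exact: E.
- by move=> u v g _ IH; rewrite (homV fM) (homV hM) IH; gsimp.
- by move=> u v w g k _ IHg _ IHk; rewrite fM hM IHg IHk; gsimp.
Qed.

Section Transfer.
Variables (I V I' V' : choiceType).
Variables (D : I -> Prop) (s t : I -> V) (D' : I' -> Prop) (s' t' : I' -> V').
Variables (K : groupType) (lam : I -> K) (lam' : I' -> K).
Variables (r : V -> V') (a : I -> free_group I') (c : V -> K).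
Variables (b : I' -> free_group I) (d : V -> free_group I).
Hypothesis aP : forall i, D i -> gpd D' s' t' (r (s i)) (r (t i)) (a i).
Hypothesis lamP : forall i, D i ->
  fhom lam' (a i) = (c (s i))^-1 * lam i * c (t i).

Lemma label_transfer u v g : gpd D s t u v g ->
  fhom lam' (fhom a g) = (c u)^-1 * fhom lam g * c v.
Proof.
apply: (gpd_conj (fhomM lam) (hom_comp (fhomM a) (fhomM lam'))).
by move=> i Di; rewrite /= !fhom_gen lamP.
Qed.

(** The twist by [c] conjugates the labels of loops, so a loop with trivial label goes to a loop
    with trivial label; and [b] recovers the original loop up to conjugation by [d]. *)
Lemma inj_transfer :
  (forall i, D i -> fhom b (a i) = (d (s i))^-1 * gen i * d (t i)) ->
  gpd_inj D' s' t' lam' -> gpd_inj D s t lam.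
Proof.
move=> bP inj' u g ug g1.
have /inj' : gpd D' s' t' (r u) (r u) (fhom a g) by exact: gpd_map aP _ _ _ ug.
rewrite (label_transfer ug) g1 mulg1 mulVg => /(_ erefl) ag1.
have : fhom b (fhom a g) = (d u)^-1 * g * d u.
  apply: (gpd_conj (f := id) _ (hom_comp (fhomM a) (fhomM b)) _ ug) => //.
  by move=> i Di; rewrite /= fhom_gen bP.
rewrite ag1 fhom1 => h.
have -> : g = d u * ((d u)^-1 * g * d u) * (d u)^-1 by gsimp.
by rewrite -h; gsimp.
Qed.

(** The labels of loops at [u] are conjugated by [c u], so [S] has to absorb this conjugation. *)
Lemma onto_transfer (S : K -> Prop) :
  (forall u k, S k -> S (c u * k * (c u)^-1)) ->
  gpd_onto D s t lam S -> gpd_onto D' s' t' lam' S.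
Proof.
move=> SJ [u uP]; exists (r u) => k /(SJ u)/uP[g ug gE].
exists (fhom a g); first exact: gpd_map aP _ _ _ ug.
by rewrite (label_transfer ug) gE; gsimp.
Qed.

End Transfer.

(** * Edge-path groupoids of finite graphs and the combinatorial criteria *)

Definition gp (G : graph) (u v : vertex G) (g : free_group (edge G)) : Prop :=
  gpd (fun=> True) (edge_src G) (edge_tgt G) u v g.

Lemma gpE (G : graph) (u v : vertex G) g : gp u v g <-> edge_path u g v.
Proof.
rewrite /gp gpdP; elim: (g : seq _) u => [|l w IH] u /=; first exact: rwP eqP.
split=> [[_ lu /IH->]|/andP[/eqP lu /IH p]]; last by split.
by rewrite andbT -lu; case: l {lu}=> e [] /=.
Qed.

Lemma hom_valid (G H : graph) (a : vertex G -> vertex H)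
  (A : free_group (edge G) -> free_group (edge H)) : is_hom A ->
  (forall e, gp (a (edge_src G e)) (a (edge_tgt G e)) (A (gen e))) ->
  forall u v g, gp u v g -> gp (a u) (a v) (A g).
Proof.
move=> AM Av u v g ug.
have -> : A g = fhom (fun e => A (gen e)) g.
  by apply: (hom_ext AM (fhomM _)) => e; rewrite fhom_gen.
by apply: (gpd_map (r := a)) ug => e _; exact: Av.
Qed.

Definition edge_hom (G H : graph) (f : tight_map G H) : free_group (edge G) -> free_group (edge H) :=
  fhom (fun e => word_elt (emap f e)).

Lemma gp_hom (G H : graph) (f : tight_map G H) u v g : gp u v g ->
  gp (vmap f u) (vmap f v) (edge_hom f g).
Proof.
apply: gpd_map => e _; apply/gpE.
by rewrite word_elt_inj_reduced ?emap_tight //; exact: emap_path.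
Qed.

Definition comb_inj (G H : graph) (f : tight_map G H) : Prop :=
  forall u g, gp u u g -> edge_hom f g = 1%g -> g = 1%g.

Definition comb_onto (G H : graph) (f : tight_map G H) : Prop := exists v, forall k,
  gp (vmap f v) (vmap f v) k -> exists2 g, gp v v g & edge_hom f g = k.

(** * Moves on labelled graphs *)

Section ListGraph.
Variables (V : choiceType) (K : groupType) (v0 : V).
Variable S : K -> Prop.
Implicit Types (u v w : V) (x y : K) (es : seq (V * K * V)).

Definition gnth es (i : nat) : V * K * V := nth (v0, 1, v0) es i.
Definition gsrc es i := (gnth es i).1.1.
Definition glab es i := (gnth es i).1.2.
Definition gtgt es i := (gnth es i).2.
Definition gdom es (i : nat) : Prop := (i < size es)%N.
Definition lgpd es := gpd (gdom es) (gsrc es) (gtgt es).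
Definition lg_inj es : Prop := gpd_inj (gdom es) (gsrc es) (gtgt es) (glab es).
Definition lg_onto es : Prop := gpd_onto (gdom es) (gsrc es) (gtgt es) (glab es) S.

Definition lg_equiv es es' : Prop :=
  (lg_inj es <-> lg_inj es') /\ (lg_onto es <-> lg_onto es').

Lemma lg_equiv_trans es es' es'' :
  lg_equiv es es' -> lg_equiv es' es'' -> lg_equiv es es''.
Proof. by rewrite /lg_equiv; tauto. Qed.

Lemma lgpd_gen es i u v : (i < size es)%N -> gsrc es i = u -> gtgt es i = v ->
  lgpd es u v (gen i).
Proof. by move=> ? <- <-; exact: gpd_gen. Qed.

(** For moves that keep the vertices: mutually inverse substitutions of paths for edges that respect
    the labels. *)
Lemma lg_equiv_iso es es' (a b : nat -> free_group nat) :
  (forall i, (i < size es)%N -> [/\ lgpd es' (gsrc es i) (gtgt es i) (a i),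
     fhom (glab es') (a i) = glab es i & fhom b (a i) = gen i]) ->
  (forall i, (i < size es')%N -> [/\ lgpd es (gsrc es' i) (gtgt es' i) (b i),
     fhom (glab es) (b i) = glab es' i & fhom a (b i) = gen i]) ->
  lg_equiv es es'.
Proof.
move=> aP bP; split; split.
- apply: (inj_transfer (r := id) (a := b) (c := fun=> 1) (b := a) (d := fun=> 1)).
  + by move=> i /bP[].
  + by move=> i /bP[_ -> _]; gsimp.
  + by move=> i /bP[_ _ ->]; gsimp.
- apply: (inj_transfer (r := id) (a := a) (c := fun=> 1) (b := b) (d := fun=> 1)).
  + by move=> i /aP[].
  + by move=> i /aP[_ -> _]; gsimp.
  + by move=> i /aP[_ _ ->]; gsimp.
- apply: (onto_transfer (r := id) (a := a) (c := fun=> 1)).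
  + by move=> i /aP[].
  + by move=> i /aP[_ -> _]; gsimp.
  + by move=> _ k; gsimp.
- apply: (onto_transfer (r := id) (a := b) (c := fun=> 1)).
  + by move=> i /bP[].
  + by move=> i /bP[_ -> _]; gsimp.
  + by move=> _ k; gsimp.
Qed.

Lemma lg_equiv_perm es es' : perm_eq es es' -> lg_equiv es es'.
Proof.
move=> /(perm_iotaP (v0, 1, v0))[s ps ->].
have us : uniq s by rewrite (perm_uniq ps) iota_uniq.
have ms i : i \in s = (i < size es')%N by rewrite (perm_mem ps) mem_iota.
have zs : size s = size es' by rewrite (perm_size ps) size_iota.
have nE i : (i < size s)%N -> gnth (map (nth (v0, 1, v0) es') s) i = gnth es' (nth 0%N s i).
  by move=> si; rewrite /gnth (nth_map 0%N).
apply: (lg_equiv_iso (a := fun i => gen (nth 0%N s i)) (b := fun i => gen (index i s))).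
  rewrite size_map => i si; have nsi : (nth 0%N s i < size es')%N.
    by rewrite -ms mem_nth.
  split; rewrite ?fhom_gen ?index_uniq //; last by rewrite /glab nE.
  by apply: lgpd_gen; rewrite ?/gsrc ?/gtgt ?nE.
move=> i; rewrite -ms => si; have isi : (index i s < size s)%N by rewrite index_mem.
split; rewrite ?fhom_gen ?nth_index //; last by rewrite /glab nE // nth_index.
by apply: lgpd_gen; rewrite ?size_map // /gsrc /gtgt nE // nth_index.
Qed.

Lemma lg_equiv_flip u x v es : lg_equiv ((u, x, v) :: es) ((v, x^-1, u) :: es).
Proof.
pose a i := if i is i'.+1 then gen i'.+1 else (gen 0%N)^-1.
by apply: (lg_equiv_iso (a := a) (b := a)) => -[|i] /= si; split;
  rewrite /a ?fhomV ?fhom_gen ?invgK //;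
  do ?[apply: gpd_inv]; exact: lgpd_gen.
Qed.

(** For [x = y] the new label is trivial: a Stallings fold is this slide, followed by the collapse
    of the new edge unless that edge is a loop. *)
Lemma lg_equiv_slide_src u x v y w es :
  lg_equiv ((u, x, v) :: (u, y, w) :: es) ((u, x, v) :: (v, x^-1 * y, w) :: es).
Proof.
pose a i : free_group nat := if i == 1%N then gen 0%N * gen 1%N else gen i.
pose b i : free_group nat := if i == 1%N then (gen 0%N)^-1 * gen 1%N else gen i.
apply: (lg_equiv_iso (a := a) (b := b)) => -[|[|i]] /= si; rewrite /a /b /=;
  split; rewrite ?fhomM ?fhomV ?fhom_gen //= ?mulKg ?mulVKg //; try exact: lgpd_gen.
- by apply: (@gpd_mul _ _ _ _ _ _ v); exact: lgpd_gen.
- by apply: (@gpd_mul _ _ _ _ _ _ u); [apply: gpd_inv|]; exact: lgpd_gen.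
Qed.

Lemma lg_equiv_slide_tgt u x v y w es :
  lg_equiv ((u, x, v) :: (w, y, v) :: es) ((u, x, v) :: (w, y * x^-1, u) :: es).
Proof.
pose a i : free_group nat := if i == 1%N then gen 1%N * gen 0%N else gen i.
pose b i : free_group nat := if i == 1%N then gen 1%N * (gen 0%N)^-1 else gen i.
apply: (lg_equiv_iso (a := a) (b := b)) => -[|[|i]] /= si; rewrite /a /b /=;
  split; rewrite ?fhomM ?fhomV ?fhom_gen //= ?mulgK ?mulgVK //; try exact: lgpd_gen.
- by apply: (@gpd_mul _ _ _ _ _ _ u); exact: lgpd_gen.
- by apply: (@gpd_mul _ _ _ _ _ _ v); [|apply: gpd_inv]; exact: lgpd_gen.
Qed.

Definition rename u v w : V := if w == v then u else w.
Definition rename_edge u v (e : V * K * V) : V * K * V :=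
  (rename u v e.1.1, e.1.2, rename u v e.2).

Lemma lg_equiv_collapse u v es : u != v ->
  lg_equiv ((u, 1, v) :: es) (map (rename_edge u v) es).
Proof.
move=> uv; set es1 := _ :: es; set es2 := map _ _.
(* [d w] leads from [w] to its new name, that is, back along the collapsed edge if [w] is [v]. Its
   label is trivial, so the labels are not twisted. *)
pose d w : free_group nat := if w == v then (gen 0%N)^-1 else 1.
pose a i : free_group nat := if i is i'.+1 then gen i' else 1.
pose b i : free_group nat := (d (gsrc es i))^-1 * gen i.+1 * d (gtgt es i).
have nE i : (i < size es)%N -> gnth es2 i = rename_edge u v (gnth es i).
  by move=> si; rewrite /gnth (nth_map (v0, 1, v0)).
have ad w : fhom a (d w) = 1 by rewrite /d; case: ifP; rewrite ?fhomV ?fhom_gen ?invg1.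
have ld w : fhom (glab es1) (d w) = 1.
  by rewrite /d; case: ifP; rewrite ?fhomV ?fhom_gen ?invg1.
have dP w : lgpd es1 w (rename u v w) (d w).
  rewrite /d /rename; case: eqP => [->|_]; last exact: gpd_one.
  by apply: gpd_inv; exact: lgpd_gen.
have aP i : gdom es1 i ->
    lgpd es2 (rename u v (gsrc es1 i)) (rename u v (gtgt es1 i)) (a i).
  case: i => [_|i si] /=.
    by rewrite /rename eqxx (negbTE uv); exact: gpd_one.
  by apply: lgpd_gen; rewrite ?size_map // /gsrc /gtgt nE.
have aL i : gdom es1 i -> fhom (glab es2) (a i) = glab es1 i.
  by case: i => [//|i] si; rewrite fhom_gen /glab nE.
have bP i : gdom es2 i -> lgpd es1 (gsrc es2 i) (gtgt es2 i) (b i).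
  rewrite /gdom size_map => si; rewrite /gsrc /gtgt nE //.
  apply: gpd_mul (dP _); apply: gpd_mul (gpd_inv (dP _)) _.
  exact: lgpd_gen.
have bL i : gdom es2 i -> fhom (glab es1) (b i) = glab es2 i.
  rewrite /gdom size_map => si.
  by rewrite /b !fhomM fhomV !ld fhom_gen /glab nE //; gsimp.
split; split.
- apply: (inj_transfer (r := id) (a := b) (c := fun=> 1) (b := a) (d := fun=> 1)) => //.
  + by move=> i /bL->; gsimp.
  + by move=> i si; rewrite /b !fhomM fhomV !ad fhom_gen; gsimp.
- apply: (inj_transfer (r := rename u v) (a := a) (c := fun=> 1) (b := b) (d := d)) => //.
  + by move=> i /aL->; gsimp.
  + case=> [_|i si] /=; last by rewrite fhom_gen.
    by rewrite /gsrc /gtgt /= /d eqxx (negbTE uv) invg1 mul1g mulgV.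
- apply: (onto_transfer (r := rename u v) (a := a) (c := fun=> 1)) => //.
  + by move=> i /aL->; gsimp.
  + by move=> _ k; gsimp.
- apply: (onto_transfer (r := id) (a := b) (c := fun=> 1)) => //.
  + by move=> i /bL->; gsimp.
  + by move=> _ k; gsimp.
Qed.

Lemma lg_inj_loop u es : ~ lg_inj ((u, 1, u) :: es).
Proof.
move=> h; have : gen 0%N = 1 :> free_group nat.
  by apply: (h u); [exact: lgpd_gen|rewrite fhom_gen].
by move/(congr1 (fun x : free_group nat => size x)).
Qed.

(** The way back contracts the new edge labelled [x] and moves [n] to [u]. Labels of loops at [n]
    are thereby conjugated by [x], which is where the closure condition on [S] enters. *)
Lemma lg_equiv_subdivide u x y v n es :
  (forall k, S k -> S (x^-1 * k * x)) ->
  u != n -> v != n -> all (fun e => (e.1.1 != n) && (e.2 != n)) es ->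
  lg_equiv ((u, x * y, v) :: es) ((u, x, n) :: (n, y, v) :: es).
Proof.
move=> Sx un vn esn; set es1 := _ :: es; set es2 := [:: _, _ & es].
pose a i : free_group nat := if i is i'.+1 then gen i'.+2 else gen 0%N * gen 1%N.
pose b i : free_group nat := if i is i'.+1 then gen i' else 1.
pose r w := rename u n w.
pose c w : K := if w == n then x^-1 else 1.
pose d w : free_group nat := if w == n then (gen 0%N)^-1 else 1.
have rid w : w != n -> [/\ r w = w, c w = 1 & d w = 1].
  by rewrite /r /rename /c /d => /negbTE->.
have rn : [/\ r n = u, c n = x^-1 & d n = (gen 0%N)^-1].
  by rewrite /r /rename /c /d eqxx.
have rD i : (i < size es)%N -> (gsrc es i != n) && (gtgt es i != n).
  by move=> si; exact: (allP esn) _ (mem_nth _ si).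
have aP i : gdom es1 i -> lgpd es2 (gsrc es1 i) (gtgt es1 i) (a i).
  case: i => [_|i si] /=; last exact: lgpd_gen.
  by apply: (@gpd_mul _ _ _ _ _ _ n); exact: lgpd_gen.
have aL i : gdom es1 i -> fhom (glab es2) (a i) = glab es1 i.
  by case: i => [_|i si]; rewrite ?fhomM !fhom_gen.
have bP i : gdom es2 i -> lgpd es1 (r (gsrc es2 i)) (r (gtgt es2 i)) (b i).
  case: i => [_|[_|i si]] /=; rewrite /gsrc /gtgt /=.
  - by have [-> _ _] := rn; have [-> _ _] := rid _ un; exact: gpd_one.
  - by have [-> _ _] := rn; have [-> _ _] := rid _ vn; exact: lgpd_gen.
  - have /andP[h1 h2] := rD i si; have [h _ _] := rid _ h1; have [h' _ _] := rid _ h2.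
    by apply: lgpd_gen => //; rewrite -?/(gsrc es i) -?/(gtgt es i) ?h ?h'.
have bL i : gdom es2 i ->
    fhom (glab es1) (b i) = (c (gsrc es2 i))^-1 * glab es2 i * c (gtgt es2 i).
  case: i => [_|[_|i si]] /=; rewrite /gsrc /gtgt /= ?fhom_gen.
  - by have [_ -> _] := rn; have [_ -> _] := rid _ un; gsimp.
  - by have [_ -> _] := rn; have [_ -> _] := rid _ vn; gsimp.
  - have /andP[h1 h2] := rD i si; have [_ h _] := rid _ h1; have [_ h' _] := rid _ h2.
    by rewrite -/(gsrc es i) -/(gtgt es i) h h'; gsimp.
split; split.
- apply: (inj_transfer (r := r) (a := b) (c := c) (b := a) (d := d)) => //.
  case=> [_|[_|i si]] /=; rewrite /gsrc /gtgt /= ?fhom_gen.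
  - by have [_ _ ->] := rn; have [_ _ ->] := rid _ un; rewrite fhom1; gsimp.
  - by have [_ _ ->] := rn; have [_ _ ->] := rid _ vn; gsimp.
  - have /andP[h1 h2] := rD i si; have [_ _ h] := rid _ h1; have [_ _ h'] := rid _ h2.
    by rewrite -/(gsrc es i) -/(gtgt es i) h h'; gsimp.
- apply: (inj_transfer (r := id) (a := a) (c := fun=> 1) (b := b) (d := fun=> 1)) => //.
  + by move=> i /aL->; gsimp.
  + by case=> [_|i si] /=; rewrite ?fhomM !fhom_gen /=; gsimp.
- apply: (onto_transfer (r := id) (a := a) (c := fun=> 1)) => //.
  + by move=> i /aL->; gsimp.
  + by move=> _ k; gsimp.
- apply: (onto_transfer (r := r) (a := b) (c := c)) => //.
  move=> w k Sk; rewrite /c; case: ifP => _; last by gsimp.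
  by rewrite invgK; exact: Sx.
Qed.

End ListGraph.

(** * Folded graphs *)

Section Folded.
Variables (V A : choiceType) (v0 : V).
Local Notation K := (free_group A).
Implicit Types (es : seq (V * A * V)).

Definition lab_edge (e : V * A * V) : V * K * V := (e.1.1, gen e.1.2, e.2).

Definition clash (e e' : V * A * V) : bool :=
  (e.1.2 == e'.1.2) && ((e.1.1 == e'.1.1) || (e.2 == e'.2)).

Variables (es : seq (V * A * V)).
Hypothesis fold_es : pairwise (fun e e' => ~~ clash e e') es.
Variable S : K -> Prop.

Let d (a0 : A) : V * A * V := (v0, a0, v0).

Let noclash a0 i j : (i < size es)%N -> (j < size es)%N ->
  clash (nth (d a0) es i) (nth (d a0) es j) -> i = j.
Proof.
have clashC e e' : clash e e' = clash e' e by rewrite /clash ![_ == e'.1.2]eq_sym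
  ![_ == e'.1.1]eq_sym ![_ == e'.2]eq_sym.
move=> si sj; have /(pairwiseP (d a0)) h := fold_es.
case: (ltngtP i j) => // ij c.
  by have := h _ _ si sj ij; rewrite c.
by have := h _ _ sj si ij; rewrite clashC c.
Qed.

Let les := map lab_edge es.

(** Consecutive oriented edges with inverse labels clash, hence are inverse to each other. So a
    reduced path has a reduced label of the same length; in particular a single letter can only be
    the label of a single edge. *)
Lemma lgpd_folded u v g : lgpd v0 les u v g ->
  exists w : seq (letter A), [/\ (fhom (glab v0 les) g : seq _) = w,
    size w = size g & forall a, w = [:: (a, false)] -> (u, a, v) \in es].
Proof.
move=> /gpd_lpath p.
case: (posnP (size es)) => [s0|].
  have g0 : (g : seq _) = [::] by case: (g : seq _) p => //= l w [] ; rewrite /gdom size_map s0.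
  by exists [::]; rewrite (free_eq1 g0) fhom1; split.
(* The letter in the default edge is taken from [es] itself, since [A] may be empty. *)
case E : es => [//|[[b0 a0] c0] es0] _; rewrite -E {b0 c0 es0 E}.
have nE i : (i < size es)%N -> gnth v0 les i = lab_edge (nth (d a0) es i).
  by move=> si; rewrite /gnth /les (nth_map (d a0)).
pose h (l : letter nat) : letter A := ((nth (d a0) es l.1).1.2, l.2).
have lvalE l : (l.1 < size es)%N -> lval (glab v0 les) l = lgen (h l).
  by case: l => i [] /= si; rewrite /lval /= /glab nE // /h /= lgenT.
have hE w : reduced w -> forall u', lpath (gdom les) (gsrc v0 les) (gtgt v0 les) u' w v ->
    reduced (map h w) /\ wval (glab v0 les) w = map h w :> seq _.
  elim: w => // l w IH rlw u' /= [Dl _ pw].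
  have rw : reduced w by exact: path_sorted rlw.
  have [rh wE] := IH rw _ pw; move: Dl; rewrite /gdom size_map => Dl.
  have rh' : reduced (h l :: map h w).
    case: w pw rlw rh {IH rw wE} => //= l' w [Dl' ll' _] /andP[nl _] rh.
    apply/andP; split; last exact: rh.
    clear rh.
    apply: contraNneq nl => hl; apply/eqP.
    move: Dl'; rewrite /gdom size_map => Dl'.
    case: l l' Dl Dl' ll' hl => i b [j b'] /= Dl Dl' ll' [aa bb].
    rewrite /linv /=; congr (_, _) => //; symmetry; apply: (noclash (a0 := a0)) => //.
    rewrite /clash aa eqxx /=; move: ll'; rewrite /lsrc /= bb /gsrc /gtgt !nE //.
    by case: b {aa bb} => /= ->; rewrite eqxx ?orbT.
  split=> //; rewrite lvalE // [LHS]lgen_mul wE.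
  by rewrite -[RHS](reduce_id rh') /= -/(reduce _) reduce_id.
have [rh wE] := hE _ (valP g) _ p.
exists (map h g); split; [exact: wE|exact: size_map|].
move=> a; case: (g : seq _) p => //= -[i b] [] //= [Di si ti] [<- bE]; subst b.
move: Di si ti; rewrite /gdom size_map /lsrc /= /gsrc /gtgt => Di; rewrite nE //= => <- <-.
have := mem_nth (d a0) Di; rewrite /h /=.
by case: (nth _ _ _) => [[]].
Qed.

Lemma lg_inj_folded : lg_inj v0 les.
Proof.
move=> u g /lgpd_folded[w [wE sw _]] g1; apply: free_eq1.
by move: wE sw; rewrite g1 => <- /= /esym/size0nil.
Qed.

(** The subgroup generated by the live letters, presented as the vertex group of a one-vertex graph
    so that the groupoid lemmas apply to it. *)
Definition rose (live : seq A) (k : K) : Prop :=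
  gpd (fun a => a \in live) (fun=> tt) (fun=> tt) tt tt k.

(** A path with label [gen a] is a single edge by the equality of lengths, and being closed it is a
    loop. Conversely, loops for the generators give the whole subgroup. *)
Lemma lg_onto_folded (live : seq A) : lg_onto v0 (rose live) les <->
  exists u, forall a, a \in live -> (u, a, u) \in es.
Proof.
split=> [[u uP]|[u uP]]; exists u.
  move=> a al; have ra : rose live (gen a) by exact: gpd_gen.
  have [g /lgpd_folded[w [wE _ wP]] gE] := uP _ ra.
  by apply: wP; rewrite -wE gE.
move=> k; rewrite /rose; move: tt tt => x y.
elim=> {x y k} [_|a al|_ _ k _ [g gu gk]|_ _ _ k k' _ [g gu gk] _ [g' gu' gk']].
- by exists 1; [exact: gpd_one|rewrite fhom1].
- have := uP a al; case/(nthP (d a)) => i si iE; exists (gen i).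
    apply: lgpd_gen; rewrite ?size_map // /gsrc /gtgt /gnth /les.
      by rewrite (nth_map (d a)) // iE.
    by rewrite (nth_map (d a)) // iE.
  by rewrite fhom_gen /glab /gnth /les (nth_map (d a)) // iE.
- by exists g^-1; [exact: gpd_inv|rewrite fhomV gk].
- by exists (g * g'); [exact: gpd_mul gu gu'|rewrite fhomM gk gk'].
Qed.

End Folded.

(** * Correctness of the folding algorithm *)

Local Notation K := (free_group tree).

Definition lab_val (l : tree) : K := if l is Cons a _ then gen a else 1.
Definition dec (e : tree) : tree * K * tree := (esrc e, lab_val (elab e), etgt e).
(** [lab_val] ignores the tail of a label, whereas the algorithm compares labels as trees; on labels
    of this form the two notions of equality agree. *)
Definition good_lab (l : tree) : bool := if l is Cons a b then b == Nil else true.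
Definition good_edges (es : seq tree) : bool := all (fun e => good_lab (elab e)) es.

Lemma dec_rene u v e : dec (rene (Cons u v) e) = rename_edge u v (dec e).
Proof. by rewrite /dec /rene /rename_edge /rename /renm /= !teqE !tif_bool. Qed.

Definition unlab (e : tree) : tree * tree * tree := (esrc e, thd (elab e), etgt e).

Lemma dec_unlab es : all (fun e => elab e != Nil) es ->
  map dec es = map (@lab_edge _ _) (map unlab es).
Proof.
move=> a; rewrite -map_comp; apply/eq_in_map => e /(allP a).
by rewrite /dec /lab_edge /=; case: (elab e).
Qed.

Lemma unlab_noclash es : all (fun e => elab e != Nil) es -> good_edges es ->
  pairwise (fun e e' => ~~ clashb e e') es ->
  pairwise (fun e e' => ~~ clash e e') (map unlab es).
Proof.
move=> a g pw; rewrite pairwise_map; apply: sub_in_pairwise pw; last exact: allss.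
move=> e e' ee ee' /=; apply: contra; rewrite /clash /clashb /= => /andP[/eqP le ->].
rewrite andbT; move: (allP a _ ee) (allP a _ ee') (allP g _ ee) (allP g _ ee') le.
by case: (elab e) (elab e') => [|b c] [|b' c'] //= _ _ /eqP-> /eqP-> ->.
Qed.

Section FoldSpec.
Variable S : K -> Prop.
Local Notation equiv es es' := (lg_equiv Nil S (map dec es) (map dec es')).

Lemma equiv_perm es es' : perm_eq es es' -> equiv es es'.
Proof. by move=> p; apply: lg_equiv_perm; exact: perm_map. Qed.

Definition stuck (es : seq tree) : Prop :=
  (exists2 e, e \in es & elab e = Nil /\ esrc e = etgt e) \/
  (all (fun e => elab e != Nil) es /\ pairwise (fun e e' => ~~ clashb e e') es).

(** A collapse removes an edge with trivial label; a fold keeps the number of edges and makes one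
    label trivial. *)
Definition fold_measure (es : seq tree) : nat :=
  (size es + count (fun e => elab e != Nil) es)%N.

Lemma is_epsE z e : is_eps z e = tree_of_bool (elab e == Nil).
Proof. by rewrite /is_eps; case: (elab e). Qed.

Lemma fold_stepP es : good_edges (spine es) ->
  [/\ good_edges (spine (fold_step es)), equiv (spine es) (spine (fold_step es)) &
   (fold_measure (spine (fold_step es)) < fold_measure (spine es))%N \/
   (fold_step es = es /\ stuck (spine es))].
Proof.
move=> ges; rewrite /fold_step.
have gp es' : perm_eq (spine es) es' -> good_edges es'.
  by move=> p; rewrite /good_edges -(perm_all _ p).
case: (pick2P (p := fun _ e => elab e == Nil) is_epsE Nil es) => /= [[-> a _]|[e [-> /eqP ee p]]].
  case: (find_pairP es) => /= [[-> pw]|[e1 [e2 [-> ce p]]]] /=.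
    by split=> //; right; split=> //; right.
  move: (gp _ p); rewrite /good_edges /= => /and3P[g1 g2 g3].
  set e3 := tif _ _ _.
  have [le12 se] := andP ce.
  have e3P : elab e3 = Nil /\ equiv [:: e1, e2 & spine (ttl (find_pair es))]
      [:: e1, e3 & spine (ttl (find_pair es))].
    rewrite /e3 teqE tif_bool /= /dec (eqP le12).
    case: ifP se => [/eqP-> _|_ /= /eqP->]; split=> //.
      have := lg_equiv_slide_src Nil S (esrc e2) (lab_val (elab e2)) (etgt e1)
        (lab_val (elab e2)) (etgt e2).
      by rewrite mulVg; apply.
    have := lg_equiv_slide_tgt Nil S (esrc e1) (lab_val (elab e2)) (etgt e2)
        (lab_val (elab e2)) (esrc e2).
    by rewrite mulgV; apply.
  have [l3 q3] := e3P.
  split=> /=; first by rewrite /good_edges /= g1 l3.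
    exact: lg_equiv_trans (equiv_perm p) q3.
  left; rewrite /fold_measure (perm_size p) (permP p) /= l3 eqxx /=.
  have -> : elab e2 != Nil by apply: (allP a); rewrite (perm_mem p) !inE eqxx orbT.
  by rewrite add0n add1n !addnS !ltnS leqnn.
rewrite /= teqE tif_bool; case: ifP => [/eqP se|/negbT ne].
  split=> //.
  by right; split=> //; left; exists e => //; rewrite (perm_mem p) mem_head.
have := gp _ p; rewrite /good_edges /= => /andP[_ g].
have sE : spine (renl (esrc e) (etgt e) (ttl (pick2 is_eps Nil es))) =
    rev (map (rene (Cons (esrc e) (etgt e))) (spine (ttl (pick2 is_eps Nil es)))).
  by rewrite /renl spine_tfold_cons cats0.
split.
- by rewrite sE /good_edges all_rev all_map.
- apply: lg_equiv_trans (equiv_perm p) _; rewrite sE.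
  apply: lg_equiv_trans (equiv_perm _); last by rewrite perm_sym perm_rev.
  rewrite /= {1}/dec ee /= -map_comp (eq_map (dec_rene (esrc e) (etgt e))) map_comp.
  exact: lg_equiv_collapse.
- left; rewrite sE /fold_measure size_rev size_map (perm_size p) count_rev count_map.
  by rewrite (permP p) /= ee eqxx add0n ltn_add2r.
Qed.

Lemma fold_allP es : good_edges (spine es) -> let es' := fold_all es in
  [/\ good_edges (spine es'), equiv (spine es) (spine es') & stuck (spine es')].
Proof.
move=> ges /=; rewrite /fold_all !tfold_iter -iterD.
have : (fold_measure (spine es) <= size (spine es) + size (spine es))%N.
  by rewrite leq_add2l count_size.
move: (_ + _)%N => n; elim: n es ges => [|n IH] es ges mn.
  split=> //.
  move: mn; rewrite leqn0 addn_eq0 size_eq0 => /andP[/eqP-> _].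
  by right.
have [g q [m|[E st]]] := fold_stepP ges.
  rewrite iterSr; have [|g' q' st'] := IH _ g; first by rewrite -ltnS (leq_trans m mn).
  by split=> //; exact: lg_equiv_trans q q'.
have -> : iter n.+1 fold_step es = es by elim: (n.+1) => //= k ->.
by split.
Qed.

Lemma stuck_inj es : stuck es -> good_edges es ->
  lg_inj Nil (map dec es) <-> all (fun e => elab e != Nil) es.
Proof.
case=> [[e ees [le se]]|[a pw]] g.
  split=> [inj|/allP/(_ _ ees)]; last by rewrite le.
  exfalso; have := perm_to_rem ees => p.
  have [[h _] _] := equiv_perm p; move: (h inj); rewrite /= {1}/dec le se.
  exact: lg_inj_loop.
split=> // _.
rewrite (dec_unlab a); apply: lg_inj_folded; exact: unlab_noclash.
Qed.

End FoldSpec.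

(** * Subdivision *)

(** Subdivision of the edge [e], whose label is a word, into edges labelled by
    letters and a last one with a trivial label; the new vertices are
    [Cons tree_true n] for successive numerals [n]. *)
Definition letter_edge (cur name l : tree) : tree :=
  tif (ttl l) (mk name (Cons (thd l) Nil) cur) (mk cur (Cons (thd l) Nil) name).
(** The state consists of the current vertex, the next free numeral and the edges produced so
    far. *)
Definition letter_step (l st : tree) : tree :=
  let name := Cons tree_true (thd (ttl st)) in
  Cons name (Cons (Cons Nil (thd (ttl st)))
    (Cons (letter_edge (thd st) name l) (ttl (ttl st)))).
Definition edge_step (e st : tree) : tree :=
  let r := tfold letter_step (Cons (esrc e) st) (elab e) in
  Cons (thd (ttl r)) (Cons (mk (thd r) Nil (etgt e)) (ttl (ttl r))).
Definition expand (es : tree) : tree := ttl (tfold edge_step (Cons Nil Nil) es).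

Lemma computable_expand : computable expand.
Proof.
have cr : computable (fun z => tfold letter_step
    (Cons (esrc (thd (ttl z))) (ttl (ttl z))) (elab (thd (ttl z)))).
  apply: (computable_fold (f := fun _ => letter_step) (e := fun=> Nil));
  rewrite /computable3 /letter_step /letter_edge; comp.
apply: computable_tl.
apply: (computable_fold (f := fun _ => edge_step) (e := fun=> Nil)); last 3 first.
- exact: computable_const.
- exact: computable_const.
- exact: computable_id.
rewrite /computable3 /edge_step; comp; exact: cr.
Qed.

Definition dec_letter (l : tree) : letter tree := (thd l, ttl l != Nil).
Definition word_val (w : tree) : K := word_elt (map dec_letter (spine w)).
Definition decw (e : tree) : tree * K * tree := (esrc e, word_val (elab e), etgt e).

Section ExpandSpec.
Variable S : K -> Prop.
Local Notation V := tree.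
Local Notation equiv := (lg_equiv Nil S).

(** Freshness is required against all later names at once, since the number of names still to be
    drawn depends on the words. *)
Definition not_new (n : nat) (v : tree) : Prop :=
  forall m, n <= m -> v != Cons tree_true (enc_nat m).
Definition all_not_new (n : nat) (es : seq (V * K * V)) : Prop :=
  forall e, e \in es -> not_new n e.1.1 /\ not_new n e.2.

Lemma not_newW n m v : n <= m -> not_new n v -> not_new m v.
Proof. by move=> nm u k mk; apply: u; exact: leq_trans mk. Qed.

Lemma enc_nat_inj : injective enc_nat.
Proof. by elim=> [|n IH] [|m] //= [/IH->]. Qed.

Lemma not_new_name n : not_new n.+1 (Cons tree_true (enc_nat n)).
Proof.
move=> m nm; apply/eqP => -[/enc_nat_inj nm']; by rewrite nm' ltnn in nm.
Qed.

Definition conj_closed (l : tree) : Prop :=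
  forall k, S k -> S ((lgen (dec_letter l))^-1 * k * lgen (dec_letter l)).

Lemma letter_edgeE cur name l : dec (letter_edge cur name l) =
  if ttl l == Nil then (cur, lgen (dec_letter l), name)
  else (name, (lgen (dec_letter l))^-1, cur).
Proof.
by rewrite /letter_edge /dec_letter; case: (ttl l).
Qed.

(** The edge into [v] is the unfinished remainder, labelled by the letters not yet read; each step
    splits one letter off its front. [T] stands for the edges still to be treated, which the new
    vertices must avoid as well. *)
Lemma letter_foldP ls cur n done v T : {in ls, forall l, conj_closed l} ->
  not_new n cur -> not_new n v -> all_not_new n (map dec (spine done)) -> all_not_new n T ->
  good_edges (spine done) ->
  exists cur' m done',
  [/\ foldl (fun st l => letter_step l st) (Cons cur (Cons (enc_nat n) done)) ls =
        Cons cur' (Cons (enc_nat m) done'),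
      n <= m /\ not_new m cur', good_edges (spine done'),
      all_not_new m (map dec (spine done')) &
      equiv ((cur, word_elt (map dec_letter ls), v) :: map dec (spine done) ++ T)
            ((cur', 1, v) :: map dec (spine done') ++ T)].
Proof.
elim: ls cur n done => [|l ls IH] cur n done cS uc uv ud uT gd.
  by exists cur, n, done; split.
set name := Cons tree_true (enc_nat n).
set done1 := Cons (letter_edge cur name l) done.
have nn : n <= n.+1 by [].
have [||||||cur' [m [done' [E [nm uc'] gd' ud' q]]]] := IH name n.+1 done1.
- by move=> l' l's; apply: cS; rewrite inE l's orbT.
- exact: not_new_name.
- exact: not_newW uv.
- move=> e; rewrite /done1 /= inE => /predU1P[->|/ud[h1 h2]]; last first.
    by split; apply: not_newW; [exact: nn|exact: h1|exact: nn|exact: h2].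
  rewrite letter_edgeE; case: ifP => _ /=; split;
    by [exact: not_new_name|exact: not_newW uc].
- by move=> e /uT[h1 h2]; split; apply: not_newW; [exact: nn|exact: h1|exact: nn|exact: h2].
- rewrite /good_edges /= -/(good_edges _) gd andbT /letter_edge.
  by case: (ttl l).
exists cur', m, done'; split=> //; first by split=> //; exact: ltnW.
apply: lg_equiv_trans q.
set D := map dec (spine done).
have -> : map dec (spine done1) = dec (letter_edge cur name l) :: D by [].
rewrite /= word_elt_cons letter_edgeE.
have sub : equiv ((cur, lgen (dec_letter l) * word_elt (map dec_letter ls), v) :: D ++ T)
   [:: (cur, lgen (dec_letter l), name), (name, word_elt (map dec_letter ls), v) & D ++ T].
  apply: lg_equiv_subdivide.
  - by apply: cS; rewrite mem_head.
  - exact: uc.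
  - exact: uv.
  - apply/allP => e; rewrite mem_cat => /orP[/ud[h1 h2]|/uT[h1 h2]];
      by rewrite h1 // h2.
apply: lg_equiv_trans sub _; case: ifP => _.
  by apply: lg_equiv_perm; rewrite (perm_catCA [:: _] [:: _]).
apply: lg_equiv_trans; first exact: lg_equiv_flip.
by apply: lg_equiv_perm; rewrite (perm_catCA [:: _] [:: _]).
Qed.

Lemma expandP es :
  (forall e, e \in spine es -> {in spine (elab e), forall l, conj_closed l}) ->
  (forall e, e \in spine es -> not_new 0 (esrc e) /\ not_new 0 (etgt e)) ->
  good_edges (spine (expand es)) /\
  equiv (map decw (spine es)) (map dec (spine (expand es))).
Proof.
move=> cS uS; rewrite /expand tfoldE.
(* Finished edges carry letters and the others still carry words, so the invariant mixes [dec] and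
   [decw]. *)
suff H s : forall n done, (forall e, e \in s -> {in spine (elab e), forall l, conj_closed l}) ->
    (forall e, e \in s -> not_new n (esrc e) /\ not_new n (etgt e)) ->
    all_not_new n (map dec (spine done)) -> good_edges (spine done) ->
    let r := foldl (fun st e => edge_step e st) (Cons (enc_nat n) done) s in
    good_edges (spine (ttl r)) /\
    equiv (map dec (spine done) ++ map decw s) (map dec (spine (ttl r))).
  by have [|//|g q] := H (spine es) 0 Nil cS uS; split.
elim: s => [|e s IH] n done cSs us ud gd; first by rewrite /= cats0; split.
have [us1 ut1] := us e (mem_head _ _).
have uT : all_not_new n (map decw s).
  by move=> x /mapP[e' e's ->]; apply: us; rewrite inE e's orbT.
have [] := @letter_foldP (spine (elab e)) (esrc e) n done (etgt e) (map decw s) => //.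
  exact: cSs (mem_head _ _).
move=> cur' [m [done' [E [nm uc'] gd' ud' q]]].
rewrite /= {2}/edge_step {3}/edge_step tfoldE E /=.
have [||||g q'] := IH m (Cons (mk cur' Nil (etgt e)) done').
- by move=> e' e's; apply: cSs; rewrite inE e's orbT.
- move=> e' e's; have [h1 h2] := us e' (mem_behead (s := e :: s) e's).
  by split; apply: not_newW; [exact: nm|exact: h1|exact: nm|exact: h2].
- move=> x; rewrite /= inE => /predU1P[->|/ud'//] /=.
  by split=> //; exact: not_newW ut1.
- by [].
split=> //; apply: lg_equiv_trans q'.
apply: lg_equiv_trans q.
by apply: lg_equiv_perm; rewrite (perm_catCA _ [:: _]).
Qed.

End ExpandSpec.

(** * Testing surjectivity *)

Definition tmem (a l : tree) : tree := tfold (fun x acc => tor (teq x a) acc) Nil l.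
Definition loop_mem (e es a : tree) : tree :=
  tmem (mk (esrc e) (Cons a Nil) (esrc e)) es.
Definition loops_at (live es e : tree) : tree :=
  tfold (fun a acc => tand (loop_mem e es a) acc) tree_true live.
(** With no live letter every vertex will do, even if the list of edges is empty; otherwise a
    suitable vertex carries a loop and is found among the sources of the edges. *)
Definition onto_test (live es : tree) : tree :=
  tif live (tfold (fun e acc => tor (loops_at live es e) acc) Nil es) tree_true.

Lemma computable_tmem : computable2 tmem.
Proof.
apply: (computable_fold (f := fun a x acc => tor (teq x a) acc));
  rewrite /computable3; comp.
Qed.

Lemma computable_loops_at : computable3 loops_at.
Proof.
apply: (computable_fold
  (f := fun z a acc => tand (loop_mem (thd z) (ttl z) a) acc)
  (e := fun x => Cons (ttl (ttl x)) (thd (ttl x)))); try (comp; fail).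
rewrite /computable3 /loop_mem; comp.
by apply: (computable_app2 computable_tmem); comp.
Qed.

Lemma computable_onto_test : computable2 onto_test.
Proof.
apply: computable_if; try (comp; fail).
apply: (computable_fold (f := fun z e acc => tor (loops_at (thd z) (ttl z) e) acc)
  (e := fun x => Cons (thd x) (ttl x))); try (comp; fail).
rewrite /computable3; comp.
by apply: (computable_app3 computable_loops_at); comp.
Qed.

Lemma tmemE a l : tmem a l = tree_of_bool (a \in spine l).
Proof.
rewrite /tmem tfoldE; elim/last_ind: (spine l) => //= s x IH.
by rewrite foldl_rcons IH teqE torE mem_rcons inE (eq_sym a).
Qed.

Lemma loops_atE live es e : loops_at live es e = tree_of_bool
  (all (fun a => mk (esrc e) (Cons a Nil) (esrc e) \in spine es) (spine live)).
Proof.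
rewrite /loops_at tfoldE; elim/last_ind: (spine live) => //= s x IH.
by rewrite foldl_rcons IH /loop_mem tmemE tandE all_rcons.
Qed.

Lemma onto_testE live es : onto_test live es = tree_of_bool ((live == Nil) ||
  has (fun e => all (fun a => mk (esrc e) (Cons a Nil) (esrc e) \in spine es)
                    (spine live)) (spine es)).
Proof.
rewrite /onto_test; case: live => [//|l0 live0].
rewrite (_ : (Cons l0 live0 == Nil) = false) // orFb [tif _ _ _]/=.
set live := Cons l0 live0.
rewrite tfoldE; elim/last_ind: {1 3}(spine es) => //= s x IH.
by rewrite foldl_rcons IH loops_atE torE has_rcons.
Qed.

Lemma onto_testP live es : stuck (spine es) -> good_edges (spine es) ->
  all (fun e => elab e != Nil) (spine es) ->
  lg_onto Nil (rose (spine live)) (map dec (spine es)) <->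
  onto_test live es = tree_true.
Proof.
case=> [[e ees [le _]] _ /allP/(_ _ ees)|[a pw] g _]; first by rewrite le.
rewrite (dec_unlab a) lg_onto_folded; last exact: unlab_noclash.
have unE e : e \in spine es -> e = mk (esrc e) (Cons (thd (elab e)) Nil) (etgt e).
  move=> ees; move: (allP a _ ees) (allP g _ ees).
  rewrite /mk /esrc /elab /etgt; case: e {ees} => [//|e1 [//|[//|l b] e3]] /= _.
  by move=> /eqP->.
have memE u a0 : ((u, a0, u) \in map unlab (spine es)) =
    (mk u (Cons a0 Nil) u \in spine es).
  apply/mapP/idP => [[e ees [-> -> ee]]|h]; last by exists (mk u (Cons a0 Nil) u).
  by rewrite {2}ee -unE.
rewrite onto_testE; split=> [[u uP]|].
  case: live uP => [//|l0 live0] uP.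
  rewrite (_ : has _ _ = true) ?orbT //; apply/hasP; exists (mk u (Cons l0 Nil) u).
    by rewrite -memE; apply: uP; rewrite mem_head.
  by apply/allP => b /uP; rewrite memE.
case: eqP => [-> _|_ /=]; first by exists Nil.
case: hasP => // -[e _ /allP h] _; exists (esrc e) => b /h.
by rewrite memE.
Qed.

Definition core (es : tree) : tree := fold_all (expand es).
(** Surjectivity is read off a folded graph. A graph that is stuck because of a trivial loop may
    still contain clashes, so the second test counts only after the first has succeeded. *)
Definition bij_test (live es : tree) : tree :=
  tand (injective_test (core es)) (onto_test live (core es)).

Lemma computable_core : computable core.
Proof. exact: computable_comp computable_expand computable_fold_all. Qed.

Lemma computable_bij_test : computable2 bij_test.
Proof.
have cc : computable (fun z => core (ttl z)) by apply: (computable_comp _ computable_core); comp.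
apply: computable_if; first exact: (computable_comp cc computable_injective_test).
  by apply: (computable_app2 computable_onto_test) => //; comp.
exact: computable_const.
Qed.

Definition small_vertices (es : seq tree) : Prop :=
  forall e, e \in es -> not_new 0 (esrc e) /\ not_new 0 (etgt e).

Lemma injective_testE es :
  injective_test es = tree_of_bool (all (fun e => elab e != Nil) (spine es)).
Proof.
rewrite /injective_test.
case: (pick2P (p := fun _ e => elab e == Nil) is_epsE Nil es) => /= [[-> a _]|[e [-> ee p]]].
  by rewrite a.
rewrite (_ : all _ _ = false) //; apply/negbTE/allPn; exists e; last by rewrite negbK.
by rewrite (perm_mem p) mem_head.
Qed.

Lemma inj_coreP es : small_vertices (spine es) ->
  lg_inj Nil (map decw (spine es)) <-> injective_test (core es) = tree_true.
Proof.
(* For injectivity any [S] may be chosen; the full set satisfies all closure conditions. *)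
move=> sv; have [||g [q _]] := @expandP (fun=> True) es; [by []|exact: sv|].
have [g' [q' _] st] := fold_allP (fun=> True) g.
rewrite q q' injective_testE (stuck_inj (fun=> True) st g').
by case: (all _ _).
Qed.

Lemma bij_testP live es : small_vertices (spine es) ->
  (forall e, e \in spine es -> {in spine (elab e), forall l, thd l \in spine live}) ->
  lg_inj Nil (map decw (spine es)) /\ lg_onto Nil (rose (spine live)) (map decw (spine es))
  <-> bij_test live es = tree_true.
Proof.
move=> sv inl; have [||g [q r]] := @expandP (rose (spine live)) es; [|exact: sv|].
  (* All letters of the labels are live, so conjugation by them preserves the subgroup. *)
  move=> e ees l le k rk; have ll : rose (spine live) (lgen (dec_letter l)).
    have := inl _ ees _ le; rewrite /dec_letter; case: (ttl l == Nil) => /= ll.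
      exact: gpd_gen.
    by rewrite lgenT; apply: gpd_inv; exact: gpd_gen.
  exact: gpd_mul (gpd_mul (gpd_inv ll) rk) ll.
have [g' [q' r'] st] := fold_allP (rose (spine live)) g.
rewrite q q' r r' /bij_test injective_testE (stuck_inj (fun=> True) st g').
case: (boolP (all _ _)) => a; last by split=> // -[].
by rewrite /= -(onto_testP _ st g' a); split=> [[]|].
Qed.

(** * From graphs to lists *)

Section GraphList.
Variables (G : graph) (v0 : vertex G) (lam : edge G -> K).

Definition graph_inj : Prop :=
  gpd_inj (fun=> True) (edge_src G) (edge_tgt G) lam.
Definition graph_onto (S : K -> Prop) : Prop :=
  gpd_onto (fun=> True) (edge_src G) (edge_tgt G) lam S.

Definition graph_list : seq (tree * K * tree) :=
  [seq (enc_nat (edge_src G e), lam e, enc_nat (edge_tgt G e)) | e <- enum (edge G)].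

Let gnthE (e : edge G) : gnth Nil graph_list e =
  (enc_nat (edge_src G e), lam e, enc_nat (edge_tgt G e)).
Proof.
by rewrite /gnth /graph_list (nth_map e) ?size_enum_ord // nth_ord_enum.
Qed.

Let a (e : edge G) : free_group nat := gen (val e).
Let b (i : nat) : free_group (edge G) := if insub i is Some e then gen e else 1.
Let r (t : tree) : vertex G :=
  odflt v0 [pick v : vertex G | enc_nat v == t].

Let rK (v : vertex G) : r (enc_nat v) = v.
Proof.
rewrite /r; case: pickP => [w /eqP/enc_nat_inj/val_inj //|/(_ v)].
by rewrite eqxx.
Qed.

Let glist_dom i : gdom graph_list i -> exists e : edge G, i = val e.
Proof. by rewrite /gdom size_map size_enum_ord => si; exists (Ordinal si). Qed.

Let aP e : True -> lgpd Nil graph_list (enc_nat (edge_src G e)) (enc_nat (edge_tgt G e)) (a e).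
Proof.
move=> _; apply: lgpd_gen; rewrite /gsrc /gtgt ?gnthE //.
rewrite /graph_list size_map size_enum_ord; exact: ltn_ord.
Qed.

Let bE (e : edge G) : b (val e) = gen e.
Proof. by rewrite /b valK. Qed.

Let bP i : gdom graph_list i ->
  gp (r (gsrc Nil graph_list i)) (r (gtgt Nil graph_list i)) (b i).
Proof.
move=> /glist_dom[e ->]; rewrite bE /gsrc /gtgt gnthE /= !rK.
exact: gpd_gen.
Qed.

Lemma graph_list_inj : graph_inj <-> lg_inj Nil graph_list.
Proof.
split.
  apply: (inj_transfer (r := r) (a := b) (c := fun=> 1) (b := a) (d := fun=> 1)) => //.
  - by move=> i /glist_dom[e ->]; rewrite bE fhom_gen /glab gnthE; gsimp.
  - by move=> i /glist_dom[e ->]; rewrite bE fhom_gen; gsimp.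
apply: (inj_transfer (r := fun v : vertex G => enc_nat v) (a := a) (c := fun=> 1)
  (b := b) (d := fun=> 1)) => //.
- by move=> e _; rewrite fhom_gen /glab gnthE; gsimp.
- by move=> e _; rewrite fhom_gen bE; gsimp.
Qed.

Lemma graph_list_onto S : graph_onto S <-> lg_onto Nil S graph_list.
Proof.
split.
  apply: (onto_transfer (r := fun v : vertex G => enc_nat v) (a := a) (c := fun=> 1)) => //.
  - by move=> e _; rewrite fhom_gen /glab gnthE; gsimp.
  - by move=> _ k; gsimp.
apply: (onto_transfer (r := r) (a := b) (c := fun=> 1)) => //.
- by move=> i /glist_dom[e ->]; rewrite bE fhom_gen /glab gnthE; gsimp.
- by move=> _ k; gsimp.
Qed.

End GraphList.

(** * Collapsing the edges of the target that are not loops *)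

Definition erase (dead : seq tree) : K -> K :=
  fhom (fun a => if a \in dead then 1 else gen a).

Section Collapse.
Variable G : graph.
Implicit Types (lam : edge G -> K) (D : tree -> Prop) (s t : tree -> tree).
Implicit Types (rho : vertex G -> tree).

(** The target is a graph on trees with edge set [D], so that it can shrink while the source stays
    fixed; [rho] follows the vertices of [G] through the collapses. *)
Definition graph_bij lam D s t rho : Prop :=
  graph_inj lam /\ exists u, forall k, gpd D s t (rho u) (rho u) k ->
    exists2 g, gp u u g & fhom lam g = k.

Definition label_valid lam D s t rho : Prop :=
  forall e, gpd D s t (rho (edge_src G e)) (rho (edge_tgt G e)) (lam e).

(** This is the form in which connectedness survives the collapses: once only loops are left, it
    places all of them at the image of each vertex of [G]. *)
Definition target_connected D s t rho : Prop :=
  forall u a, D a -> exists k, gpd D s t (rho u) (s a) k.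

Section Step.
Variables (lam : edge G -> K) (D : tree -> Prop) (s t : tree -> tree).
Variables (rho : vertex G -> tree) (a0 : tree).
Hypothesis Da0 : D a0.
Hypothesis sta0 : s a0 != t a0.
Hypothesis lamP : label_valid lam D s t rho.

Let ren := rename (s a0) (t a0).
Let D' a := D a /\ a != a0.
Let er : K -> K := fhom (fun a => if a == a0 then 1 else gen a).
Let d (w : tree) : K := if w == t a0 then (gen a0)^-1 else 1.
(** A homotopy inverse of the collapse: [d w] leads from [w] to its new name along the collapsed
    edge, and every remaining edge is rerouted through these paths. *)
Let back : K -> K := fhom (fun a => (d (s a))^-1 * gen a * d (t a)).

Let erM : is_hom er := fhomM _.
Let backM : is_hom back := fhomM _.

Let er_valid u v k : gpd D s t u v k ->
  gpd D' (ren \o s) (ren \o t) (ren u) (ren v) (er k).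
Proof.
apply: gpd_map => a Da /=; case: (eqVneq a a0) => [->|na]; last exact: gpd_gen.
by rewrite /ren /rename eqxx (negbTE sta0); exact: gpd_one.
Qed.

Let dP w : gpd D s t w (ren w) (d w).
Proof.
rewrite /d /ren /rename; case: eqP => [->|_]; last exact: gpd_one.
by apply: gpd_inv; exact: gpd_gen.
Qed.

Let back_valid u v k : gpd D' (ren \o s) (ren \o t) u v k -> gpd D s t u v (back k).
Proof.
apply: (gpd_map (r := id)) => a [Da _] /=.
exact: gpd_mul (gpd_mul (gpd_inv (dP _)) (gpd_gen _ _ Da)) (dP _).
Qed.

Let er_d w : er (d w) = 1.
Proof.
by rewrite /d; case: ifP => // _; rewrite /er fhomV fhom_gen eqxx invg1.
Qed.

Let back_er u v k : gpd D s t u v k -> back (er k) = (d u)^-1 * k * d v.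
Proof.
have idM : is_hom (@idfun K) by [].
apply: (gpd_conj idM (hom_comp erM backM)) => a Da /=.
rewrite /er fhom_gen; case: (eqVneq a a0) => [->|na].
  by rewrite (hom1 backM) /d eqxx (negbTE sta0) invg1 mul1g mulgV.
by rewrite /back fhom_gen.
Qed.

Let er_back u v k : gpd D' (ren \o s) (ren \o t) u v k -> er (back k) = k.
Proof.
have idM : is_hom (@idfun K) by [].
move=> vk; have := @gpd_conj _ _ _ _ _ _ _ _ (fun=> 1) idM (hom_comp backM erM) _ _ _ _ vk.
rewrite /= invg1 mul1g mulg1; apply => a [Da na].
rewrite /back fhom_gen !erM (homV erM) !er_d /er fhom_gen (negbTE na).
by gsimp.
Qed.

Let er_inj u k : gpd D s t u u k -> er k = 1 -> k = 1.
Proof.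
move=> uk ek; have := back_er uk; rewrite ek (hom1 backM) => h.
have -> : k = d u * ((d u)^-1 * k * d u) * (d u)^-1 by gsimp.
by rewrite -h; gsimp.
Qed.

Let lam_valid u v g : gp u v g -> gpd D s t (rho u) (rho v) (fhom lam g).
Proof. by apply: gpd_map => e _; exact: lamP. Qed.

Let er_lam g : fhom (er \o lam) g = er (fhom lam g).
Proof. by rewrite (fhom_comp _ erM). Qed.

Lemma label_valid_collapse :
  label_valid (er \o lam) D' (ren \o s) (ren \o t) (ren \o rho).
Proof. by move=> e; exact: er_valid (lamP e). Qed.

Lemma target_connected_collapse : target_connected D s t rho ->
  target_connected D' (ren \o s) (ren \o t) (ren \o rho).
Proof.
by move=> cn u a [Da _]; have [k /er_valid kP] := cn u a Da; exists (er k).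
Qed.

(** On vertex groups [er] is a bijection, with inverse [back] up to conjugation by [d], so composing
    the labels with it affects neither injectivity nor surjectivity. *)
Lemma graph_bij_collapse : graph_bij lam D s t rho <->
  graph_bij (er \o lam) D' (ren \o s) (ren \o t) (ren \o rho).
Proof.
split=> -[inj [u uP]]; split.
- move=> w g wg; rewrite er_lam => /er_inj h.
  by apply: (inj w) => //; apply: h; exact: lam_valid wg.
- exists u => k kP; have bk := back_valid kP.
  have [|g ug gE] := uP (d (rho u) * back k * (d (rho u))^-1).
    exact: gpd_mul (gpd_mul (dP _) bk) (gpd_inv (dP _)).
  exists g => //; rewrite er_lam gE !erM (homV erM) er_d (er_back kP).
  by gsimp.
- move=> w g wg g1; apply: (inj w) => //.
  by rewrite er_lam g1 (hom1 erM).
- exists u => k kP; have [g ug] := uP _ (er_valid kP); rewrite er_lam => gE.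
  exists g => //; apply: divg1_eq; apply: (@er_inj (rho u)).
    exact: gpd_mul (lam_valid ug) (gpd_inv kP).
  by rewrite erM (homV erM) gE mulgV.
Qed.

End Step.

(** If all edges are loops, no path leaves its vertex. Connectedness then puts all live edges at one
    vertex, whose group is generated by them. *)
Lemma graph_bij_loops lam live s t rho :
  (forall a, a \in live -> s a = t a) ->
  target_connected (fun a => a \in live) s t rho ->
  graph_bij lam (fun a => a \in live) s t rho <->
  graph_inj lam /\ graph_onto lam (rose live).
Proof.
move=> st cn.
have loop u v k : gpd (fun a => a \in live) s t u v k -> u = v.
  by elim=> // ? ? ? ? ? _ -> _ ->.
have sr u a : a \in live -> s a = rho u.
  by move=> al; have [k /loop] := cn u a al.
have E u k : gpd (fun a => a \in live) s t (rho u) (rho u) k <-> rose live k.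
  split=> kP; rewrite -[k]fhom_id.
    by apply: (gpd_map (r := fun=> tt)) kP => a al; exact: gpd_gen.
  apply: (gpd_map (r := fun=> rho u)) kP => a al.
  by apply: gpd_gen' => //; rewrite -?st // (sr u).
by split=> -[inj [u uP]]; split=> //; exists u => k kP; apply: uP; apply/(E u).
Qed.

End Collapse.

(** * Programs that assemble the labelled graph and collapse the target *)

Definition build_step (e st : tree) : tree :=
  Cons (ttl (thd st)) (Cons (mk (thd e) (thd (thd st)) (ttl e)) (ttl st)).
Definition build (es ws : tree) : tree := ttl (tfold build_step (Cons ws Nil) es).

Lemma computable_build : computable2 build.
Proof.
apply: computable_tl.
apply: (computable_fold (f := fun _ => build_step) (e := fun=> Nil));
  rewrite /computable3 /build_step; comp.
Qed.

Lemma buildE (T : Type) (a b w : T -> tree) (s : seq T) :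
  spine (build (enc_seq (fun x => Cons (a x) (b x)) s) (enc_seq w s)) =
  rev [seq mk (a x) (w x) (b x) | x <- s].
Proof.
rewrite /build tfoldE spine_enc.
suff H acc : spine (ttl (foldl (fun st e => build_step e st) (Cons (enc_seq w s) acc)
    [seq Cons (a x) (b x) | x <- s])) = rev [seq mk (a x) (w x) (b x) | x <- s] ++ spine acc.
  by rewrite H cats0.
by elim: s acc => //= x s IH acc; rewrite IH rev_cons cat_rcons.
Qed.

(** Each edge of the target gets its own numeral as label, so that after renaming of vertices the
    label still tells which letter to erase. *)
Definition number_step (e st : tree) : tree :=
  Cons (Cons Nil (thd st)) (Cons (mk (thd e) (thd st) (ttl e)) (ttl st)).
Definition number (es : tree) : tree := ttl (tfold number_step (Cons Nil Nil) es).

Lemma computable_number : computable number.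
Proof.
apply: computable_tl.
apply: (computable_fold (f := fun _ => number_step) (e := fun=> Nil));
  rewrite /computable3 /number_step; comp.
Qed.

Lemma numberE m (a b : 'I_m -> tree) :
  spine (number (enc_seq (fun x => Cons (a x) (b x)) (enum 'I_m))) =
  rev [seq mk (a x) (enc_nat x) (b x) | x <- enum 'I_m].
Proof.
rewrite /number tfoldE spine_enc.
suff H s : forall n acc, [seq val x | x <- s] = iota n (size s) ->
    spine (ttl (foldl (fun st e => number_step e st) (Cons (enc_nat n) acc)
    [seq Cons (a x) (b x) | x <- s])) = rev [seq mk (a x) (enc_nat x) (b x) | x <- s] ++ spine acc.
  by rewrite (H _ 0) ?cats0 // val_enum_ord size_enum_ord.
elim: s => //= x s IH n acc [xn sn].
rewrite (_ : number_step _ _ =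
  Cons (enc_nat n.+1) (Cons (mk (a x) (enc_nat n) (b x)) acc)) //.
by rewrite IH // rev_cons cat_rcons xn.
Qed.

(** A loop stays a loop under all later renamings, so it can be declared live at once. *)
Definition collapse_step (st : tree) : tree :=
  let e := thd (thd st) in
  let live := thd (ttl st) in
  let dead := ttl (ttl st) in
  tif (teq (esrc e) (etgt e))
    (Cons (ttl (thd st)) (Cons (Cons (elab e) live) dead))
    (Cons (renl (esrc e) (etgt e) (ttl (thd st))) (Cons live (Cons (elab e) dead))).
Definition collapse (es : tree) : tree :=
  ttl (tfold (fun _ st => collapse_step st) (Cons es (Cons Nil Nil)) es).

Lemma computable_collapse : computable collapse.
Proof.
have cs : computable collapse_step.
  rewrite /collapse_step; comp.
  by apply: (computable_app3 computable_renl); comp.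
have cs3 : computable3 (fun _ _ st => collapse_step st).
  by apply: (computable_comp _ cs); comp.
apply: computable_tl.
by apply: (computable_fold (f := fun _ _ st => collapse_step st) (e := fun=> Nil)) => //; comp.
Qed.

Lemma erase_nil k : erase [::] k = k.
Proof. by rewrite -[RHS]fhom_id; apply: eq_fhom. Qed.

Lemma erase_cons a dead k :
  erase (a :: dead) k = fhom (fun b => if b == a then 1 else gen b) (erase dead k).
Proof.
rewrite /erase (fhom_comp _ (fhomM _)); apply: eq_fhom => b /=.
by rewrite inE; case: (b \in dead); rewrite ?orbT ?orbF ?fhom_gen.
Qed.

(** The ends of the edges change with every collapse, so the induction runs over all [s], [t] and
    [rho]. The last conclusion guarantees that the letters left after erasure are live, as the
    bijectivity test requires. *)
Lemma collapseP (G : graph) (lam : edge G -> K) n : forall T todo live dead s t rho,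
  size T = n -> spine todo = [seq mk (s a) a (t a) | a <- T] ->
  uniq (T ++ spine live) -> (forall a, a \in spine live -> s a = t a) ->
  let D a := is_true (a \in T ++ spine live) in
  label_valid (erase (spine dead) \o lam) D s t rho ->
  target_connected D s t rho ->
  exists live' dead',
  [/\ iter n collapse_step (Cons todo (Cons live dead)) = Cons Nil (Cons live' dead'),
      graph_bij (erase (spine dead) \o lam) D s t rho <->
      graph_inj (erase (spine dead') \o lam) /\
      graph_onto (erase (spine dead') \o lam) (rose (spine live')) &
      forall a, a \in T ++ spine live ++ spine dead ->
        a \in spine live' ++ spine dead'].
Proof.
elim: n => [|n IH] T todo live dead s t rho.
  move=> /size0nil-> tE _ st D lamP cn; exists live, dead; split=> //.
    by case: (todo) tE.
  exact: graph_bij_loops.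
case: T => [//|a T] [Tn]; case: todo => [//|e todo] [-> tE] uT st D lamP cn.
rewrite iterSr /collapse_step /= teqE tif_bool /esrc /etgt /elab /=.
case: eqP => [sta|/eqP sta].
  have pT : perm_eq (T ++ a :: spine live) (a :: T ++ spine live).
    by rewrite (perm_catCA T [:: a]).
  have DE : D = (fun b => is_true (b \in T ++ spine (Cons a live))).
    by apply/funext => b; rewrite /D -(perm_mem pT).
  have [||||live' [dead' [E q sub]]] := IH T todo (Cons a live) dead s t rho Tn tE.
  - by rewrite (perm_uniq pT).
  - by move=> b; rewrite /= inE => /predU1P[->//|]; exact: st.
  - by rewrite -DE.
  - by rewrite -DE.
  exists live', dead'; split=> //; first by rewrite DE.
  move=> b bT; apply: sub; move: bT; rewrite !(mem_cat, inE) /=.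
  by case: (b == a); case: (b \in T).
have aD : D a by rewrite /D mem_head.
have /andP[aT uT'] : (a \notin T ++ spine live) && uniq (T ++ spine live) := uT.
have DE : (fun b => D b /\ b != a) = (fun b => is_true (b \in rev T ++ spine live)).
  apply/funext => b; apply/propext; rewrite /D /= inE !mem_cat mem_rev.
  split=> [[/predU1P[->|//]]|h]; first by rewrite eqxx.
  split; first by rewrite h orbT.
  by apply: contraNneq aT => <-; rewrite mem_cat.
have EE : erase (spine (Cons a dead)) \o lam =
    fhom (fun b => if b == a then 1 else gen b) \o (erase (spine dead) \o lam).
  by apply/funext => b; rewrite /= erase_cons.
have lv := label_valid_collapse sta lamP.
have tc := target_connected_collapse sta cn.
have gb := graph_bij_collapse aD sta lamP.
set ren := rename (s a) (t a) in lv tc gb.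
(* [renl] reverses the list of edges, hence [rev T]. *)
have [||||||live' [dead' [E q sub]]] := IH (rev T) (renl (s a) (t a) todo) live (Cons a dead)
    (ren \o s) (ren \o t) (ren \o rho).
- by rewrite size_rev.
- rewrite /renl spine_tfold_cons cats0 tE -map_comp map_rev; congr rev.
  by apply: eq_map => b; rewrite /= /rene /renm /ren /rename /= !teqE !tif_bool.
- by rewrite (@perm_uniq _ _ (T ++ spine live)) // perm_cat2r perm_rev.
- by move=> b /st /= ->.
- by rewrite EE -DE.
- by rewrite -DE.
exists live', dead'; split=> //.
  rewrite -q EE -DE; exact: gb.
move=> b bT; apply: sub; move: bT; rewrite /= !(mem_cat, inE) mem_rev.
by case: (b == a); case: (b \in T); case: (b \in spine live).
Qed.

Definition reverse (l : tree) : tree := tfold Cons Nil l.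
(** The fold turns the word around, so it is reversed again; in lists of edges the order is
    immaterial. *)
Definition erase_word (dead w : tree) : tree :=
  reverse (tfold (fun l acc => tif (tmem (thd l) dead) acc (Cons l acc)) Nil w).
Definition erase_edges (dead es : tree) : tree :=
  tfold (fun e acc => Cons (mk (esrc e) (erase_word dead (elab e)) (etgt e)) acc) Nil es.

Lemma computable_erase_edges : computable2 erase_edges.
Proof.
have cr : computable reverse.
  apply: (computable_fold (f := fun _ => Cons) (e := fun=> Nil)); rewrite /computable3; comp.
have cw : computable2 erase_word.
  apply: (computable_comp _ cr).
  apply: (computable_fold (f := fun d l acc => tif (tmem (thd l) d) acc (Cons l acc))).
  - rewrite /computable3; comp; by apply: (computable_app2 computable_tmem); comp.
  - by comp.
  - by comp.
  - by comp.
apply: (computable_fold (f := fun d e acc =>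
  Cons (mk (esrc e) (erase_word d (elab e)) (etgt e)) acc)).
- rewrite /computable3; comp; by apply: (computable_app2 cw); comp.
- by comp.
- by comp.
- by comp.
Qed.

Lemma erase_wordE dead w :
  spine (erase_word dead w) = [seq l <- spine w | thd l \notin spine dead].
Proof.
rewrite /erase_word /reverse (spine_tfold_cons id) cats0 map_id tfoldE.
rewrite -[RHS]revK; congr rev.
elim/last_ind: (spine w) => //= s l IH.
rewrite foldl_rcons tmemE tif_bool filter_rcons; case: ifP => _ /=; first exact: IH.
by rewrite IH rev_rcons.
Qed.

Lemma word_val_erase dead w :
  word_val (erase_word dead w) = erase (spine dead) (word_val w).
Proof.
rewrite /word_val erase_wordE; elim: (spine w) => [|l s IH] /=; first by [].
rewrite [in RHS]word_elt_cons /erase fhomM -/(erase _) -IH /erase.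
rewrite [in RHS]fhom_lgen /lval /dec_letter /=.
case: (thd l \in spine dead) => /=; first by rewrite invg1 if_same mul1g.
by rewrite word_elt_cons; case: (ttl l == Nil); rewrite //= lgenT.
Qed.

Lemma erase_edgesE dead es : spine (erase_edges dead es) =
  rev [seq mk (esrc e) (erase_word dead (elab e)) (etgt e) | e <- spine es].
Proof. by rewrite /erase_edges spine_tfold_cons cats0. Qed.

Lemma not_new_enc_nat n : not_new 0 (enc_nat n).
Proof. by case: n => [|n] m _; apply/eqP. Qed.

(** * The tests applied to encoded tight maps *)

Definition embed n : free_group 'I_n -> K := fhom (fun i : 'I_n => gen (enc_nat i)).

Lemma embed_inj n : injective (@embed n).
Proof.
apply: (@fhom_map_inj _ _ (fun i : 'I_n => enc_nat i)).
by move=> i j /enc_nat_inj/val_inj.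
Qed.

Lemma word_val_enc n (w : seq (letter 'I_n)) :
  word_val (enc_word w) = embed (word_elt w).
Proof.
rewrite /word_val /enc_word spine_enc; elim: w => [//|[i b] w IH] /=.
rewrite !word_elt_cons IH [RHS]fhomM; congr (_ * _).
by rewrite [RHS]fhom_lgen /lval /dec_letter /=; case: b => //=; rewrite lgenT.
Qed.

Section Map.
Variables (G H : graph) (f : tight_map G H).
Hypothesis G0 : exists v : vertex G, True.
Hypothesis H0 : exists v : vertex H, True.

Let lam (e : edge G) : K := embed (word_elt (emap f e)).

Lemma fhom_lam g : fhom lam g = embed (edge_hom f g).
Proof. by rewrite /edge_hom /embed (fhom_comp _ (fhomM _)). Qed.

Lemma comb_injP : comb_inj f <-> graph_inj lam.
Proof.
split=> inj u g ug.
  rewrite fhom_lam => g1; apply: (inj u) => //; apply: embed_inj.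
  by rewrite g1.
move=> g1; apply: (inj u) => //; by rewrite fhom_lam g1.
Qed.

Definition edges_of (i : tree) : tree :=
  build (ttl (thd (thd i))) (ttl (ttl i)).

Lemma edges_ofE : spine (edges_of (enc_tight_map f)) =
  rev [seq mk (enc_nat (edge_src G e)) (enc_word (emap f e)) (enc_nat (edge_tgt G e))
      | e <- enum (edge G)].
Proof. exact: buildE. Qed.

Lemma small_edges : small_vertices (spine (edges_of (enc_tight_map f))).
Proof.
move=> e; rewrite edges_ofE mem_rev => /mapP[x _ ->].
by split; exact: not_new_enc_nat.
Qed.

Lemma comb_inj_test : comb_inj f <->
  injective_test (core (edges_of (enc_tight_map f))) = tree_true.
Proof.
have [v0 _] := G0.
rewrite comb_injP (graph_list_inj v0) -inj_coreP; last exact: small_edges.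
have p : perm_eq (graph_list lam) (map decw (spine (edges_of (enc_tight_map f)))).
  rewrite edges_ofE map_rev perm_sym perm_rev -map_comp /graph_list.
  rewrite (eq_map (g := fun e => (enc_nat (edge_src G e), lam e, enc_nat (edge_tgt G e)))) //.
  by move=> e; rewrite /= /decw /= word_val_enc.
by have [q _] := lg_equiv_perm Nil (fun=> True) p.
Qed.

End Map.

Lemma bij_testE live es : bij_test live es = tree_of_bool
  (all (fun e => elab e != Nil) (spine (core es)) &&
   ((live == Nil) || has (fun e => all (fun a =>
      mk (esrc e) (Cons a Nil) (esrc e) \in spine (core es)) (spine live)) (spine (core es)))).
Proof. by rewrite /bij_test injective_testE onto_testE tandE. Qed.

Definition bij_program (i : tree) : tree :=
  let c := collapse (number (ttl (ttl (thd i)))) in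
  bij_test (thd c) (erase_edges (ttl c) (edges_of i)).

Lemma computable_edges_of : computable edges_of.
Proof. by apply: (computable_app2 computable_build); comp. Qed.

Lemma computable_bij_program : computable bij_program.
Proof.
have cc : computable (fun i => collapse (number (ttl (ttl (thd i))))).
  apply: (computable_comp _ computable_collapse).
  by apply: (computable_comp _ computable_number); comp.
apply: (computable_app2 computable_bij_test); first exact: computable_hd.
apply: (computable_app2 computable_erase_edges); first exact: computable_tl.
exact: computable_edges_of.
Qed.

Section Bij.
Variables (G H : graph) (f : tight_map G H).
Hypothesis G0 : exists v : vertex G, True.
Hypothesis H0 : exists v : vertex H, True.
Hypothesis HC : forall u v : vertex H, exists g, gp u v g.

Let lam (e : edge G) : K := embed (word_elt (emap f e)).
Let find_edge (a : tree) : option (edge H) := [pick e : edge H | enc_nat e == a].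
Let s (a : tree) : tree := if find_edge a is Some e then enc_nat (edge_src H e) else Nil.
Let t (a : tree) : tree := if find_edge a is Some e then enc_nat (edge_tgt H e) else Nil.
(** The order is the one in which [number] leaves the edges. *)
Let T : seq tree := rev [seq enc_nat e | e : edge H <- enum (edge H)].
Let rho (v : vertex G) : tree := enc_nat (vmap f v).
Let D (a : tree) : Prop := a \in T ++ spine Nil.

Let find_edgeE (e : edge H) : find_edge (enc_nat e) = Some e.
Proof.
rewrite /find_edge; case: pickP => [x /eqP/enc_nat_inj/val_inj->//|/(_ e)].
by rewrite eqxx.
Qed.

Let DP a : D a <-> exists e : edge H, a = enc_nat e.
Proof.
rewrite /D cats0 mem_rev; split=> [/mapP[e _ ->]|[e ->]]; first by exists e.
by apply: map_f; rewrite mem_enum.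
Qed.

Let embed_gp (u v : vertex H) k : gp u v k -> gpd D s t (enc_nat u) (enc_nat v) (embed k).
Proof.
apply: (gpd_map (r := fun v : vertex H => enc_nat v)) => e _.
apply: gpd_gen'; last 2 first.
- by rewrite /s find_edgeE.
- by rewrite /t find_edgeE.
by apply/DP; exists e.
Qed.

Let unembed_gp (u v : vertex H) k : gpd D s t (enc_nat u) (enc_nat v) k ->
  exists2 k', gp u v k' & embed k' = k.
Proof.
have [v0 _] := H0.
pose r (x : tree) : vertex H := odflt v0 [pick v : vertex H | enc_nat v == x].
have rK (w : vertex H) : r (enc_nat w) = w.
  rewrite /r; case: pickP => [x /eqP/enc_nat_inj/val_inj //|/(_ w)].
  by rewrite eqxx.
pose b (a : tree) : free_group (edge H) := if find_edge a is Some e then gen e else 1.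
move=> uk; exists (fhom b k).
  have := gpd_map (r := r) (a := b) (D' := fun=> True) (s' := edge_src H)
    (t' := edge_tgt H) _ uk; rewrite !rK; apply=> a /DP[e ->].
  by rewrite /b /s /t find_edgeE !rK; exact: gpd_gen.
have idM : is_hom (@idfun K) by [].
have := @gpd_conj _ _ _ _ _ _ _ _ (fun=> 1) idM (hom_comp (fhomM b) (fhomM _)) _ _ _ _ uk.
rewrite /= invg1 mul1g mulg1; apply=> a /DP[e ->].
by rewrite fhom_gen /b find_edgeE fhom_gen; gsimp.
Qed.

Let lam_valid : label_valid lam D s t rho.
Proof.
move=> e; apply: embed_gp; apply/gpE.
by rewrite word_elt_inj_reduced ?emap_tight //; exact: emap_path.
Qed.

Let target_conn : target_connected D s t rho.
Proof.
move=> u a /DP[e ->]; have [g gP] := HC (vmap f u) (edge_src H e).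
by exists (embed g); rewrite /s find_edgeE; exact: embed_gp.
Qed.

Let comb_bijP : comb_inj f /\ comb_onto f <-> graph_bij lam D s t rho.
Proof.
rewrite /graph_bij; split=> -[inj [u uP]]; split.
- exact/comb_injP.
- exists u => k /unembed_gp[k' /uP[g ug gk] kk']; exists g => //.
  by rewrite fhom_lam gk.
- exact/comb_injP.
- exists u => k /embed_gp/uP[g ug gk]; exists g => //.
  by apply: embed_inj; rewrite -fhom_lam.
Qed.

Lemma comb_bij_test : comb_inj f /\ comb_onto f <->
  bij_program (enc_tight_map f) = tree_true.
Proof.
have [v0 _] := G0.
rewrite /bij_program /= /enc_graph /=.
set hs := number _.
have hsE : spine hs = [seq mk (s a) a (t a) | a <- T].
  rewrite /hs numberE /T map_rev -map_comp; congr rev; apply: eq_map => e /=.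
  by rewrite /s /t find_edgeE.
have uT : uniq (T ++ spine Nil).
  rewrite cats0 rev_uniq map_inj_uniq ?enum_uniq //.
  by move=> x y /enc_nat_inj/val_inj.
have E0 : erase (spine Nil) \o lam = lam by apply/funext => e; exact: erase_nil.
have := @collapseP G lam _ T hs Nil Nil s t rho erefl hsE uT (fun _ => ltac:(by []))
  _ target_conn.
rewrite E0 => /(_ lam_valid)[live [dead [cE q sub]]].
rewrite /collapse tfold_iter hsE size_map cE /=.
rewrite comb_bijP q (graph_list_inj v0) (graph_list_onto v0).
set es := erase_edges dead _.
have esE : spine es = rev [seq mk (esrc e) (erase_word dead (elab e)) (etgt e)
    | e <- spine (edges_of (enc_tight_map f))] by exact: erase_edgesE.
rewrite -bij_testP.
- have p : perm_eq (graph_list (erase (spine dead) \o lam)) (map decw (spine es)).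
    rewrite esE edges_ofE map_rev perm_sym perm_rev -map_comp map_rev perm_rev.
    rewrite -map_comp /graph_list.
    rewrite (eq_map (g := fun e => (enc_nat (edge_src G e), erase (spine dead) (lam e),
      enc_nat (edge_tgt G e)))) //.
    by move=> e; rewrite /= /decw /elab /= word_val_erase word_val_enc.
  by have [-> ->] := lg_equiv_perm Nil (rose (spine live)) p.
- move=> e; rewrite esE mem_rev => /mapP[x xs ->].
  exact: small_edges xs.
- move=> e; rewrite esE mem_rev => /mapP[x + ->].
  rewrite edges_ofE mem_rev => /mapP[y _ ->] l.
  rewrite /elab /= erase_wordE mem_filter spine_enc => /andP[nd /mapP[z _ lz]].
  have : thd l \in T ++ spine Nil ++ spine Nil.
    rewrite lz /= cats0 mem_rev; apply: map_f; exact: mem_enum.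
  by move/sub; rewrite mem_cat (negbTE nd) orbF.
Qed.

End Bij.

(** * Free bases *)

Section FreeBasis.
Variables (n : nat) (w : n.-tuple (seq (letter 'I_n))).

Let b (i : 'I_n) : free_group 'I_n := word_elt (tnth w i).

(** The universal property for the standard generators yields a left inverse [phi] of [fhom b]. Its
    uniqueness clause yields surjectivity: [fhom b \o phi] and the identity both extend [b]. *)
Lemma free_basisP : is_free_basis b <->
  (forall g, fhom b g = 1 -> g = 1) /\ (forall k, exists g, fhom b g = k).
Proof.
split=> [fb|[inj onto] L k].
  have [phi [phiM phib _]] := fb (free_group 'I_n) (@gen _).
  have phiK g : phi (fhom b g) = g.
    rewrite -[RHS]fhom_id.
    apply: (hom_ext (hom_comp (fhomM b) phiM) (fhomM _)) => i.
    by rewrite /= !fhom_gen phib.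
  split=> [g g1|k]; first by rewrite -(phiK g) g1 (hom1 phiM).
  have [psi [_ _ psiU]] := fb (free_group 'I_n) b.
  have h0 i : (fhom b \o phi) (b i) = b i by rewrite /= phib fhom_gen.
  have h1 := psiU _ (hom_comp phiM (fhomM b)) h0.
  have h2 : @idfun (free_group 'I_n) =1 psi by exact: psiU.
  by exists (phi k); rewrite -[LHS]/((fhom b \o phi) k) h1 -h2.
have /choice[inv invE] := onto.
have invK g : inv (fhom b g) = g.
  by apply: (hom_inj (fhomM b) inj); rewrite invE.
have invM : is_hom inv.
  by move=> x y; apply: (hom_inj (fhomM b) inj); rewrite fhomM !invE.
exists (fhom k \o inv); split.
- by move=> x y; rewrite /= invM fhomM.
- by move=> i; rewrite /= -(fhom_gen b) invK fhom_gen.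
- move=> psi psiM psib x; rewrite -(invE x) /= invK.
  apply: (hom_ext (hom_comp (fhomM b) psiM) (fhomM k)) => i.
  by rewrite /= !fhom_gen psib.
Qed.

(** A tuple of words is a labelling of the [n] petals of a rose, so the folding test applies
    directly, with all letters live. *)
Let Rose : graph := @Graph 1 n [ffun=> ord0] [ffun=> ord0].
Let lam (e : edge Rose) : K := embed (b e).

Let rose_gp (g : free_group (edge Rose)) : @gp Rose ord0 ord0 g.
Proof.
elim/free_ind: g => [|l g IH]; first exact: gpd_one.
apply: gpd_mul IH.
have := @gpd_lgen _ _ (fun=> True) (edge_src Rose) (edge_tgt Rose) l Logic.I.
by rewrite /lsrc !ffunE !if_same.
Qed.

Let embed_rose (k : free_group 'I_n) :
  rose [seq enc_nat i | i : 'I_n] (embed k).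
Proof.
apply: (gpd_map (r := fun _ : vertex Rose => tt)) (rose_gp k) => i _.
by apply: gpd_gen; apply: map_f; rewrite mem_enum.
Qed.

Let unembed_rose (k : K) : rose [seq enc_nat i | i : 'I_n] k ->
  exists k' : free_group 'I_n, embed k' = k.
Proof.
rewrite /rose; move: tt tt => x y.
elim=> {x y k} [_|a /mapP[i _ ->]|_ _ g _ [g' <-]|_ _ _ g h _ [g' <-] _ [h' <-]].
- by exists 1.
- by exists (gen i); rewrite /embed fhom_gen.
- by exists g'^-1; rewrite /embed fhomV.
- by exists (g' * h'); rewrite /embed fhomM.
Qed.

Lemma free_basis_graph : is_free_basis b <->
  graph_inj lam /\ graph_onto lam (rose [seq enc_nat i | i : 'I_n]).
Proof.
have lamE g : fhom lam g = embed (fhom b g).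
  by rewrite /embed [RHS](fhom_comp _ (fhomM _)).
rewrite free_basisP; split=> -[inj onto]; split.
- move=> u g _; rewrite lamE => g1; apply: inj; apply: embed_inj.
  by rewrite g1.
- exists ord0 => _ /unembed_rose[k <-]; have [g gk] := onto k.
  by exists g; [exact: rose_gp|rewrite lamE gk].
- by move=> g g1; apply: (inj ord0); [exact: rose_gp|rewrite lamE g1].
- move=> k; have [u uP] := onto; have [g _ gE] := uP _ (embed_rose k).
  by exists g; apply: embed_inj; rewrite -lamE.
Qed.

Definition letters_step (st : tree) : tree := Cons (Cons Nil (thd st)) (Cons (thd st) (ttl st)).
(** The rank is not encoded separately: the tuple has length [n], so the letters are obtained by
    counting the words. *)
Definition letters (ws : tree) : tree :=
  ttl (tfold (fun _ st => letters_step st) (Cons Nil Nil) ws).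
Definition loops (ws : tree) : tree :=
  tfold (fun x acc => Cons (mk Nil x Nil) acc) Nil ws.
Definition basis_program (ws : tree) : tree := bij_test (letters ws) (loops ws).

Lemma computable_basis_program : computable basis_program.
Proof.
apply: (computable_app2 computable_bij_test).
  apply: computable_tl.
  apply: (computable_fold (f := fun _ _ st => letters_step st) (e := fun=> Nil));
    rewrite /computable3 /letters_step; comp.
apply: (computable_fold (f := fun _ x acc => Cons (mk Nil x Nil) acc) (e := fun=> Nil));
  rewrite /computable3; comp.
Qed.

Lemma lettersE ws : spine (letters ws) = rev [seq enc_nat i | i <- iota 0 (size (spine ws))].
Proof.
rewrite /letters tfold_iter; move: (size _) => m.
suff -> : iter m letters_step (Cons Nil Nil) =
    Cons (enc_nat m) (enc_seq enc_nat (rev (iota 0 m))) by rewrite /= spine_enc map_rev.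
elim: m => // m IH.
by rewrite iterS IH -(addn1 m) iotaD rev_cat add0n /= addn1.
Qed.

Lemma basis_test : is_free_basis b <->
  basis_program (enc_seq (@enc_word n) w) = tree_true.
Proof.
rewrite free_basis_graph (@graph_list_inj Rose ord0) (@graph_list_onto Rose ord0).
have lE : spine (letters (enc_seq (@enc_word n) w)) =i [seq enc_nat i | i : 'I_n].
  move=> a; rewrite lettersE mem_rev spine_enc size_map size_tuple.
  by rewrite -val_enum_ord -map_comp.
have rE k : rose [seq enc_nat i | i : 'I_n] k <->
    rose (spine (letters (enc_seq (@enc_word n) w))) k.
  split; rewrite /rose => kP; rewrite -[k]fhom_id; apply: (gpd_map (r := id)) kP => a al.
    by apply: gpd_gen; rewrite lE.
  by apply: gpd_gen; rewrite -lE.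
have sE : spine (loops (enc_seq (@enc_word n) w)) = rev [seq mk Nil (enc_word x) Nil | x <- w].
  by rewrite /loops spine_tfold_cons cats0 spine_enc -map_comp.
rewrite /basis_program -bij_testP.
- have p : perm_eq (graph_list lam) (map decw (spine (loops (enc_seq (@enc_word n) w)))).
    rewrite sE map_rev perm_sym perm_rev -map_comp.
    rewrite -{1}[w : seq _](map_tnth_enum w) -map_comp.
    rewrite (_ : map _ _ = graph_list lam) //; apply: eq_map => e.
    by rewrite /= !ffunE /= /decw /elab /= word_val_enc.
  have [-> _] := lg_equiv_perm Nil (fun=> True) p.
  have [_ <-] := lg_equiv_perm Nil (rose (spine (letters (enc_seq (@enc_word n) w)))) p.
  suff -> : rose [seq enc_nat i | i : 'I_n] =
    rose (spine (letters (enc_seq (@enc_word n) w))) by [].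
  by apply/funext => k; apply/propext; exact: rE.
- move=> e; rewrite sE mem_rev => /mapP[x _ ->].
  by split; exact: (not_new_enc_nat 0).
- move=> e; rewrite sE mem_rev => /mapP[x _ ->] l.
  rewrite /elab /= spine_enc => /mapP[z _ ->] /=.
  by rewrite lE; apply: map_f; exact: mem_enum.
Qed.

End FreeBasis.

(** * The topology of the realization *)

Section Topology.
Import Order.TTheory GRing.Theory Num.Theory numFieldNormedType.Exports.
Local Open Scope classical_set_scope.
Local Open Scope ring_scope.
Local Open Scope quotient_scope.

Section Interval.
Variable R : realType.

Lemma coord_ge0 (t : unit_interval R) : 0 <= coord t.
Proof. by have := valP t; rewrite inE /= in_itv /= => /andP[]. Qed.

Lemma coord_le1 (t : unit_interval R) : coord t <= 1.
Proof. by have := valP t; rewrite inE /= in_itv /= => /andP[]. Qed.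

Lemma coord_inj : injective (@coord R).
Proof. exact: val_inj. Qed.

Lemma clampE (r : R) : coord (clamp r) = Num.max 0 (Num.min 1 r).
Proof. by []. Qed.

Lemma clamp_id (r : R) : 0 <= r <= 1 -> coord (clamp r) = r.
Proof. by case/andP=> r0 r1; rewrite clampE min_r // max_r. Qed.

Lemma coordK : cancel (@coord R) (@clamp R).
Proof. by move=> t; apply: coord_inj; rewrite clamp_id // coord_ge0 coord_le1. Qed.

Lemma clamp_le0 (r : R) : r <= 0 -> clamp r = zero.
Proof.
move=> r0; apply: coord_inj; rewrite coord0 clampE min_r; last by lra.
by rewrite max_l.
Qed.

Lemma clamp_ge1 (r : R) : 1 <= r -> clamp r = one.
Proof.
by move=> r0; apply: coord_inj; rewrite coord1 clampE min_l // max_r.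
Qed.

End Interval.

(** * Points of the realization and their neighbourhoods *)

Section Geom.
Variables (R : realType) (G : graph).
Local Notation X := (geom R G).
Local Notation I := (unit_interval R).
Implicit Types (v : vertex G) (e : edge G) (d : letter (edge G)) (x y : X) (r : R).

Lemma attach_repr (c : cells R G) : attach (repr (\pi_X c)) = attach c.
Proof.
have : repr (\pi_X c) = c %[mod X] by rewrite reprK.
by move/eqmodP => /eqP.
Qed.

(** Since [attach] moves the ends of 1-cells to 0-cells, an edge occurs in a normal form only with a
    parameter strictly between 0 and 1. *)
Definition nf (x : X) : vertex G + edge G * R :=
  match attach (repr x) with
  | existT (inl v) _ => inl v
  | existT (inr e) t => inr (e, coord t)
  end.

Definition ept (e : edge G) (r : R) : X := dpoint (e, false) r.

Lemma ept0 e : ept e 0 = vpoint R (edge_src G e).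
Proof. exact: dpoint0. Qed.

Lemma ept1 e : ept e 1 = vpoint R (edge_tgt G e).
Proof. exact: dpoint1. Qed.

Lemma dpoint_rev d r : dpoint (linv d) r = dpoint d (1 - r).
Proof. by case: d => e [] //; rewrite /dpoint /= subKr. Qed.

Lemma nf_vpoint v : nf (vpoint R v) = inl v.
Proof. by rewrite /nf attach_repr. Qed.

Lemma nf_ept e r : 0 < r < 1 -> nf (ept e r) = inr (e, r).
Proof.
move=> /andP[r0 r1]; rewrite /nf attach_repr /=.
have E : coord (clamp r) = r by rewrite clamp_id // !ltW.
rewrite ifF; last by apply/eqP => h; move: E r0; rewrite h coord0 => ->; rewrite ltxx.
rewrite ifF; last by apply/eqP => h; move: E r1; rewrite h coord1 => ->; rewrite ltxx.
by rewrite /cell1 /= E.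
Qed.

Variant geom_spec : X -> vertex G + edge G * R -> Prop :=
  | GeomVertex v : geom_spec (vpoint R v) (inl v)
  | GeomEdge e r of 0 < r < 1 : geom_spec (ept e r) (inr (e, r)).

Lemma geomP x : geom_spec x (nf x).
Proof.
suff [[v ->]|[e [r [r01 ->]]]] : (exists v, x = vpoint R v) \/
    (exists e r, 0 < r < 1 /\ x = ept e r).
- by rewrite nf_vpoint; constructor.
- by rewrite nf_ept //; constructor.
have := reprK x; case: (repr x) => -[v []|e t] <-; first by left; exists v.
have -> : \pi_X (cell1 e t) = ept e (coord t).
  by rewrite /ept /dpoint /= coordK.
have := coord_le1 t; have := coord_ge0 t.
rewrite le_eqVlt => /predU1P[<-|t0]; first by left; eexists; exact: ept0.
rewrite le_eqVlt => /predU1P[->|t1]; first by left; eexists; exact: ept1.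
by right; exists e, (coord t); rewrite t0 t1.
Qed.

Section GeomFun.
Variables (Y : topologicalType) (fv : vertex G -> Y) (fe : edge G -> R -> Y).
Hypothesis fe0 : forall e, fe e 0 = fv (edge_src G e).
Hypothesis fe1 : forall e, fe e 1 = fv (edge_tgt G e).
Hypothesis fc : forall e, continuous (fe e).

Definition cell_fun (c : cells R G) : Y :=
  match c with
  | existT (inl v) _ => fv v
  | existT (inr e) t => fe e (coord t)
  end.

Definition geom_fun (x : X) : Y := cell_fun (repr x).

Lemma cell_fun_attach (c : cells R G) : cell_fun (attach c) = cell_fun c.
Proof.
case: c => -[v //|e t] /=; case: eqP => [->|_] /=; first by rewrite coord0 fe0.
by case: eqP => [->|_] //=; rewrite coord1 fe1.
Qed.

Lemma geom_fun_vpoint v : geom_fun (vpoint R v) = fv v.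
Proof. by rewrite /geom_fun -cell_fun_attach attach_repr. Qed.

Lemma geom_fun_ept e r : 0 <= r <= 1 -> geom_fun (ept e r) = fe e r.
Proof.
move=> r01; rewrite /geom_fun -cell_fun_attach attach_repr cell_fun_attach /=.
by rewrite clamp_id.
Qed.

Lemma cell_fun_continuous : continuous cell_fun.
Proof.
have cE : cell_fun = (fun c => cell_fun (existT (@cell R G) (tag c) (tagged c))).
  by apply/funext => -[].
rewrite cE; apply: (@sigT_continuous _ (@cell R G) _
  (fun k (t : @cell R G k) => cell_fun (existT (@cell R G) k t))) => -[v|e] t /=.
  exact: cvg_cst.
apply: (@continuous_comp _ R _ (@coord R)); first exact: coord_continuous.
exact: fc.
Qed.

Lemma geom_fun_continuous : continuous geom_fun.
Proof.
apply: repr_comp_continuous; first exact: cell_fun_continuous.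
move=> c c' /eqP/eqmodP/eqP cc'; apply/eqP.
by rewrite -(cell_fun_attach c) cc' cell_fun_attach.
Qed.

End GeomFun.

(** The distance to [v] along the edges, truncated at 1, glues to a continuous function on the
    realization, and a sublevel set of it is the neighbourhood sought. *)
Lemma near_vpoint v (eps : R) : 0 < eps -> \forall x \near vpoint R v,
  x = vpoint R v \/ exists d r, [/\ dsrc d = v, 0 < r < 1, r < eps & x = dpoint d r].
Proof.
move=> eps0.
pose fv u : R := if u == v then 0 else 1.
pose fe e r : R := Num.min (if edge_src G e == v then `|r| else 1)
                           (if edge_tgt G e == v then `|1 - r| else 1).
have fe0 e : fe e 0 = fv (edge_src G e).
  rewrite /fe /fv normr0 subr0 normr1.
  by case: ifP => _; case: ifP => _; rewrite /Num.min ?ltxx ?ltr01.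
have fe1 e : fe e 1 = fv (edge_tgt G e).
  rewrite /fe /fv subrr normr0 normr1.
  by case: ifP => _; case: ifP => _; rewrite /Num.min ?ltxx ?ltr10.
have fc e : continuous (fe e).
  rewrite /fe => r; apply: continuous_min.
    case: (edge_src G e == v); last exact: cvg_cst.
    by apply: cvg_norm; exact: cvg_id.
  case: (edge_tgt G e == v); last exact: cvg_cst.
  by apply: cvg_norm; apply: cvgB; [exact: cvg_cst|exact: cvg_id].
have := @geom_fun_continuous _ fv fe fe0 fe1 fc (vpoint R v).
rewrite /continuous_at (geom_fun_vpoint fe0 fe1) {2}/fv eqxx.
have m0 : 0 < Num.min eps 1 by rewrite lt_min eps0 ltr01.
move=> /cvgr_lt/(_ _ m0); apply: filterS => x.
case: (geomP x) => {x} [u|e r r01].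
  by rewrite (geom_fun_vpoint fe0 fe1) /fv; case: eqP => [->|_]; [left|rewrite lt_min ltxx andbF].
rewrite (geom_fun_ept fe0 fe1); last by lra.
move=> h; right; move: h; rewrite /fe /= lt_min. rewrite !gt_min => /andP[].
case: ifP => [/eqP sv|_]; last first.
  case: ifP => [/eqP tv|_]; last by rewrite ltxx orbF => h; lra.
  rewrite gtr0_norm; last by lra.
  move=> h1 h2; exists (e, true), (1 - r); split; [exact: tv|lra|lra|].
  by rewrite -(dpoint_rev (e, true)).
case: ifP => [/eqP tv|_]; last first.
  rewrite gtr0_norm; last by lra.
  by move=> h1 h2; exists (e, false), r; split=> //; lra.
rewrite !gtr0_norm; [|lra|lra].
(* The edge is a loop at [v]: whichever end lies within [eps] gives the orientation. *)
move=> h1 h2; have [re|re] := ltP r eps.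
  by exists (e, false), r; split=> //; lra.
exists (e, true), (1 - r); split; [exact: tv|lra|lra|].
by rewrite -(dpoint_rev (e, true)).
Qed.

(** The distance to the point along its edge is capped at [m], its distance to the nearer end, so
    that it extends by the constant [m] to the rest of the graph. *)
Lemma near_ept e t (eps : R) : 0 < eps -> 0 < t < 1 -> \forall x \near ept e t,
  exists r, [/\ 0 < r < 1, `|r - t| < eps & x = ept e r].
Proof.
move=> eps0 t01.
pose m : R := Num.min t (1 - t).
pose fv (u : vertex G) : R := m.
pose fe e' r : R := if e' == e then Num.min `|r - t| m else m.
have fe0 e' : fe e' 0 = fv (edge_src G e').
  rewrite /fe /fv; case: ifP => // _; rewrite sub0r normrN gtr0_norm; last by lra.
  by rewrite min_r // ge_min lexx.
have fe1 e' : fe e' 1 = fv (edge_tgt G e').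
  rewrite /fe /fv; case: ifP => // _; rewrite gtr0_norm; last by lra.
  by rewrite min_r // ge_min lexx orbT.
have fc e' : continuous (fe e').
  rewrite /fe; case: (e' == e); last by move=> r; exact: cvg_cst.
  move=> r.
  apply: (continuous_min (f := fun r0 => `|r0 - t|) (g := fun=> m)); last exact: cvg_cst.
  by apply: cvg_norm; apply: cvgB; [exact: cvg_id|exact: cvg_cst].
have m0 : 0 < m by rewrite lt_min; lra.
have := @geom_fun_continuous _ fv fe fe0 fe1 fc (ept e t).
rewrite /continuous_at (geom_fun_ept fe0 fe1); last by lra.
rewrite {2}/fe eqxx subrr normr0 (min_l (ltW m0)).
have m1 : 0 < Num.min eps m by rewrite lt_min eps0 m0.
move=> /cvgr_lt/(_ _ m1); apply: filterS => x.
case: (geomP x) => {x} [u|e' r r01].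
  by rewrite (geom_fun_vpoint fe0 fe1) /fv lt_min ltxx andbF.
rewrite (geom_fun_ept fe0 fe1); last by lra.
rewrite /fe; case: ifP => [/eqP->|_]; last by rewrite lt_min ltxx andbF.
rewrite lt_min (gt_min m) ltxx orbF (gt_min eps) => /andP[h1 h2].
exists r; split=> //; case/orP: h1 => // h1.
exact: lt_trans h2 h1.
Qed.

End Geom.

Lemma locally_constant (T : topologicalType) (K : Type) (c : T -> K) :
  connected [set: T] -> (forall t0, \forall t \near t0, c t = c t0) ->
  forall s t, c s = c t.
Proof.
move=> cT cc s t; have /seteqP[_ /(_ s I)//] : [set u | c u = c t] = setT.
apply: cT; first by exists t.
- exists [set u | c u = c t]; last by rewrite setTI.
  by rewrite openE => u /= ut; have := cc u; apply: filterS => w /= ->.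
- exists [set u | c u = c t]; last by rewrite setTI.
  rewrite -openC openE => u /= ut; have := cc u; apply: filterS => w wu /= wt.
  by apply: ut; rewrite -wu.
Qed.

Lemma connected_line (R : realType) : connected [set: R].
Proof. by apply/connected_intervalP. Qed.

(** * The cocycle and lifts of maps along it *)

Section Tau.
Variables (R : realType) (G : graph).
Local Notation X := (geom R G).
Local Notation F := (free_group (edge G)).
Implicit Types (v : vertex G) (e : edge G) (d : letter (edge G)) (x y : X) (r : R).

Definition ref x : vertex G :=
  match nf x with inl v => v | inr (e, _) => edge_src G e end.

(** This is the path from [ref x] to the end of the edge that is nearer to [x], the midpoint being
    attributed to the source. *)
Definition half x : F :=
  match nf x with inl _ => 1%g | inr (e, r) => if 2^-1 < r then gen e else 1%g end.

(** The transition element between nearby points: a lift of a path of [X] to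
    the covering with fibre [F] is multiplied by it. *)
Definition tau x y : F :=
  match nf x, nf y with
  | inr (e, r), inr (e', r') =>
      if (e == e') && (`|r - r'| < 2^-1) then 1%g else (half x / half y)%g
  | _, _ => (half x / half y)%g
  end.

Lemma ref_vpoint v : ref (vpoint R v) = v.
Proof. by rewrite /ref nf_vpoint. Qed.

Lemma ref_ept e r : 0 < r < 1 -> ref (ept e r) = edge_src G e.
Proof. by move=> ?; rewrite /ref nf_ept. Qed.

Lemma tau_refl x : tau x x = 1%g.
Proof.
by rewrite /tau; case: (nf x) => [v|[e r]]; rewrite ?mulgV //; case: ifP.
Qed.

(** The radius [4^-1] makes the branches of [tau] agree. Around a vertex, two points on one edge
    less than [2^-1] apart lie at the same end and have the same [half]; around an interior point
    all distances are below [2^-1] and [tau] is trivial. *)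
Lemma tau_local x0 : exists (h : X -> F) (U : set X),
  nbhs x0 U /\ forall x y, U x -> U y -> tau x y = (h x / h y)%g.
Proof.
case: (geomP x0) => [v|e r r01].
  have e0 : (0 : R) < 4^-1 by lra.
  exists half; eexists; split; first exact: (near_vpoint v e0).
  have B x : x = vpoint R v \/ (exists d r,
      [/\ dsrc d = v, 0 < r < 1, r < 4^-1 & x = dpoint d r]) ->
      match nf x with inl _ => True | inr (e, r) => (r < 4^-1) || (1 - 4^-1 < r) end.
    case=> [->|[[e b] [r [_ r01 r4 ->]]]]; first by rewrite nf_vpoint.
    case: b.
      rewrite -[(e, true)]/(linv (e, false)) dpoint_rev nf_ept; last by lra.
      by apply/orP; right; lra.
    by rewrite nf_ept // r4.
  move=> x y /B + /B; rewrite /tau /half.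
  case: (nf x) => [//|[e r]]; case: (nf y) => [//|[e' r']].
  case: (boolP (_ && _)) => // /andP[/eqP<-]; rewrite real_ltr_norml ?num_real //.
  move=> rr /orP h /orP h'.
  case: ifP => /idP h1; case: ifP => /idP h2; rewrite ?mulgV ?mulg1 //.
    by exfalso; apply: h2; case: h => ?; case: h' => ?; lra.
  by exfalso; apply: h1; case: h => ?; case: h' => ?; lra.
have e0 : (0 : R) < 4^-1 by lra.
exists (fun=> 1%g); eexists; split; first exact: (near_ept e e0 r01).
move=> x y /= [s [s01 sr ->]] [s' [s'01 s'r ->]]; rewrite /tau !nf_ept // eqxx /=.
move: sr s'r; rewrite !real_ltr_norml ?num_real // => sr s'r.
by rewrite ifT ?invg1 ?mulg1 //; lra.
Qed.

Lemma tau_valid x0 : \forall x \near x0, gp (ref x0) (ref x) (tau x0 x).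
Proof.
case: (geomP x0) => [v|e r r01].
  have e0 : (0 : R) < 4^-1 by lra.
  have := near_vpoint v e0; apply: filterS => x; rewrite ref_vpoint.
  case=> [->|[[e b] [r [dv r01 r4 ->]]]].
    by rewrite ref_vpoint tau_refl; exact: gpd_one.
  case: b dv => /= dv.
    rewrite -[(e, true)]/(linv (e, false)) dpoint_rev ref_ept; last by lra.
    rewrite /tau /half !nf_vpoint nf_ept; last by lra.
    rewrite ifT; last by lra.
    by rewrite mul1g -dv; apply/gpd_inv/gpd_gen.
  rewrite ref_ept // /tau /half !nf_vpoint nf_ept //.
  rewrite ifF; last by apply/negbTE; rewrite -leNgt; lra.
  by rewrite invg1 mulg1 -dv; exact: gpd_one.
have e0 : (0 : R) < 4^-1 by lra.
have := near_ept e e0 r01; apply: filterS => x [s [s01 sr ->]].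
move: sr; rewrite !real_ltr_norml ?num_real // => sr.
rewrite /tau !ref_ept // !nf_ept // eqxx ifT; first exact: gpd_one.
by rewrite real_ltr_norml ?num_real //=; lra.
Qed.

Lemma tau_cocycle x0 : exists U : set X, nbhs x0 U /\
  forall x y z, U x -> U y -> U z -> (tau x y * tau y z)%g = tau x z.
Proof.
have [h [U [xU hU]]] := tau_local x0; exists U; split=> // x y z Ux Uy Uz.
by rewrite !hU //; gsimp.
Qed.

Lemma tau_sym x0 : \forall x \near x0, tau x x0 = ((tau x0 x)^-1)%g.
Proof.
have [h [U [xU hU]]] := tau_local x0; apply: filterS (xU) => x Ux.
have Ux0 := nbhs_singleton xU.
by rewrite !hU //; gsimp.
Qed.

Section Lift.
Variable T : topologicalType.

Definition islift (p : T -> X) (g : T -> F) : Prop :=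
  forall t0, \forall t \near t0, g t = (g t0 * tau (p t0) (p t))%g.

Lemma islift_mull p g c : islift p g -> islift p (fun t => c * g t)%g.
Proof. by move=> gp t0; apply: filterS (gp t0) => t ->; rewrite mulgA. Qed.

Lemma islift_uniq p g g' : connected [set: T] -> islift p g -> islift p g' ->
  forall s t, ((g s)^-1 * g t = (g' s)^-1 * g' t)%g.
Proof.
move=> cT gl g'l s t.
have E : (g s / g' s = g t / g' t)%g.
  apply: (locally_constant (c := fun t => g t / g' t)%g cT) => t0.
  by have := g'l t0; apply: filterS2 (gl t0) => u -> ->; gsimp.
apply: (mulgI (g s)); apply: (mulIg (g' t)^-1)%g; gsimp.
by rewrite -E; gsimp.
Qed.

Lemma islift_cst p g : connected [set: T] -> islift p g ->
  (forall s t, p s = p t) -> forall s t, g s = g t.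
Proof.
move=> cT gl pc; apply: locally_constant => // t0.
by apply: filterS (gl t0) => t ->; rewrite (pc t t0) tau_refl mulg1.
Qed.

Lemma islift_valid p g v : connected [set: T] -> continuous p -> islift p g ->
  forall s t, gp v (ref (p s)) (g s) -> gp v (ref (p t)) (g t).
Proof.
move=> cT pc gl s t.
suff E s' t' : gp v (ref (p s')) (g s') = gp v (ref (p t')) (g t') by rewrite (E s t).
apply: (locally_constant (c := fun t => gp v (ref (p t)) (g t)) cT) => t0.
have V : \forall u \near t0, gp (ref (p t0)) (ref (p u)) (tau (p t0) (p u)).
  exact: pc t0 _ (tau_valid (p t0)).
apply: filterS2 V (gl t0) => u vu ->.
apply/propext; split=> h; last exact: gpd_mul h vu.
have := gpd_mul h (gpd_inv vu); by gsimp.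
Qed.

End Lift.
End Tau.

Lemma continuous_pair (T U V : topologicalType) (f : T -> U) (g : T -> V) :
  continuous f -> continuous g -> continuous (fun t => (f t, g t)).
Proof. by move=> fc gc t; exact: cvg_pair (fc t) (gc t). Qed.

Lemma continuous_compT (T U V : topologicalType) (f : T -> U) (g : U -> V) :
  continuous f -> continuous g -> continuous (fun t => g (f t)).
Proof. by move=> fc gc t; exact: (continuous_comp (fc t) (gc (f t))). Qed.

Lemma continuous_id (T : topologicalType) : continuous (fun t : T => t).
Proof. by move=> t; exact: cvg_id. Qed.

Lemma continuous_const (T U : topologicalType) (u : U) : continuous (fun _ : T => u).
Proof. by move=> t; exact: cvg_cst. Qed.

Section UnitInterval.
Variable R : realType.
Local Notation I := (unit_interval R).

Lemma clamp_surj : [set: I] = @clamp R @` [set: R].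
Proof. by apply/seteqP; split=> // t _; exists (coord t); rewrite ?coordK. Qed.

Lemma clamp_surj01 : [set: I] = @clamp R @` `[0, 1]%classic.
Proof.
apply/seteqP; split=> // t _; exists (coord t); rewrite ?coordK //=.
by rewrite in_itv /= coord_ge0 coord_le1.
Qed.

Lemma connected_unit : connected [set: I].
Proof.
rewrite clamp_surj; apply: connected_continuous_connected.
  exact: connected_line.
exact/continuous_subspaceT/clamp_continuous.
Qed.

Lemma compact_unit : compact [set: I].
Proof.
rewrite clamp_surj01; apply: continuous_compact; last exact: segment_compact.
exact/continuous_subspaceT/clamp_continuous.
Qed.

End UnitInterval.

(** * Existence of lifts over the interval and the square *)

Section LiftExistence.
Variables (R : realType) (G : graph).
Local Notation X := (geom R G).
Local Notation F := (free_group (edge G)).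
Local Notation I := (unit_interval R).

Section Line.
Variable p : R -> X.
Hypothesis pc : continuous p.
Hypothesis p0 : forall t, t <= 0 -> p t = p 0.
Hypothesis p1 : forall t, 1 <= t -> p t = p 1.

(** The lifting condition is imposed at points below [s] only, while [g] remains a total
    function. *)
Let lift_below (s : R) (g : R -> F) : Prop :=
  (forall t, t <= 0 -> g t = 1%g) /\
  forall t, t < s -> \forall t' \near t, g t' = (g t * tau (p t) (p t'))%g.

Let lift_belowW (s s' : R) g : s' <= s -> lift_below s g -> lift_below s' g.
Proof.
by move=> ss' [g0 gl]; split=> // t ts'; apply: gl; exact: lt_le_trans ss'.
Qed.

(** [delta] depends on [s0] alone and not on the partial lift, as the supremum argument in
    [lift_all] requires. *)
Let lift_extend (s0 : R) : exists2 delta, 0 < delta &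
  forall g, lift_below (s0 - delta) g -> exists g', lift_below (s0 + delta) g'.
Proof.
have [U [xU cU]] := tau_cocycle (p s0).
have /nbhs_ballP[eps /= eps0 epsU] : nbhs s0 (p @^-1` U) by exact: pc xU.
exists (eps / 2); first by lra.
(* [s1] lies below [s0 - eps / 2], where [g] is a lift, and above [s0 - eps], where the cocycle
   identity holds; from [s1] on the new lift is prescribed by [tau]. *)
move=> g [g0 gl]; have [s1 s1E] : exists s1, s1 = s0 - 3 * eps / 4 by eexists.
pose g' t := if t <= s1 then g t else (g s1 * tau (p s1) (p t))%g.
have pU t : s0 - eps < t -> t < s0 + eps -> U (p t).
  move=> h h'; apply: epsU; rewrite /ball /= real_ltr_norml ?num_real //.
  by apply/andP; split; lra.
exists g'; split=> [t t0|t ts].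
  rewrite /g'; case: ifP => [_|/negbT ts1]; first exact: g0.
  have s10 : s1 <= 0 by rewrite -ltNge in ts1; lra.
  by rewrite g0 // (p0 t0) (p0 s10) tau_refl mulg1.
rewrite /g'; case: (ltgtP t s1) => ts1.
- have t1 : t < s0 - eps / 2 by lra.
  have := gl t t1; apply: filterS2 (lt_nbhsl ts1) => t' /= t's1.
  by rewrite (ltW t's1).
- near=> t'.
  have t's1 : s1 < t' by near: t'; exact: lt_nbhsr.
  have t's0 : t' < s0 + eps by near: t'; apply: lt_nbhsl; lra.
  rewrite ifF; last by rewrite leNgt t's1.
  by rewrite -mulgA cU //; apply: pU; lra.
- have t1 : t < s0 - eps / 2 by lra.
  have := gl t t1; rewrite -ts1; apply: filterS => t' h.
  by case: ifP.
Unshelve. all: by end_near. Qed.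

Let lift_all (s : R) : exists g, lift_below s g.
Proof.
apply: contrapT => nLs.
pose S := [set s' | exists g, lift_below s' g].
have S0 : S 0.
  exists (fun=> 1%g); split=> // t t0.
  have := lt_nbhsl t0; apply: filterS => t' /= t'0.
  by rewrite (p0 (ltW t0)) (p0 (ltW t'0)) tau_refl mulg1.
have down s1 s2 : s1 <= s2 -> S s2 -> S s1.
  by move=> s12 [g gl]; exists g; exact: lift_belowW gl.
have Sub : ubound S s.
  by move=> s' Ss'; rewrite leNgt; apply/negP => /ltW/down/(_ Ss')/nLs.
have hS : has_sup S by split; [exists 0|exists s].
have [d d0 dP] := lift_extend (sup S).
have [s' Ss' ss'] := sup_adherent d0 hS.
have [g /dP[g' g'P]] := down _ _ (ltW ss') Ss'.
have : sup S + d <= sup S by apply: ub_le_sup; [exists s|exists g'].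
by lra.
Qed.

Lemma lift_line : exists2 g : R -> F, islift p g & g 0 = 1%g.
Proof.
(* A bound beyond 1 is taken so that the lifting condition holds at 1 itself; past 1 the path is
   constant and the lift is frozen. *)
have [g [g0 gl]] := lift_all 2.
exists (fun t => if t <= 1 then g t else g 1); last by rewrite ler01 g0.
move=> t; case: (ltgtP t 1) => t1.
- have t2 : t < 2 by lra.
  have := gl t t2; apply: filterS2 (lt_nbhsl t1) => t' /= t'1.
  by rewrite (ltW t'1).
- have := lt_nbhsr t1; apply: filterS => t' /= t'1.
  by rewrite leNgt t'1 /= (p1 (ltW t1)) (p1 (ltW t'1)) tau_refl mulg1.
- have t2 : (1 : R) < 2 by lra.
  have := gl 1 t2; rewrite t1; apply: filterS => t' h.
  case: (leP t' 1) => // /ltW t'1.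
  by rewrite (p1 t'1) tau_refl mulg1.
Qed.

End Line.

Lemma lift_exists (p : I -> X) : continuous p ->
  exists2 g : I -> F, islift p g & g zero = 1%g.
Proof.
move=> pc.
have qc : continuous (p \o @clamp R).
  by move=> t; apply: continuous_comp; [exact: clamp_continuous|exact: pc].
have q0 t : t <= 0 -> (p \o @clamp R) t = (p \o @clamp R) 0.
  by move=> t0 /=; rewrite !clamp_le0.
have q1 t : 1 <= t -> (p \o @clamp R) t = (p \o @clamp R) 1.
  by move=> t0 /=; rewrite !clamp_ge1.
have [g gl g0] := lift_line qc q0 q1.
exists (g \o @coord R); last by rewrite /= coord0.
move=> t0; have h : \forall t \near t0, g (coord t) =
    (g (coord t0) * tau (p (clamp (coord t0))) (p (clamp (coord t))))%g.
  exact: (@coord_continuous R t0 _ (gl (coord t0))).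
by move: h; apply: filterS => t /=; rewrite !coordK.
Qed.

(** The rows are lifted starting from a lift of the column over [zero]. The other columns are then
    lifts by uniqueness: transporting the row at [t0] by [tau] gives a lift of the row at a nearby
    [t], for all [s] at once by compactness of the interval. *)
Lemma lift_square (H : I * I -> X) : continuous H -> exists g : I -> I -> F,
  (forall t, islift (fun s => H (s, t)) (g^~ t)) /\
  (forall s, islift (fun t => H (s, t)) (g s)).
Proof.
move=> Hc.
have row t : exists g : I -> F, islift (fun s => H (s, t)) g /\ g zero = 1%g.
  have : continuous (fun s => H (s, t)).
    apply: (continuous_compT (f := fun s => (s, t))) Hc.
    exact: continuous_pair (@continuous_id _) (@continuous_const _ _ _).
  by move/lift_exists => [g gl g0]; exists g.
have [r rP] := choice row.
have : continuous (fun t => H (zero, t)).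
  apply: (continuous_compT (f := fun t => (zero, t))) Hc.
  exact: continuous_pair (@continuous_const _ _ _) (@continuous_id _).
move/lift_exists => [c cl c0].
pose g s t : F := (c t * r t s)%g.
have gr t : islift (fun s => H (s, t)) (g^~ t).
  by apply: islift_mull; have [] := rP t.
exists g; split=> // s0 t0.
have g0 t : g zero t = c t by rewrite /g (proj2 (rP t)) mulg1.
pose P t s := \forall s' \near s,
  (tau (H (s, t0)) (H (s', t0)) * tau (H (s', t0)) (H (s', t)) =
   tau (H (s, t0)) (H (s, t)) * tau (H (s, t)) (H (s', t)))%g.
have nP : \forall t \near t0, [set: I] `<=` P t.
  apply: (proj1 (compact_near_coveringP _) (@compact_unit R) I (nbhs t0) P) => s1 _.
  have [U [xU cU]] := tau_cocycle (H (s1, t0)).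
  have [[B C] /= [Bs1 Ct0] BCU] : nbhs (s1, t0) (H @^-1` U) by exact: Hc xU.
  have CT0 := nbhs_singleton Ct0.
  exists (B^°, C); first by split=> //; exact: nbhs_interior.
  move=> [s t] [/= Bs Ct]; rewrite /P.
  have Us := interior_subset Bs.
  have nB : nbhs s B := Bs.
  apply: filterS nB => s' Bs'.
  have UH a b : B a -> C b -> U (H (a, b)) by move=> Ba Cb; exact: (BCU (a, b)).
  by rewrite !cU //; exact: UH.
have ct0 : \forall t \near t0, c t = (c t0 * tau (H (zero, t0)) (H (zero, t)))%g.
  exact: cl t0.
have nP' : \forall t \near t0, forall s, P t s.
  by apply: filterS nP => t Pt s; exact: Pt.
near=> t.
have ct : c t = (c t0 * tau (H (zero, t0)) (H (zero, t)))%g by near: t; exact: ct0.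
have Pt : forall s, P t s by near: t; exact: nP'.
pose g' s := (g s t0 * tau (H (s, t0)) (H (s, t)))%g.
have g'l : islift (fun s => H (s, t)) g'.
  move=> s; have := gr t0 s; apply: filterS2 (Pt s) => s' E.
  by rewrite /g' => ->; rewrite -mulgA E mulgA.
have := islift_uniq (@connected_unit R) (gr t) g'l zero s0.
by rewrite !g0 /g' g0 ct => /mulgI.
Unshelve. all: by end_near. Qed.

Definition omega (p : I -> X) (w : F) : Prop :=
  exists2 g : I -> F, islift p g & ((g zero)^-1 * g one)%g = w.

Lemma omega_exists p : continuous p -> exists w, omega p w.
Proof. by move/lift_exists => [g gl _]; exists ((g zero)^-1 * g one)%g, g. Qed.

Lemma omega_uniq p w w' : omega p w -> omega p w' -> w = w'.
Proof.
by move=> [g gl <-] [g' g'l <-]; exact: (islift_uniq (@connected_unit R) gl g'l).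
Qed.

Lemma omega_valid p w : continuous p -> omega p w ->
  gp (ref (p zero)) (ref (p one)) w.
Proof.
move=> pc [g gl <-].
have := islift_valid (@connected_unit R) pc (islift_mull (g zero)^-1%g gl)
  (v := ref (p zero)) (s := zero) one.
by rewrite mulVg; apply; exact: gpd_one.
Qed.

Lemma omega_homotopic (x y : X) (p q : {path I from x to y}) w :
  path_homotopic p q -> omega p w -> omega q w.
Proof.
move=> [H [Hc H0 H1 Hs]] pw; have [g [gr gc]] := lift_square Hc.
have pE : (fun s => H (s, zero)) = p by apply/funext.
have qE : (fun s => H (s, one)) = q by apply/funext.
have := gr zero; rewrite pE => gp; have := gr one; rewrite qE => gq.
rewrite -(omega_uniq (ex_intro2 _ _ _ gp erefl) pw).
exists (g^~ one) => //.
have cst s : s = zero \/ s = one -> g s zero = g s one.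
  move=> s01; apply: (islift_cst (@connected_unit R) (gc s)) => t t'.
  by have [a b] := Hs t; have [a' b'] := Hs t'; case: s01 => ->; rewrite ?a ?b ?a' ?b'.
by rewrite !cst; [|right|left].
Qed.

End LiftExistence.

Lemma continuous_glue (R : realType) (Y : topologicalType) (f g : R -> Y) :
  continuous f -> continuous g -> f 0 = g 0 ->
  continuous (fun x : R => if x <= 0 then f x else g x).
Proof.
move=> fc gc fg x W; case: (ltgtP (x : R) (0 : R)) => x0 Wx.
- have fW : \forall y \near x, W (f y) by exact: fc Wx.
  by apply: filterS2 (lt_nbhsl x0) fW => y /= y0; rewrite (ltW y0).
- have gW : \forall y \near x, W (g y) by exact: gc Wx.
  by apply: filterS2 (lt_nbhsr x0) gW => y /= y0; rewrite leNgt y0.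
- move: Wx; rewrite x0 => Wx.
  have fW : \forall y \near (0 : R), W (f y) by exact: fc Wx.
  have gW : \forall y \near (0 : R), W (g y) by apply: gc; rewrite -fg.
  by apply: filterS2 fW gW => y /= ? ?; case: ifP.
Qed.

Ltac xlra := intros; exfalso; lra.

Lemma continuous_fst (T U : topologicalType) : continuous (@fst T U).
Proof. by move=> q; exact: cvg_fst. Qed.

Lemma continuous_snd (T U : topologicalType) : continuous (@snd T U).
Proof. by move=> q; exact: cvg_snd. Qed.

(** * Geodesics of the universal cover in coordinates *)

Section Geodesic.
Variables (R : realType) (G : graph).
Local Notation X := (geom R G).
Local Notation F := (free_group (edge G)).
Local Notation L := (letter (edge G)).
Implicit Types (v : vertex G) (e : edge G) (d : L) (o : option L) (k : seq L).
Implicit Types (x y : X) (r s : R).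

Lemma dpoint_le0 d r : r <= 0 -> dpoint d r = vpoint R (dsrc d).
Proof.
move=> r0; rewrite -dpoint0 /dpoint; case: d.2; last by rewrite !clamp_le0.
by rewrite !clamp_ge1 //; lra.
Qed.

Lemma dpoint_ge1 d r : 1 <= r -> dpoint d r = vpoint R (dtgt d).
Proof.
move=> r1; rewrite -dpoint1 /dpoint; case: d.2; last by rewrite !clamp_ge1.
by rewrite !clamp_le0 //; lra.
Qed.

Lemma path_point_catl v w w' r : w != [::] -> r <= (size w)%:R ->
  path_point v (w ++ w') r = path_point v w r.
Proof.
elim: w v r => // d w IH v r _ /= rw; case: ifP => // /negbT; rewrite -ltNge => r1.
have w0 : w != [::] by case: w rw {IH} => //=; lra.
by apply: IH => //; move: rw; rewrite -natr1; lra.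
Qed.

Lemma path_point_rcons v v' w d r : edge_path v (rcons w d) v' ->
  (size w)%:R <= r -> path_point v (rcons w d) r = dpoint d (r - (size w)%:R).
Proof.
elim: w v r => [|d' w IH] v r /=; rewrite -?natr1.
  rewrite subr0 => _ _; case: ifP => // /negbT; rewrite -ltNge => r1.
  by rewrite dpoint_ge1 // ltW.
move=> /andP[_ p] wr; case: ifP => r1; last by rewrite IH //; [congr dpoint|]; lra.
have w0 : w = [::].
  by apply/eqP; rewrite -size_eq0 -(lern0 R); lra.
subst w; move: p wr => /= /andP[/eqP sd _] wr.
by rewrite dpoint_ge1 ?dpoint_le0 ?sd //; lra.
Qed.

Definition odp v o r : X := if o is Some d then dpoint d r else vpoint R v.
Definition dl o : seq L := if o is Some d then [:: d] else [::].
Definition starts o k : bool :=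
  match o, k with Some d, d' :: _ => d' == d | _, _ => false end.
(** With the default [d] the empty path never ends in [linv d], so nothing is cancelled on it. *)
Definition ends k o : bool := if o is Some d then last d k == linv d else false.

(** The points [(o, a)] and [(o', b)], at distance [a] and [b] from the ends of
    the reduced edge path [k], are joined in the universal cover by a geodesic
    that is part of the line [geoQ]: whether it starts in the negative
    direction depends on the first letter of [k]. *)
Definition geoQ v o k o' r : X :=
  if r <= 0 then odp v o (- r) else path_point v (k ++ dl o') r.
Definition geo_start o (a : R) k o' : R := if starts o (k ++ dl o') then a else - a.
Definition geo_end k o' (b : R) : R := (size k)%:R + (if ends k o' then - b else b).
Definition geo v o a k o' b s : X :=
  let x0 := geo_start o a k o' in
  geoQ v o k o' (x0 + (geo_end k o' b - x0) * s).

Definition wf v o (a : R) : Prop :=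
  [/\ if o is Some d then dsrc d = v else True, 0 <= a <= 1 & o = None -> a = 0].

Lemma linv_neq d : (d == linv d) = false.
Proof. by case: d => e []; rewrite /linv /=; apply/eqP => -[]. Qed.

Lemma ends_nil o : ends [::] o = false.
Proof. by case: o => //= d; rewrite linv_neq. Qed.

Lemma geo_end_ge0 k o (b : R) : 0 <= b <= 1 -> 0 <= geo_end k o b.
Proof.
move=> b01; rewrite /geo_end; case: k => [|d k]; first by rewrite ends_nil add0r; lra.
have : (0 : R) <= (size k)%:R by [].
by rewrite /= -natr1; case: ifP; lra.
Qed.

Lemma dpoint_linv d r : dpoint (linv d) r = dpoint d (1 - r).
Proof. exact: dpoint_rev. Qed.

Lemma convex_ge (a b c s : R) : 0 <= s <= 1 -> c <= a -> c <= b ->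
  c <= a + (b - a) * s.
Proof.
move=> s01 ca cb.
have h1 : 0 <= (a - c) * (1 - s) by apply: mulr_ge0; lra.
have h2 : 0 <= (b - c) * s by apply: mulr_ge0; lra.
have -> : a + (b - a) * s = c + (a - c) * (1 - s) + (b - c) * s by ring.
by lra.
Qed.

Lemma convex_le (a b c s : R) : 0 <= s <= 1 -> a <= c -> b <= c ->
  a + (b - a) * s <= c.
Proof.
move=> s01 ca cb; rewrite -lerN2.
have -> : - (a + (b - a) * s) = - a + (- b - - a) * s by ring.
by apply: convex_ge => //; rewrite lerN2.
Qed.

Lemma geo_const v o a s : wf v o a -> geo v o a [::] o a s = odp v o a.
Proof.
move=> [wv a01 oa]; rewrite /geo /geo_start /geo_end ends_nil /= add0r.
case: o wv oa => [d|] /= dv oa; last first.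
  by rewrite oa // oppr0 subrr mul0r addr0 /geoQ lexx.
rewrite eqxx subrr mul0r addr0 /geoQ /=.
case: (leP a 0) => a0; last by rewrite ifT //; lra.
by rewrite !dpoint_le0 //; lra.
Qed.

Lemma geo_0 v v' o a k o' b : wf v o a -> wf v' o' b -> edge_path v k v' ->
  geo v o a k o' b 0 = odp v o a.
Proof.
move=> [wv a01 oa] wo' kp; rewrite /geo mulr0 addr0 /geo_start /geoQ.
case: (boolP (starts _ _)) => [|_]; last by rewrite oppr_le0 ifT ?opprK //; lra.
case: o wv oa => //= d dv _; case: (k ++ _) => //= d' w /eqP ->.
case: (leP a 0) => a0; last by rewrite ifT //; lra.
by rewrite !dpoint_le0 //; lra.
Qed.

Lemma geo_1 v v' o a k o' b : wf v o a -> wf v' o' b -> edge_path v k v' ->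
  geo v o a k o' b 1 = odp v' o' b.
Proof.
move=> [wv a01 oa] [wv' b01 ob] kp.
rewrite /geo mulr1 [X in geoQ _ _ _ _ X](_ : _ = geo_end k o' b); last by ring.
have := @geo_end_ge0 k o' b b01; rewrite le_eqVlt => /predU1P[E|E].
  rewrite -E /geoQ lexx oppr0. move: E; rewrite /geo_end.
  have -> : odp v o 0 = vpoint R v by case: o wv {oa} => //= d <-; rewrite dpoint0.
  case: (lastP k) kp => [|k1 d] kp.
    move: kp => /= /eqP vv'; rewrite ends_nil add0r vv' => <-.
    by case: o' wv' {ob} => //= d <-; rewrite dpoint0.
  rewrite size_rcons -natr1; have k10 : (0 : R) <= (size k1)%:R by [].
  case: o' wv' ob => [d'|] /= dv ob; last by rewrite ob //; xlra.
  rewrite last_rcons; case: ifP => [/eqP dd'|_]; last by xlra.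
  move=> E; have k0 : k1 = [::] by apply/eqP; rewrite -size_eq0 -(lern0 R); lra.
  subst k1; move: kp => /=; rewrite dd' => /andP[/eqP <- _].
  by rewrite dpoint_ge1 //; lra.
rewrite /geoQ ifF; last by rewrite leNgt E.
move: E; rewrite /geo_end; case: o' wv' ob => [d|] /= dv ob; last first.
  by rewrite ob // addr0 cats0 (path_point_size _ kp).
case: ifP => [/eqP lk|_] E.
  move: lk kp E; case: (lastP k) => [|k1 d1]; first by move/eqP; rewrite linv_neq.
  rewrite last_rcons => -> kp E; rewrite path_point_catl; last 2 first.
  - by case: (k1).
  - by lra.
  rewrite (path_point_rcons kp) size_rcons -natr1; last by lra.
  by rewrite dpoint_linv; congr dpoint; lra.
rewrite cats1 (@path_point_rcons _ (dtgt d)); [congr dpoint; lra| |lra].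
rewrite -cats1; elim: k v kp {wv E} => /= [|d' k IH] v.
  by move=> /eqP ->; rewrite dv !eqxx.
by move=> /andP[-> /IH].
Qed.

(** Independence of the choice of the edge at an endpoint that is a vertex. *)
Lemma geo_left0 v v' o k o' b s : wf v o 0 -> wf v' o' b -> 0 <= s <= 1 ->
  geo v o 0 k o' b s = geo v None 0 k o' b s.
Proof.
move=> [wv _ _] [_ b01 _] s01; rewrite /geo /geo_start oppr0 !if_same.
have x0 : 0 <= (0 : R) + (geo_end k o' b - 0) * s.
  by apply: convex_ge => //; exact: geo_end_ge0.
rewrite /geoQ; case: ifP => // x1; rewrite (_ : - _ = 0); last by lra.
by case: o wv => //= d <-; rewrite dpoint0.
Qed.

Lemma geo_right0 v v' o a k o' s : wf v o a -> wf v' o' 0 ->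
  edge_path v k v' -> 0 <= s <= 1 ->
  geo v o a k o' 0 s = geo v o a k None 0 s.
Proof.
move=> [wv a01 oa] [wv' _ _] kp s01; rewrite /geo.
have -> : geo_end k o' 0 = (size k)%:R by rewrite /geo_end oppr0 if_same addr0.
have -> : geo_end k None 0 = (size k)%:R :> R by rewrite /geo_end addr0.
(* If [k] is empty and [o'] is the edge of [o], the geodesic is run on the positive side of the line
   instead of the negative one; both sides give the same points. *)
case: k kp => [|d k] kp.
  rewrite /geo_start /=; case: o wv oa => [d dv _|_ oa]; last first.
    by rewrite oa //= oppr0 subrr mul0r addr0 /geoQ lexx.
  have h : 0 <= a * (1 - s) by apply: mulr_ge0; lra.
  have qE o2 : geoQ v (Some d) [::] o2 (- a + (0 - - a) * s) = dpoint d (a * (1 - s)).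
    have -> : - a + (0 - - a) * s = - (a * (1 - s)) by ring.
    by rewrite /geoQ oppr_le0 h opprK.
  rewrite qE; case: ifP; last by move=> _; exact: qE.
  case: o' wv' => //= d' d'v /eqP d'd; rewrite (_ : a + _ = a * (1 - s)); last by ring.
  rewrite /geoQ /= d'd; case: ifP => h'; last by rewrite ifT //; nra.
  by rewrite !dpoint_le0 //; lra.
have -> : geo_start o a (d :: k) o' = geo_start o a (d :: k) None by [].
set x := (X in geoQ _ _ _ _ X).
rewrite /geoQ; case: ifP => // _; rewrite cats0 path_point_catl //.
apply: convex_le => //; rewrite /geo_start.
have : (0 : R) <= (size k)%:R by [].
by rewrite /= -natr1; case: ifP; lra.
Qed.

(** Moving the reference vertex across an edge. *)
Lemma geo_flipl_cons v v' d a k o' b s : wf v (Some d) a -> wf v' o' b ->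
  reduced (d :: k) -> 0 <= s <= 1 ->
  geo v (Some d) a (d :: k) o' b s =
  geo (dtgt d) (Some (linv d)) (1 - a) k o' b s.
Proof.
move=> [dv a01 _] [wv' b01 ob] rk s01.
have e0 := geo_end_ge0 (d :: k) o' b01.
rewrite /geo {1 2}/geo_start /= eqxx.
have x0 : 0 <= a + (geo_end (d :: k) o' b - a) * s by apply: convex_ge; lra.
(* As [d :: k] is reduced, this case occurs only if [k] is empty and both points lie on the edge
   [d], described from opposite ends. *)
case: (boolP (starts (Some (linv d)) (k ++ dl o'))) => st.
  have [k0 o'd] : k = [::] /\ o' = Some (linv d).
    case: k st rk {e0 x0} => [|d' k] /=; first by case: o' {wv' ob} => //= d' /eqP->.
    by move=> /eqP->; rewrite eqxx.
  subst k o'; rewrite /geo_start /= eqxx.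
  have E1 : geo_end [:: d] (Some (linv d)) b = 1 - b.
    by rewrite /geo_end /= linvK eqxx.
  have E2 : geo_end [::] (Some (linv d)) b = b by rewrite /geo_end ends_nil add0r.
  rewrite E1 in x0 *; rewrite E2.
  set y := (X in geoQ _ _ _ _ X = _); set y' := (X in _ = geoQ _ _ _ _ X).
  have yy' : y' = 1 - y by rewrite /y' /y; ring.
  have y01 : 0 <= y <= 1 by rewrite x0; apply: convex_le; lra.
  have qE u : 0 <= u <= 1 -> geoQ v (Some d) [:: d] (Some (linv d)) u = dpoint d u.
    rewrite /geoQ /= => u01; case: ifP => u0; last by rewrite ifT //; lra.
    by rewrite !dpoint_le0 //; lra.
  have qE' u : 0 <= u <= 1 ->
      geoQ (dtgt d) (Some (linv d)) [::] (Some (linv d)) u = dpoint (linv d) u.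
    rewrite /geoQ /= => u01; case: ifP => u0; last by rewrite ifT //; lra.
    by rewrite !dpoint_le0 //; lra.
  by rewrite qE // qE' yy' ?dpoint_linv ?subKr //; lra.
rewrite /geo_start (negbTE st).
have E : geo_end k o' b = geo_end (d :: k) o' b - 1.
  rewrite /geo_end /= -natr1.
  have -> : ends (d :: k) o' = ends k o'.
    case: o' {wv' ob e0 x0} st => //= d'; case: k {rk} => [|d1 k] //=.
    by rewrite linv_neq; apply: contraNF => /eqP ->; rewrite linvK.
  by ring.
rewrite E; set y := a + _ in x0 *.
have -> : - (1 - a) + (geo_end (d :: k) o' b - 1 - - (1 - a)) * s = y - 1.
  by rewrite /y; ring.
rewrite {1}/geoQ; case: ifP => y0.
  rewrite /geoQ ifT /= ?dpoint_linv; last by lra.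
  by congr dpoint; lra.
rewrite /=; case: ifP => y1; rewrite /geoQ.
  by rewrite ifT /= ?dpoint_linv; [congr dpoint|]; lra.
by rewrite ifF //; apply/negbTE; rewrite -ltNge; lra.
Qed.

(** If [k] starts with [d], this is the previous lemma. Otherwise multiplication puts [linv d] in
    front of [k], and the previous lemma applies in the opposite direction. *)
Lemma geo_flipl v v' d a (k : F) o' b s : wf v (Some d) a -> wf v' o' b ->
  0 <= s <= 1 ->
  geo v (Some d) a k o' b s =
  geo (dtgt d) (Some (linv d)) (1 - a) (lgen (linv d) * k)%g o' b s.
Proof.
move=> wd wo s01; rewrite lgen_mul.
have [dv a01 _] := wd; have := valP k; rewrite /=.
case E : (k : seq _) => [|d' k1] /=; last case: eqP => [->|/eqP nd] rk.
- move=> _; rewrite (@geo_flipl_cons _ v' (linv d)) //.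
    by rewrite linvK subKr /dtgt linvK dv.
  by split=> //; lra.
- by move: rk; rewrite linvK => rk; exact: geo_flipl_cons wd wo rk s01.
- rewrite (@geo_flipl_cons _ v' (linv d)) //.
  + by rewrite linvK subKr /dtgt linvK dv.
  + by split=> //; lra.
  + by rewrite /reduced /= nd.
Qed.

Lemma reduced_rcons2 k d d' :
  reduced (rcons (rcons k d) d') = reduced (rcons k d) && (d' != linv d).
Proof. by rewrite /reduced; case: k => [|d1 k] /=; rewrite ?andbT // !rcons_path last_rcons. Qed.

Lemma geo_flipr_rcons v v' o a d k b s : wf v o a -> wf v' (Some d) b ->
  reduced (rcons k (linv d)) -> 0 <= s <= 1 ->
  geo v o a (rcons k (linv d)) (Some d) b s =
  geo v o a k (Some (linv d)) (1 - b) s.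
Proof.
move=> [wv a01 oa] [dv b01 _] rk s01; rewrite /geo.
have E : geo_end (rcons k (linv d)) (Some d) b = (size k)%:R + (1 - b).
  by rewrite /geo_end /= last_rcons eqxx size_rcons -natr1; ring.
have E' : geo_end k (Some (linv d)) (1 - b) = (size k)%:R + (1 - b).
  rewrite /geo_end /= linvK ifF //; apply/eqP.
  case: (lastP k) rk => [_ /=|k1 d1]; first by move/eqP; rewrite eq_sym linv_neq.
  rewrite /reduced -!cats1 -catA => /cat_sorted2[_] /=.
  by rewrite cats1 last_rcons andbT => /eqP + dd; rewrite dd.
have S1 : geo_start o a (rcons k (linv d)) (Some d) =
          geo_start o a k (Some (linv d)).
  by rewrite /geo_start /= cats1; case: o {wv oa} => //= d1; case: (k).
rewrite E E' S1; set x := (X in geoQ _ _ _ _ X); rewrite /geoQ; case: ifP => // _.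
rewrite path_point_catl ?cats1 //; first by case: (k).
rewrite size_rcons -natr1; apply: convex_le => //; last by lra.
have : (0 : R) <= (size k)%:R by [].
by rewrite /geo_start; case: ifP; lra.
Qed.

Lemma geo_flipr v v' o a d (k : F) b s : wf v o a -> wf v' (Some d) b ->
  0 <= s <= 1 ->
  geo v o a k (Some d) b s =
  geo v o a (k * lgen d)%g (Some (linv d)) (1 - b) s.
Proof.
move=> wo wd s01; have [dv b01 _] := wd.
have wd' : wf (dtgt d) (Some (linv d)) (1 - b) by split=> //; lra.
have [k0|[k1 [d1 kE]]] : (k : seq L) = [::] \/ exists k1 d1, (k : seq L) = rcons k1 d1.
    by case: (lastP k) => [|k1 d1]; [left|right; exists k1, d1].
  rewrite (free_eq1 k0) mul1g.
  have -> : ((lgen d : F) : seq L) = rcons [::] (linv (linv d)) by rewrite linvK.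
  by rewrite (geo_flipr_rcons wo wd') // linvK subKr.
have rk := valP k; rewrite /= kE in rk.
have kW : k = word_elt (rcons k1 d1) by rewrite -kE word_eltK.
rewrite kE kW -[lgen d]/(word_elt [:: d]) -word_elt_cat cats1.
case: (eqVneq d1 (linv d)) => [d1E|nd].
  rewrite -!cats1 -catA d1E word_elt_cat cat1s word_elt_cons -[word_elt [:: d]]/(lgen d).
  rewrite -lgenV mulVg mulg1 word_elt_inj_reduced; last first.
    by move: rk; rewrite -cats1 => /cat_sorted2[].
  by rewrite cats1 (geo_flipr_rcons wo wd) // -d1E.
rewrite word_elt_inj_reduced.
  have -> : rcons (rcons k1 d1) d = rcons (rcons k1 d1) (linv (linv d)) by rewrite linvK.
  rewrite (geo_flipr_rcons wo wd') ?linvK ?subKr //.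
  by rewrite reduced_rcons2 rk; apply: contraNneq nd => ->; rewrite linvK.
by rewrite reduced_rcons2 rk; apply: contraNneq nd => ->; rewrite linvK.
Qed.

(** While the combinatorial data are fixed, only the position on the fixed line [geoQ] varies. Jumps
    of the data are treated by [rep_left] and [rep_right]. *)
Lemma geo_continuous v v' o k o' : (if o is Some d then dsrc d = v else True) ->
  edge_path v (k ++ dl o') v' ->
  continuous (fun q : R * R * R => geo v o q.1.1 k o' q.1.2 q.2).
Proof.
move=> wv kp.
have Qc : continuous (geoQ v o k o').
  apply: continuous_glue.
  - case: o wv => [d|] _; last exact: continuous_const.
    apply: (continuous_compT (f := fun r : R => - r)) (@dpoint_continuous _ _ d).
    by move=> r; apply: cvgN; exact: cvg_id.
  - exact: path_point_continuous kp.
  - rewrite oppr0 (path_point0 _ kp).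
    by case: o wv => //= d <-; rewrite dpoint0.
have fstc : continuous (fun q : R * R * R => q.1.1).
  exact: (continuous_compT (f := fst) (g := fst) (@continuous_fst _ _) (@continuous_fst _ _)).
have sndc : continuous (fun q : R * R * R => q.1.2).
  exact: (continuous_compT (f := fst) (g := snd) (@continuous_fst _ _) (@continuous_snd _ _)).
have sc : continuous (fun q : R * R * R => q.2) by exact: continuous_snd.
apply: (continuous_compT _ Qc).
have x0c : continuous (fun q : R * R * R => geo_start o q.1.1 k o').
  rewrite /geo_start; case: (starts _ _) => // q.
  by apply: cvgN; exact: fstc.
move=> q; apply: cvgD; first exact: x0c.
apply: cvgM; last exact: sc.
apply: cvgB; last exact: x0c.
apply: cvgD; first exact: cvg_cst.
by case: (ends _ _); [apply: cvgN|]; exact: sndc.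
Qed.

Definition repo x : option L :=
  match nf x with inl _ => None | inr (e, _) => Some (e, false) end.
Definition rept x : R := match nf x with inl _ => 0 | inr (_, r) => r end.

Lemma repP x : wf (ref x) (repo x) (rept x) /\ odp (ref x) (repo x) (rept x) = x.
Proof.
rewrite /ref /repo /rept; case: (geomP x) => [v|e r r01].
  by split=> //; split=> //; rewrite lexx ler01.
by split=> //; split=> //; lra.
Qed.

(** A nearby point is described from the reference vertex of [x0], and the change of vertex is
    absorbed by [tau]. If [x0] is a vertex, the edge [o] depends on [x]; the last clause says that
    in the limit this choice is immaterial. *)
Lemma rep_left x0 (eps : R) : 0 < eps -> \forall x \near x0, exists o a,
  [/\ wf (ref x0) o a, `|a - rept x0| < eps, wf (ref x0) o (rept x0),
   forall v' (k : F) o' b s, wf v' o' b -> 0 <= s <= 1 ->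
     geo (ref x) (repo x) (rept x) (tau x x0 * k)%g o' b s =
     geo (ref x0) o a k o' b s &
   forall v' (k : F) o' b s, wf v' o' b -> 0 <= s <= 1 ->
     geo (ref x0) o (rept x0) k o' b s =
     geo (ref x0) (repo x0) (rept x0) k o' b s].
Proof.
move=> eps0; case: (geomP x0) => [v|e t t01].
  have e0 : 0 < Num.min eps 4^-1 by rewrite lt_min eps0 /=; lra.
  have := near_vpoint v e0; apply: filterS => x.
  rewrite /rept /repo /ref nf_vpoint.
  have w0 o : (if o is Some d then dsrc d = v else True) -> wf v o (0 : R).
    by move=> wv; split=> //; lra.
  case=> [->|[[e b] [r [dv r01 + ->]]]].
    exists None, 0; rewrite nf_vpoint tau_refl subrr normr0; split=> //; try exact: w0.
    by move=> *; rewrite mul1g.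
  rewrite lt_min => /andP[re r4].
  have nr : `|r - 0| < eps by rewrite subr0 gtr0_norm //; lra.
  exists (Some (e, b)), r; split=> //; [by split=> //; lra|exact: w0| |]; last first.
    by move=> v' k o' b' s wo' s01; exact: (geo_left0 _ (w0 (Some (e, b)) dv) wo' s01).
  move=> v' k o' b' s wo' s01; case: b dv => dv.
    rewrite -[(e, true)]/(linv (e, false)) dpoint_rev /tau /half !nf_ept; last by lra.
    rewrite nf_vpoint ifT ?invg1 ?mulg1; last by lra.
    have we : wf (edge_src G e) (Some (e, false)) (1 - r) by split=> //; lra.
    rewrite (geo_flipl _ we wo' s01) mulgA lgenT mulVg mul1g subKr.
    by rewrite -dv.
  rewrite /tau /half !nf_ept // nf_vpoint ifF; last by apply/negbTE; rewrite -leNgt; lra.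
  by rewrite invg1 !mul1g -dv.
have e0 : 0 < Num.min eps 4^-1 by rewrite lt_min eps0 /=; lra.
have := near_ept e e0 t01; apply: filterS => x [r [r01 + ->]].
rewrite lt_min => /andP[rt rt4]; exists (Some (e, false)), r.
rewrite /tau /rept /repo /ref !nf_ept // eqxx ifT; last first.
  by move: rt4; rewrite !real_ltr_norml ?num_real //=; lra.
by split=> //; [split=> //; lra..|]; move=> *; rewrite mul1g.
Qed.

Lemma rep_right x0 (eps : R) : 0 < eps -> \forall x \near x0, exists o b,
  [/\ wf (ref x0) o b, `|b - rept x0| < eps, wf (ref x0) o (rept x0),
   forall v o' a (k : F) s, wf v o' a -> 0 <= s <= 1 ->
     geo v o' a (k * tau x0 x)%g (repo x) (rept x) s =
     geo v o' a k o b s &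
   forall v o' a (k : F) s, wf v o' a -> edge_path v k (ref x0) -> 0 <= s <= 1 ->
     geo v o' a k o (rept x0) s = geo v o' a k (repo x0) (rept x0) s].
Proof.
move=> eps0; case: (geomP x0) => [v|e t t01].
  have e0 : 0 < Num.min eps 4^-1 by rewrite lt_min eps0 /=; lra.
  have := near_vpoint v e0; apply: filterS => x.
  rewrite /rept /repo /ref nf_vpoint.
  have w0 o : (if o is Some d then dsrc d = v else True) -> wf v o (0 : R).
    by move=> wv; split=> //; lra.
  case=> [->|[[e b] [r [dv r01 + ->]]]].
    exists None, 0; rewrite nf_vpoint tau_refl subrr normr0; split=> //; try exact: w0.
    by move=> *; rewrite mulg1.
  rewrite lt_min => /andP[re r4].
  have nr : `|r - 0| < eps by rewrite subr0 gtr0_norm //; lra.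
  exists (Some (e, b)), r; split=> //; [by split=> //; lra|exact: w0| |]; last first.
    move=> u o' a k s wo' kp s01.
    exact: (geo_right0 wo' (w0 (Some (e, b)) dv) kp s01).
  move=> u o' a k s wo' s01; case: b dv => dv.
    rewrite -[(e, true)]/(linv (e, false)) dpoint_rev /tau /half !nf_ept; last by lra.
    rewrite nf_vpoint ifT ?mul1g; last by lra.
    have we : wf (edge_src G e) (Some (e, false)) (1 - r) by split=> //; lra.
    by rewrite (geo_flipr _ wo' we s01) -mulgA mulVg mulg1 subKr.
  rewrite /tau /half !nf_ept // nf_vpoint ifF; last by apply/negbTE; rewrite -leNgt; lra.
  by rewrite invg1 !mulg1.
have e0 : 0 < Num.min eps 4^-1 by rewrite lt_min eps0 /=; lra.
have := near_ept e e0 t01; apply: filterS => x [r [r01 + ->]].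
rewrite lt_min => /andP[rt rt4]; exists (Some (e, false)), r.
rewrite /tau /rept /repo /ref !nf_ept // eqxx ifT; last first.
  by move: rt4; rewrite !real_ltr_norml ?num_real //=; lra.
by split=> //; [split=> //; lra..|]; move=> *; rewrite mulg1.
Qed.

(** * The homotopy along geodesics *)

Section Homotopy.
Variables (Z : topologicalType) (al be : Z -> X) (k : Z -> F).
Hypothesis alc : continuous al.
Hypothesis bec : continuous be.
Hypothesis kp : forall z, gp (ref (al z)) (ref (be z)) (k z).
Hypothesis kl : forall z0, \forall z \near z0,
  k z = (tau (al z) (al z0) * k z0 * tau (be z0) (be z))%g.
Local Notation I := (unit_interval R).

Definition geo_homotopy (q : Z * I) : X :=
  geo (ref (al q.1)) (repo (al q.1)) (rept (al q.1)) (k q.1)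
      (repo (be q.1)) (rept (be q.1)) (coord q.2).

Lemma geo_homotopy0 z : geo_homotopy (z, zero) = al z.
Proof.
have [wa aE] := repP (al z); have [wb _] := repP (be z).
rewrite /geo_homotopy coord0 (geo_0 wa wb) ?aE //.
by apply/gpE; exact: kp.
Qed.

Lemma geo_homotopy1 z : geo_homotopy (z, one) = be z.
Proof.
have [wa _] := repP (al z); have [wb bE] := repP (be z).
rewrite /geo_homotopy coord1 (geo_1 wa wb) ?bE //.
by apply/gpE; exact: kp.
Qed.

Lemma geo_homotopy_const z t : al z = be z -> k z = 1%g ->
  geo_homotopy (z, t) = al z.
Proof.
move=> abz k1; have [wa aE] := repP (al z).
by rewrite /geo_homotopy /= k1 -abz geo_const ?aE.
Qed.

Lemma coord01 (t : I) : 0 <= coord t <= 1.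
Proof. by rewrite coord_ge0 coord_le1. Qed.

Lemma geo_homotopy_continuous : continuous geo_homotopy.
Proof.
move=> [z0 t0] W W0; set x0 := al z0; set y0 := be z0; set s0 := coord t0.
pose c0 : R * R * R := (rept x0, rept y0, s0).
have [wx0 _] := repP x0; have [wy0 _] := repP y0.
pose P (pp : option L * option L) (q : R * R * R) :=
    wf (ref x0) pp.1 (rept x0) -> wf (ref y0) pp.2 (rept y0) ->
    geo (ref x0) pp.1 (rept x0) (k z0) pp.2 (rept y0) s0 = geo_homotopy (z0, t0) ->
    W (geo (ref x0) pp.1 q.1.1 (k z0) pp.2 q.1.2 q.2).
(* There are finitely many choices of the two edges, so one neighbourhood of [c0] serves them all;
   the premises in [P] discard those that do not describe the limit points. *)
have nW : \forall q \near c0, forall pp, P pp q.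
  apply: (@filter_forall _ _ P (nbhs c0) _) => -[p p']; rewrite /P /=.
  have [h|h] := pselect ([/\ wf (ref x0) p (rept x0), wf (ref y0) p' (rept y0) &
    geo (ref x0) p (rept x0) (k z0) p' (rept y0) s0 = geo_homotopy (z0, t0)]);
    last by apply: filterE => q *; exfalso; apply: h.
  case: h => wo wo' E.
  have [wv _ _] := wo.
  have [v' kp'] : exists v', edge_path (ref x0) (k z0 ++ dl p') v'.
    have /gpE := kp z0; rewrite -/x0 -/y0; have [] := wo'.
    elim: (k z0 : seq L) (ref x0) => /= [|d w IH] u.
      case: p' {wo' E} => /= [d dv _ _ /eqP->|_ _ _ _]; last by exists u.
      by exists (dtgt d); rewrite dv !eqxx.
    by move=> h1 h2 h3 /andP[-> /(IH _ h1 h2 h3)].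
  have gW : \forall q \near c0,
      W (geo (ref x0) p q.1.1 (k z0) p' q.1.2 q.2).
    have := geo_continuous wv kp'; move=> /(_ c0 W); apply.
    by rewrite /= E.
  by apply: filterS gW.
have /nbhs_ballP[eps /= eps0 epsP] := nW.
have nz : \forall z \near z0, forall t, `|coord t - s0| < eps -> W (geo_homotopy (z, t)).
  have nx : \forall z \near z0, _ := alc (rep_left x0 eps0).
  have ny : \forall z \near z0, _ := bec (rep_right y0 eps0).
  have nk := kl z0.
  near=> z; move=> t ts.
  have [p [a [wo ao wo0 oE oE0]]] : exists o a,
    [/\ wf (ref x0) o a, `|a - rept x0| < eps, wf (ref x0) o (rept x0),
     forall v' (k : F) o' b s, wf v' o' b -> 0 <= s <= 1 ->
       geo (ref (al z)) (repo (al z)) (rept (al z)) (tau (al z) x0 * k)%g o' b s =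
       geo (ref x0) o a k o' b s &
     forall v' (k : F) o' b s, wf v' o' b -> 0 <= s <= 1 ->
       geo (ref x0) o (rept x0) k o' b s =
       geo (ref x0) (repo x0) (rept x0) k o' b s] by near: z; exact: nx.
  have [p' [b [wo' bo' wo0' oE' oE0']]] : exists o b,
    [/\ wf (ref y0) o b, `|b - rept y0| < eps, wf (ref y0) o (rept y0),
     forall v o' a (k : F) s, wf v o' a -> 0 <= s <= 1 ->
       geo v o' a (k * tau y0 (be z))%g (repo (be z)) (rept (be z)) s =
       geo v o' a k o b s &
     forall v o' a (k : F) s, wf v o' a -> edge_path v k (ref y0) -> 0 <= s <= 1 ->
       geo v o' a k o (rept y0) s = geo v o' a k (repo y0) (rept y0) s].
    by near: z; exact: ny.
  have kz : k z = (tau (al z) x0 * k z0 * tau y0 (be z))%g by near: z; exact: nk.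
  have [wz _] := repP (be z).
  (* Both endpoints are now described from the reference vertices of [x0] and [y0], so the two
     factors [tau] disappear and the middle path is the constant [k z0]. *)
  rewrite /geo_homotopy /= kz -mulgA (oE _ _ _ _ _ wz (coord01 t)).
  rewrite (oE' _ _ _ _ _ wo (coord01 t)).
  apply: (epsP (a, b, coord t) _ (p, p') wo0 wo0').
    split; last by rewrite /= /ball /= distrC.
    by split; rewrite /= /ball /= distrC.
  rewrite /= (oE0 _ _ _ _ _ wo0' (coord01 t0)).
  by rewrite (oE0' _ _ _ _ _ wx0 _ (coord01 t0)) //; apply/gpE; exact: kp.
have nt : \forall t \near t0, `|coord t - s0| < eps.
  have := @coord_continuous R t0; move=> /cvgrPdist_lt/(_ eps eps0).
  by apply: filterS => t; rewrite distrC.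
exists ([set z | forall t, `|coord t - s0| < eps -> W (geo_homotopy (z, t))],
        [set t | `|coord t - s0| < eps]) => //=.
by move=> [z t] /= [zP tP]; exact: zP.
Unshelve. all: by end_near. Qed.

End Homotopy.

End Geodesic.

(** * Lifts of edge paths, and homotopy of paths with equal invariant *)

Section PathLift.
Variables (R : realType) (G : graph).
Local Notation X := (geom R G).
Local Notation F := (free_group (edge G)).
Local Notation L := (letter (edge G)).
Local Notation I := (unit_interval R).

Lemma islift_comp (S T : topologicalType) (p : T -> X) g (h : S -> T) :
  continuous h -> islift p g -> islift (p \o h) (g \o h).
Proof. by move=> hc gl s; exact: hc (gl (h s)). Qed.

Lemma islift_glue (c : R) (p1 p2 : R -> X) g1 g2 : islift p1 g1 -> islift p2 g2 ->
  p1 c = p2 c -> g1 c = g2 c ->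
  islift (fun r => if r <= c then p1 r else p2 r)
         (fun r => if r <= c then g1 r else g2 r).
Proof.
move=> l1 l2 pc gc r; case: (ltgtP r c) => rc.
- apply: filterS2 (lt_nbhsl rc) (l1 r) => s /= sc.
  by rewrite (ltW sc).
- apply: filterS2 (lt_nbhsr rc) (l2 r) => s /= sc.
  by rewrite leNgt sc.
- rewrite rc; apply: filterS2 (l1 c) (l2 c) => s; rewrite -pc -gc.
  by case: ifP.
Qed.

(** The reference vertex is the source all along the open edge and becomes the target only at the
    end, so the whole jump by [gen e] happens at 1. *)
Lemma islift_ept e : islift (@ept R G e) (fun r => if r < 1 then 1%g else gen e).
Proof.
have h2 : (2^-1 : R) < 1 by lra.
have h0 : (0 : R) < 2^-1 by lra.
move=> r; case: (ltgtP r 1) => r1.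
- case: (ltP 0 r) => r0.
    have e0 : 0 < Num.min (2^-1) (Num.min r (1 - r)) by rewrite !lt_min; lra.
    apply: (filterS _ (nbhsx_ballx r _ e0)) => s; rewrite /ball /=.
    rewrite !lt_min real_ltr_norml ?num_real // => /and3P[a b c].
    move: b c; rewrite !real_ltr_norml ?num_real // => b c.
    rewrite ifT ?mul1g; last by lra.
    by rewrite /tau !nf_ept ?eqxx ?ifT //= ?real_ltr_norml ?num_real //; lra.
  apply: filterS2 (lt_nbhsl r1) (lt_nbhsl (le_lt_trans r0 h0)) => s /= s1 s2.
  rewrite s1 mul1g /ept (dpoint_le0 _ r0); case: (ltP 0 s) => s0; last first.
    by rewrite (dpoint_le0 _ s0) tau_refl.
  rewrite -/(ept e s) /tau /half nf_vpoint nf_ept; last by lra.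
  by rewrite ifF ?invg1 ?mulg1 //; apply/negbTE; rewrite -leNgt; lra.
- apply: filterS (lt_nbhsr r1) => s /= s1.
  rewrite ltNge (ltW s1) /= /ept (dpoint_ge1 _ (ltW r1)) (dpoint_ge1 _ (ltW s1)).
  by rewrite tau_refl mulg1.
- rewrite r1; apply: filterS (lt_nbhsr h2) => s /= s2.
  rewrite ept1; case: (ltP s 1) => s1; last first.
    by rewrite /ept (dpoint_ge1 _ s1) tau_refl mulg1.
  rewrite /tau /half nf_vpoint nf_ept; last by lra.
  by rewrite s2 mul1g mulgV.
Qed.

Lemma islift_dpoint (d : L) : exists g : R -> F,
  [/\ islift (@dpoint R G d) g, forall r, r <= 0 -> g r = 1%g &
      forall r, 1 <= r -> g r = lgen d].
Proof.
case: d => e []; last first.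
  exists (fun r => if r < 1 then 1%g else gen e); split; first exact: islift_ept.
    by move=> r r0; rewrite ifT //; lra.
  by move=> r r1; rewrite ltNge r1.
pose h r : R := 1 - r.
have hc : continuous h by move=> r; apply: cvgB; [exact: cvg_cst|exact: cvg_id].
have := islift_mull (gen e)^-1%g (islift_comp hc (islift_ept e)).
set g := (X in islift _ X) => gl; exists g; split.
- have -> : @dpoint R G (e, true) = @ept R G e \o h.
    by apply/funext => r; rewrite -[(e, true)]/(linv (e, false)) dpoint_rev.
  exact: gl.
- by move=> r r0; rewrite /g /h /= ltNge ifF ?mulVg //; apply/negbTE; rewrite negbK; lra.
- by move=> r r1; rewrite /g /h /= ifT ?mulg1 ?lgenT //; lra.
Qed.

Lemma islift_path_point v w v' : edge_path v w v' -> exists g : R -> F,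
  [/\ islift (@path_point R G v w) g, forall r, r <= 0 -> g r = 1%g &
      forall r, (size w)%:R <= r -> g r = word_elt w].
Proof.
elim: w v => [|d w IH] v.
  move=> _; exists (fun=> 1%g); split=> // r.
  by apply: filterE => s; rewrite tau_refl mulg1.
move=> /= /andP[/eqP dv p]; have [g [gl g0 g1]] := IH _ p.
have [gd [gdl gd0 gd1]] := islift_dpoint d.
pose h r : R := r - 1.
have hc : continuous h by move=> r; apply: cvgB; [exact: cvg_id|exact: cvg_cst].
exists (fun r => if r <= 1 then gd r else (lgen d * g (r - 1))%g); split.
- apply: (islift_glue gdl (islift_mull (lgen d) (islift_comp hc gl))).
    by rewrite /h /= subrr dpoint1 (path_point0 _ p).
  by rewrite /h /= subrr g0 // gd1 // mulg1.
- by move=> r r0; rewrite ifT ?gd0 //; lra.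
- move=> r; rewrite -natr1 => wr.
  have w0 : (0 : R) <= (size w)%:R by [].
  case: (leP r 1) => r1; last by rewrite g1 -?word_elt_cons //; lra.
  have : size w == 0 by rewrite -(lern0 R); lra.
  rewrite size_eq0 => /eqP w00; subst w.
  by rewrite gd1 //; lra.
Qed.

(** The quotient [k] of the two lifts is trivial at [zero] by normalization and at [one] by equality
    of the invariants, so the geodesic homotopy fixes the ends. *)
Lemma homotopic_of_omega (x y : X) (p q : {path I from x to y}) w :
  omega p w -> omega q w -> path_homotopic p q.
Proof.
move=> [gp0 gpl gpw] [gq0 gql gqw].
pose g1 t := ((gp0 zero)^-1 * gp0 t)%g; pose g2 t := ((gq0 zero)^-1 * gq0 t)%g.
have l1 : islift p g1 by exact: islift_mull.
have l2 : islift q g2 by exact: islift_mull.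
have pc : continuous p by exact: cts_fun.
have qc : continuous q by exact: cts_fun.
have v1 t : gp (ref x) (ref (p t)) (g1 t).
  apply: (islift_valid (@connected_unit R) pc l1 (s := zero)).
  by rewrite path_zero /g1 mulVg; exact: gpd_one.
have v2 t : gp (ref x) (ref (q t)) (g2 t).
  apply: (islift_valid (@connected_unit R) qc l2 (s := zero)).
  by rewrite path_zero /g2 mulVg; exact: gpd_one.
pose k t := ((g1 t)^-1 * g2 t)%g.
have kp t : gp (ref (p t)) (ref (q t)) (k t) by exact: gpd_mul (gpd_inv (v1 t)) (v2 t).
have kl t0 : \forall t \near t0,
    k t = (tau (p t) (p t0) * k t0 * tau (q t0) (q t))%g.
  have s : \forall t \near t0, tau (p t) (p t0) = ((tau (p t0) (p t))^-1)%g.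
    exact: pc (tau_sym (p t0)).
  apply: filterS3 s (l1 t0) (l2 t0) => t -> e1 e2.
  by rewrite /k e1 e2; gsimp.
exists (geo_homotopy p q k); split.
- exact: geo_homotopy_continuous pc qc kp kl.
- by move=> t; exact: geo_homotopy0.
- by move=> t; exact: geo_homotopy1.
- move=> t; split; rewrite geo_homotopy_const ?path_zero ?path_one //.
    by rewrite /k /g1 /g2 !mulVg.
  by rewrite /k /g1 /g2 gpw gqw mulVg.
Qed.

End PathLift.

(** * Maps compatible with the cocycle *)

Section Tracks.
Variable R : realType.

(** [A] is the effect of [al] on edge paths, up to the paths [ka x] from the
    image of the reference vertex of [x] to the reference vertex of [al x]. *)
Definition tracks (G H : graph) (al : geom R G -> geom R H)
    (a : vertex G -> vertex H) (A : free_group (edge G) -> free_group (edge H))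
    (ka : geom R G -> free_group (edge H)) : Prop :=
  [/\ continuous al, is_hom A,
      forall e, gp (a (edge_src G e)) (a (edge_tgt G e)) (A (gen e)),
      forall x, gp (a (ref x)) (ref (al x)) (ka x) &
      forall x0, \forall x \near x0,
        tau (al x0) (al x) = ((ka x0)^-1 * A (tau x0 x) * ka x)%g].

Lemma tracks_id G : tracks (@idfun (geom R G)) idfun idfun (fun=> 1%g).
Proof.
split=> //; first exact: continuous_id.
- by move=> e; exact: gpd_gen.
- by move=> x; exact: gpd_one.
- by move=> x0; apply: filterE => x; gsimp.
Qed.

Lemma tracks_comp G H K al a A ka be b B kb :
  @tracks G H al a A ka -> @tracks H K be b B kb ->
  tracks (be \o al) (b \o a) (B \o A) (fun x => B (ka x) * kb (al x))%g.
Proof.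
move=> [ac AM Av kv at_] [bc BM Bv kbv bt]; split.
- exact: continuous_compT ac bc.
- exact: hom_comp.
- by move=> e /=; apply: hom_valid BM Bv _ _ _ (Av e).
- move=> x; apply: gpd_mul (kbv (al x)).
  exact: hom_valid BM Bv _ _ _ (kv x).
- move=> x0.
  have bt' : \forall x \near x0, tau (be (al x0)) (be (al x)) =
      ((kb (al x0))^-1 * B (tau (al x0) (al x)) * kb (al x))%g.
    exact: ac (bt (al x0)).
  apply: filterS2 (at_ x0) bt' => x /= e1 ->.
  by rewrite e1 !BM (homV BM); gsimp.
Qed.

Lemma tracks_lift (T : topologicalType) G H al a A ka (p : T -> geom R G) g :
  @tracks G H al a A ka -> continuous p -> islift p g ->
  islift (al \o p) (fun t => A (g t) * ka (p t))%g.
Proof.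
move=> [_ AM _ _ at_] pc gl t0.
have at' : \forall t \near t0, tau (al (p t0)) (al (p t)) =
      ((ka (p t0))^-1 * A (tau (p t0) (p t)) * ka (p t))%g.
  exact: pc (at_ (p t0)).
by apply: filterS2 at' (gl t0) => t /= -> ->; rewrite AM; gsimp.
Qed.

Lemma tracks_omega G H al a A ka p w :
  @tracks G H al a A ka -> continuous p -> omega p w ->
  omega (al \o p) ((ka (p zero))^-1 * A w * ka (p one))%g.
Proof.
move=> al_tr pc [g gl <-]; exists (fun t => A (g t) * ka (p t))%g.
  exact: tracks_lift al_tr pc gl.
by have [_ AM _ _ _] := al_tr; rewrite AM (homV AM); gsimp.
Qed.

(** [C] is a natural transformation from [A] to [A']. The path [k x] goes from [al x] back along
    [ka x], across by [C], and forward along [ka' x]; naturality is exactly what makes [k] locally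
    compatible with [tau]. *)
Lemma homotopic_of_tracks G H al a A ka al' a' A' ka' C :
  @tracks G H al a A ka -> @tracks G H al' a' A' ka' ->
  (forall v, gp (a v) (a' v) (C v)) ->
  (forall e, A (gen e) * C (edge_tgt G e) = C (edge_src G e) * A' (gen e))%g ->
  homotopic R al al'.
Proof.
move=> [ac AM Av kv at_] [ac' AM' Av' kv' at'] Cv CE.
have CA u v g : gp u v g -> A' g = ((C u)^-1 * A g * C v)%g.
  apply: (gpd_conj AM AM') => e _.
  by rewrite -mulgA CE mulKg.
pose k x := ((ka x)^-1 * C (ref x) * ka' x)%g.
have kp x : gp (ref (al x)) (ref (al' x)) (k x).
  exact: gpd_mul (gpd_mul (gpd_inv (kv x)) (Cv (ref x))) (kv' x).
have kl x0 : \forall x \near x0,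
    k x = (tau (al x) (al x0) * k x0 * tau (al' x0) (al' x))%g.
  have s : \forall x \near x0, tau (al x) (al x0) = ((tau (al x0) (al x))^-1)%g.
    exact: ac (tau_sym (al x0)).
  near=> x.
  have -> : tau (al x) (al x0) = ((tau (al x0) (al x))^-1)%g by near: x.
  have -> : tau (al x0) (al x) = ((ka x0)^-1 * A (tau x0 x) * ka x)%g.
    by near: x; exact: at_.
  have -> : tau (al' x0) (al' x) = ((ka' x0)^-1 * A' (tau x0 x) * ka' x)%g.
    by near: x; exact: at'.
  have /CA -> : gp (ref x0) (ref x) (tau x0 x) by near: x; exact: tau_valid.
  by rewrite /k; gsimp.
exists (geo_homotopy al al' k); split.
- exact: geo_homotopy_continuous ac ac' kp kl.
- by move=> x; exact: geo_homotopy0.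
- by move=> x; exact: geo_homotopy1.
Unshelve. all: by end_near. Qed.

End Tracks.

(** * Realizations of tight maps *)

Section Realize.
Variables (R : realType) (G H : graph) (f : tight_map G H).

Lemma cell_map_repr (c : cells R G) :
  realize R f (\pi_(geom R G) c) = cell_map f c.
Proof. by rewrite /realize /= -cell_map_attach attach_repr cell_map_attach. Qed.

Lemma realize_vpoint v : realize R f (vpoint R v) = vpoint R (vmap f v).
Proof. exact: cell_map_repr. Qed.

Lemma realize_ept e r : 0 <= r <= 1 -> realize R f (ept e r) =
  path_point (vmap f (edge_src G e)) (emap f e) ((size (emap f e))%:R * r).
Proof. by move=> r01; rewrite [LHS]cell_map_repr /= clamp_id. Qed.

(** For a point inside an edge, [ka] is the lift of the image edge path, stopped at the image of the
    point. This lift is trivial at the source of the edge and ends with the full image word, which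
    accounts for the term [A (tau x0 x)] when a point approaches a target. *)
Lemma realize_tracks : exists ka, tracks (realize R f) (vmap f) (edge_hom f) ka.
Proof.
have /choice[g gP] : forall e : edge G, exists g : R -> free_group (edge H),
    [/\ islift (@path_point R H (vmap f (edge_src G e)) (emap f e)) g,
        forall r, r <= 0 -> g r = 1%g &
        forall r, (size (emap f e))%:R <= r -> g r = word_elt (emap f e)].
  by move=> e; exact: islift_path_point (emap_path f e).
pose ka (x : geom R G) : free_group (edge H) :=
  match nf x with
  | inl _ => 1%g
  | inr (e, r) => g e ((size (emap f e))%:R * r)%R
  end.
have Av e : gp (vmap f (edge_src G e)) (vmap f (edge_tgt G e)) (edge_hom f (gen e)).
  rewrite /edge_hom fhom_gen; apply/gpE.
  by rewrite word_elt_inj_reduced ?emap_tight //; exact: emap_path.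
have lc e : continuous (fun r : R => (size (emap f e))%:R * r).
  by move=> r; apply: cvgM; [exact: cvg_cst|exact: cvg_id].
have gl e (r0 : R) : \forall r \near r0, g e ((size (emap f e))%:R * r)%R =
   (g e ((size (emap f e))%:R * r0)%R * tau
     (path_point (vmap f (edge_src G e)) (emap f e) ((size (emap f e))%:R * r0)%R)
     (path_point (vmap f (edge_src G e)) (emap f e) ((size (emap f e))%:R * r)%R))%g.
  have [gle _ _] := gP e.
  exact: (islift_comp (lc e) gle r0).
exists ka; split.
- exact: realize_continuous.
- exact: fhomM.
- exact: Av.
- move=> x; rewrite /ka /ref; case: (geomP x) => [v|e r r01].
    by rewrite realize_vpoint nf_vpoint; exact: gpd_one.
  rewrite realize_ept; last by lra.
  have [gle g0 _] := gP e.
  have pc := path_point_continuous (emap_path f e).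
  rewrite -/(ref _).
  apply: (islift_valid (@connected_line R) (pc R) gle (s := 0)).
  by rewrite g0 // (path_point0 _ (emap_path f e)) ref_vpoint; exact: gpd_one.
- move=> x0; case: (geomP x0) => [v|e t t01].
    pose Q1 e r := edge_src G e = v -> 0 < r < 1 ->
        tau (realize R f (vpoint R v)) (realize R f (ept e r)) =
        g e ((size (emap f e))%:R * r)%R.
    pose Q2 e r := edge_tgt G e = v -> 0 < r < 1 ->
        tau (realize R f (vpoint R v)) (realize R f (ept e r)) =
        ((word_elt (emap f e))^-1 * g e ((size (emap f e))%:R * r)%R)%g.
    have P1 e : \forall r \near (0 : R), Q1 e r.
      have [_ g0 _] := gP e.
      apply: filterS (gl e 0) => r + ev r01; rewrite mulr0 (g0 0) // mul1g => ->.
      rewrite realize_ept; last by lra.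
      by rewrite realize_vpoint (path_point0 _ (emap_path f e)) ev.
    have P2 e : \forall r \near (1 : R), Q2 e r.
      have [_ _ g1] := gP e.
      apply: filterS (gl e 1) => r + ev r01; rewrite mulr1 (g1 (size (emap f e))%:R) // => ->.
      rewrite realize_ept; last by lra.
      by rewrite realize_vpoint (path_point_size _ (emap_path f e)) ev mulKg.
    (* The graph has finitely many edges, so a common radius exists. *)
    have F1 : \forall r \near (0 : R), forall e, Q1 e r by apply: (@filter_forall _ _ Q1 (nbhs (0 : R)) _).
    have F2 : \forall r \near (1 : R), forall e, Q2 e r by apply: (@filter_forall _ _ Q2 (nbhs (1 : R)) _).
    move: F1 F2 => /nbhs_ballP[e1 /= e10 e1P] /nbhs_ballP[e2 /= e20 e2P].
    have e0 : 0 < Num.min (2^-1) (Num.min e1 e2) by rewrite !lt_min e10 e20 andbT; lra.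
    have := near_vpoint v e0; apply: filterS => x [->|[[e b] [r [dv r01 + ->]]]].
      by rewrite !tau_refl /edge_hom /ka !nf_vpoint; gsimp.
    rewrite !lt_min => /and3P[r2 re1 re2].
    rewrite {1}/ka nf_vpoint invg1 mul1g; case: b dv => dv.
      rewrite -[(e, true)]/(linv (e, false)) dpoint_rev e2P //; last 2 first.
      - rewrite /ball /= real_ltr_norml ?num_real //; lra.
      - lra.
      rewrite /ka nf_ept /tau /half ?nf_vpoint ?nf_ept; last 2 first.
      - lra.
      - lra.
      rewrite ifT; last by lra.
      by rewrite mul1g /edge_hom fhomV fhom_gen.
    rewrite e1P //; last by rewrite /ball /= real_ltr_norml ?num_real //; lra.
    rewrite /ka nf_ept // /tau /half nf_vpoint nf_ept // ifF; last first.
      by apply/negbTE; rewrite -leNgt; lra.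
    by rewrite invg1 mul1g.
  have P1 : \forall r \near t, 0 < r < 1 ->
      tau (realize R f (ept e t)) (realize R f (ept e r)) =
      ((g e ((size (emap f e))%:R * t)%R)^-1 * g e ((size (emap f e))%:R * r)%R)%g.
    apply: filterS (gl e t) => r -> r01.
    by rewrite mulKg !realize_ept //; lra.
  move: P1 => /nbhs_ballP[e1 /= e10 e1P].
  have e0 : 0 < Num.min (2^-1) e1 by rewrite !lt_min e10 andbT; lra.
  have := near_ept e e0 t01; apply: filterS => x [r [r01 + ->]].
  rewrite lt_min => /andP[r2 re1]; rewrite e1P //; last first.
    by rewrite /ball /= distrC.
  rewrite /ka /tau !nf_ept // eqxx /= distrC r2.
  by gsimp.
Qed.

End Realize.

(** * The topological properties in terms of edge paths *)

Section Criteria.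
Variable R : realType.
Local Notation I := (unit_interval R).

Section Graph.
Variable G : graph.
Local Notation X := (geom R G).

Lemma word_path u v (g : free_group (edge G)) : gp u v g ->
  exists p : {path I from vpoint R u to vpoint R v}, omega p g.
Proof.
move=> /gpE gp0; have pc := path_point_continuous gp0.
pose h (t : I) : R := (size g)%:R * coord t.
have hc : continuous h.
  move=> t; apply: (@cvgM _ _ (nbhs (t : I)) _ (fun=> (size g)%:R) (@coord R)).
    exact: cvg_cst.
  exact: coord_continuous.
pose p := path_point u g \o h.
have pc' : continuous p by exact: continuous_compT hc (pc R).
have p0 : p zero = vpoint R u.
  by rewrite /p /h /= coord0 mulr0 (path_point0 _ gp0).
have p1 : p one = vpoint R v.
  by rewrite /p /h /= coord1 mulr1 (path_point_size _ gp0).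
have [gg [ggl gg0 gg1]] := islift_path_point R gp0.
exists (mk_path pc' p0 p1); exists (gg \o h).
  exact: islift_comp hc ggl.
by rewrite /h /= coord0 coord1 mulr0 mulr1 gg0 // gg1 // word_eltK invg1 mul1g.
Qed.

Lemma omega_cst (x : X) : omega (fun _ : I => x) 1%g.
Proof.
exists (fun=> 1%g); last by rewrite mulgV.
by move=> t; apply: filterE => s; rewrite tau_refl mulg1.
Qed.

Lemma omega_square (K : I * I -> X) : continuous K -> exists a b c d,
  [/\ omega (fun s => K (s, zero)) a, omega (fun s => K (s, one)) b,
      omega (fun t => K (zero, t)) c, omega (fun t => K (one, t)) d &
      (a * d = c * b)%g].
Proof.
move=> Kc; have [g [gr gc]] := lift_square Kc.
exists ((g zero zero)^-1 * g one zero)%g, ((g zero one)^-1 * g one one)%g,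
  ((g zero zero)^-1 * g zero one)%g, ((g one zero)^-1 * g one one)%g.
split; last by gsimp.
- by exists (g^~ zero).
- by exists (g^~ one).
- by exists (g zero).
- by exists (g one).
Qed.

(** During the homotopy the base point runs along [K (p zero, _)]; comparing the two ways around the
    square conjugates the invariant by that of this track. *)
Lemma omega_free_homotopy (p : I -> X) (K : X * I -> X) (r : X -> X) w :
  continuous p -> continuous K ->
  (forall x, K (x, zero) = r x) -> (forall x, K (x, one) = x) ->
  p zero = p one -> omega (r \o p) w -> exists2 c,
  omega (fun t => K (p zero, t)) c & omega p (c^-1 * w * c)%g.
Proof.
move=> pc Kc K0 K1 p01 rw.
have Kc' : continuous (fun st : I * I => K (p st.1, st.2)).
  apply: (continuous_compT (f := fun st : I * I => (p st.1, st.2))) Kc.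
  apply: continuous_pair (@continuous_snd _ _).
  exact: continuous_compT (@continuous_fst _ _) pc.
have [a [b [c [d [ha hb hc hd abcd]]]]] := omega_square Kc'.
move: ha hb hc hd => /=.
have -> : (fun s => K (p s, zero)) = r \o p by apply/funext => s /=.
have -> : (fun s => K (p s, one)) = p by apply/funext => s /=.
move=> ha hb hc; rewrite -p01 => hd; exists c => //.
rewrite -(omega_uniq ha rw) -{2}(omega_uniq hd hc) -mulgA abcd mulKg.
exact: hb.
Qed.

(** By [tau_valid], reachability of the reference vertex by an edge path is a locally constant
    property of points. *)
Lemma graph_connected : connected_graph R G ->
  (exists v : vertex G, True) /\ (forall u v : vertex G, exists g, gp u v g).
Proof.
move=> [[x _] cG]; split; first by case: (geomP x) => [v|e _ _]; [exists v|exists (edge_src G e)].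
move=> u v; pose c (y : X) := exists g, gp u (ref y) g.
have : c (vpoint R u) = c (vpoint R v).
  apply: (locally_constant cG) => y0; apply: filterS (tau_valid y0) => y yv.
  apply/propext; split=> [[g ug]|[g ug]].
    by exists (g * (tau y0 y)^-1)%g; exact: gpd_mul ug (gpd_inv yv).
  by exists (g * tau y0 y)%g; exact: gpd_mul ug yv.
rewrite /c !ref_vpoint => <-; exists 1%g; exact: gpd_one.
Qed.

End Graph.

Lemma omega_path_valid (G : graph) (x y : geom R G) (p : {path I from x to y}) w :
  omega p w -> gp (ref x) (ref y) w.
Proof.
have pc : continuous p by exact: cts_fun.
by move/(omega_valid pc); rewrite path_zero path_one.
Qed.

Lemma omega_path_exists (G : graph) (x y : geom R G) (p : {path I from x to y}) :
  exists w, omega p w.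
Proof. by apply: omega_exists; exact: cts_fun. Qed.

Lemma tracks_omega_path (G H : graph) al a A ka (x y : geom R G)
    (p : {path I from x to y}) w : @tracks R G H al a A ka -> omega p w ->
  omega (al \o p) ((ka x)^-1 * A w * ka y)%g.
Proof.
have pc : continuous p by exact: cts_fun.
by move=> tr pw; have := tracks_omega tr pc pw; rewrite path_zero path_one.
Qed.

Lemma path_homotopic_comp (X Y : topologicalType) (f : continuousType X Y)
    (x y : X) (p q : {path I from x to y}) :
  path_homotopic p q ->
  path_homotopic (f \o p : {path I from f x to f y}) (f \o q : {path I from f x to f y}).
Proof.
move=> [K [Kc K0 K1 Ks]]; exists (f \o K); split.
- exact: continuous_compT Kc (@cts_fun _ _ f).
- by move=> s /=; rewrite K0.
- by move=> s /=; rewrite K1.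
- by move=> t /=; have [-> ->] := Ks t.
Qed.

Variables (G H : graph) (f : tight_map G H).

Lemma pi1_injectiveP : pi1_injective R (realize R f) <-> comb_inj f.
Proof.
have [ka tr] := realize_tracks R f; have [fc fM fv kv _] := tr.
split=> [inj u g ug g1|inj x p q fpq].
  have [p pg] := word_path ug.
  pose q : {path I from vpoint R u to vpoint R u} := cst (vpoint R u).
  have qc : omega q 1%g := omega_cst (vpoint R u).
  apply: (omega_uniq pg); apply: (omega_homotopic _ qc).
  apply: inj; apply: (homotopic_of_omega (w := 1%g)).
    exact: (omega_cst (realize R f (vpoint R u))).
  by have := tracks_omega_path tr pg; rewrite g1 mulg1 mulVg.
have [a pa] := omega_path_exists p; have [b qb] := omega_path_exists q.
have := omega_uniq (omega_homotopic fpq (tracks_omega_path tr pa)) (tracks_omega_path tr qb).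
move=> /mulIg/mulgI ab.
have va := omega_path_valid pa; have vb := omega_path_valid qb.
have : (a * b^-1)%g = 1%g.
  apply: (inj (ref x)); first exact: gpd_mul va (gpd_inv vb).
  by rewrite fM (homV fM) ab mulgV.
by move=> /divg1_eq ab1; apply: (homotopic_of_omega (w := a)); rewrite // ab1.
Qed.

(** The homotopy inverse [g] is merely continuous and induces no map on edge paths at hand; it
    enters only through the invariants of composed paths and the two free homotopies. *)
Lemma homotopy_equivalence_bij : (exists y : vertex H, True) ->
  homotopy_equivalence R (realize R f) -> comb_inj f /\ comb_onto f.
Proof.
move=> [y _] [g [[K [Kc K0 K1]] [K' [Kc' K0' K1']]]].
have [ka tr] := realize_tracks R f; have [fc fM fv kv _] := tr.
split.
  move=> u w uw w1; have [p pw] := word_path uw.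
  have pc : continuous p by exact: cts_fun.
  pose q : {path I from vpoint R u to vpoint R u} := cst (vpoint R u).
  have h1 : path_homotopic
      (realize R f \o q : {path I from realize R f (vpoint R u) to realize R f (vpoint R u)})
      (realize R f \o p : {path I from realize R f (vpoint R u) to realize R f (vpoint R u)}).
    apply: (homotopic_of_omega (w := 1%g)).
      exact: (omega_cst (realize R f (vpoint R u))).
    by have := tracks_omega_path tr pw; rewrite w1 mulg1 mulVg.
  have h2 := path_homotopic_comp g h1.
  have gfp : omega ((g \o realize R f) \o p) 1%g.
    apply: (omega_homotopic h2).
    exact: (omega_cst (g (realize R f (vpoint R u)))).
  have p01 : p zero = p one by rewrite path_zero path_one.
  have [c _ pc1] := omega_free_homotopy pc Kc K0 K1 p01 gfp.
  by rewrite (omega_uniq pw pc1) mulg1 mulVg.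
have gc : continuous g by exact: cts_fun.
(* The base vertex is the reference vertex of [x0], because the preimage of [k] will be the
   invariant of [g \o q], a loop at [x0]. The loop [q] is [k] transported to [y] along the track of
   [y] under the homotopy. *)
pose x0 := g (vpoint R y); exists (ref x0) => k vk.
pose k1 := ((ka x0)^-1 * k * ka x0)%g.
have k1v : gp (ref (realize R f x0)) (ref (realize R f x0)) k1.
  exact: gpd_mul (gpd_mul (gpd_inv (kv x0)) vk) (kv x0).
have cc : continuous (fun t => K' (vpoint R y, t)).
  apply: (continuous_compT (f := fun t : I => (vpoint R y, t))) Kc'.
  exact: continuous_pair (@continuous_const _ _ _) (@continuous_id _).
have [C cC] := omega_exists cc.
have Cv : gp (ref (realize R f x0)) y C.
  by have := omega_valid cc cC; rewrite K0' K1' ref_vpoint.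
have [q qk] : exists q : {path I from vpoint R y to vpoint R y},
    omega q (C^-1 * k1 * C)%g.
  by apply: word_path; exact: gpd_mul (gpd_mul (gpd_inv Cv) k1v) Cv.
have qc : continuous q by exact: cts_fun.
have [a pa] := omega_path_exists (g \o q : {path I from x0 to x0}).
have fpa := tracks_omega_path tr pa.
have q01 : q zero = q one by rewrite path_zero path_one.
have [c cc' qc1] := omega_free_homotopy qc Kc' K0' K1' q01 fpa.
rewrite path_zero in cc'.
exists a; first exact: omega_path_valid pa.
have := omega_uniq qc1 qk; rewrite (omega_uniq cc' cC) /k1.
by move=> /mulIg/mulgI/mulIg/mulgI.
Qed.

Lemma homotopy_equivalence_of_bij :
  (forall u v : vertex G, exists g, gp u v g) ->
  (forall u v : vertex H, exists g, gp u v g) ->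
  comb_inj f -> comb_onto f -> homotopy_equivalence R (realize R f).
Proof.
move=> cG cH inj [v0 onto].
have [ka tr] := realize_tracks R f; have [fc fM fv kv _] := tr.
set y0 := vmap f v0 in onto.
have [a aP] := choice (cH y0); have [b bP] := choice (cG v0).
(* [s] is a section of the label map on loops at the base vertices, with a default value
   elsewhere. *)
have /choice[s sP] : forall k, exists g,
    gp y0 y0 k -> gp v0 v0 g /\ edge_hom f g = k.
  move=> k; have [/onto[g ug gk]|nk] := pselect (gp y0 y0 k); first by exists g.
  by exists 1%g.
have inj2 x x' : gp v0 v0 x -> gp v0 v0 x' -> edge_hom f x = edge_hom f x' -> x = x'.
  move=> xv xv' xx'; apply: divg1_eq; apply: (inj v0).
    exact: gpd_mul xv (gpd_inv xv').
  by rewrite fM (homV fM) xx' mulgV.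
(* Each edge of [H] is closed up to a loop at [y0] by the paths [a] and then lifted to a loop at
   [v0]. *)
pose w e := s (a (edge_src H e) * gen e * (a (edge_tgt H e))^-1)%g.
have wP e : gp v0 v0 (w e) /\
    edge_hom f (w e) = (a (edge_src H e) * gen e * (a (edge_tgt H e))^-1)%g.
  apply: sP; apply: gpd_mul (gpd_inv (aP _)).
  by apply: gpd_mul (aP _) _; exact: gpd_gen.
pose gv := [ffun y : vertex H => v0].
pose ge := [ffun e : edge H => (w e : seq (letter (edge G)))].
have gpath e : edge_path (gv (edge_src H e)) (ge e) (gv (edge_tgt H e)).
  by rewrite !ffunE; apply/gpE; have [] := wP e.
have gtight e : reduced (ge e) by rewrite ffunE; exact: valP (w e).
pose g := TightMap gpath gtight.
have [kb trg] := realize_tracks R g; have [gc gM gvv kvg _] := trg.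
have gE e : edge_hom g (gen e) = w e by rewrite /edge_hom fhom_gen /= ffunE word_eltK.
have fgE y y' h : gp y y' h -> edge_hom f (edge_hom g h) = (a y * h * (a y')^-1)%g.
  have E e : True -> edge_hom f (edge_hom g (gen e)) =
      (((a (edge_src H e))^-1)^-1 * gen e * (a (edge_tgt H e))^-1)%g.
    by move=> _; rewrite gE (proj2 (wP e)) invgK.
  have idM : is_hom (@idfun (free_group (edge H))) by [].
  move=> hv; have := @gpd_conj _ _ _ _ _ _ _ _ (fun y => (a y)^-1)%g idM
    (hom_comp gM fM) E _ _ _ hv.
  by rewrite /= invgK.
exists (realize R g); split.
  (* A path from [v0] to [v] is wanted whose image is [a (vmap f v)]. The path [b v] has the right
     ends, and a loop at [v0] corrects its image. *)
  pose C v : free_group (edge G) :=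
    (s (a (vmap f v) * (edge_hom f (b v))^-1) * b v)%g.
  have CP v : gp v0 v (C v) /\ edge_hom f (C v) = a (vmap f v).
    have [h1 h2] : gp v0 v0 (s (a (vmap f v) * (edge_hom f (b v))^-1)%g) /\
       edge_hom f (s (a (vmap f v) * (edge_hom f (b v))^-1)%g) =
       (a (vmap f v) * (edge_hom f (b v))^-1)%g.
      by apply: sP; apply: gpd_mul (aP _) (gpd_inv _); exact: gp_hom.
    split; first exact: gpd_mul h1 (bP v).
    by rewrite /C fM h2 mulgVK.
  apply: (homotopic_of_tracks (tracks_comp tr trg) (tracks_id R G) (C := C)).
    by move=> v /=; rewrite ffunE; have [] := CP v.
  move=> e /=; have [Cs fCs] := CP (edge_src G e); have [Ct fCt] := CP (edge_tgt G e).
  have ev : gp (edge_src G e) (edge_tgt G e) (gen e) by exact: gpd_gen.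
  have fev := gp_hom f ev.
  have -> : edge_hom g (edge_hom f (gen e)) =
      (C (edge_src G e) * gen e * (C (edge_tgt G e))^-1)%g.
    (* Naturality of [C] is checked after applying [edge_hom f], where it reduces to [fgE];
       injectivity on loops at [v0] brings it back to [G]. *)
    apply: inj2.
    - by have := hom_valid gM gvv fev; rewrite !ffunE.
    - exact: gpd_mul (gpd_mul Cs ev) (gpd_inv Ct).
    - by rewrite (fgE _ _ _ fev) 2!fM (homV fM) fCs fCt.
  by rewrite mulgVK.
apply: (homotopic_of_tracks (tracks_comp trg tr) (tracks_id R H) (C := a)).
  by move=> y /=; rewrite ffunE.
move=> e /=; rewrite (fgE (edge_src H e) (edge_tgt H e)) ?mulgVK //.
exact: gpd_gen.
Qed.

End Criteria.

End Topology.

Theorem corollary2p3p1 (R : realType) :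
  (exists p : cmd, forall (G H : graph) (f : tight_map G H),
      connected_graph R G -> connected_graph R H ->
      answers p (enc_tight_map f) (pi1_injective R (realize R f))) /\
  (exists p : cmd, forall (G H : graph) (f : tight_map G H),
      connected_graph R G -> connected_graph R H ->
      answers p (enc_tight_map f) (homotopy_equivalence R (realize R f))) /\
  (exists p : cmd, forall (n : nat) (w : n.-tuple (seq (letter 'I_n))),
      answers p (enc_seq (@enc_word n) w)
        (is_free_basis (fun i : 'I_n => word_elt (tnth w i)))).
Proof.
split; [|split].
- have c : computable (fun i => injective_test (core (edges_of i))).
    apply: (computable_comp _ computable_injective_test).
    exact: computable_comp computable_edges_of computable_core.
  have [p pP] := answers_computable c; exists p => G H f cG cH.
  have [G0 _] := graph_connected cG.
  apply: (pP _ _ _ (injective_testE _)).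
  by rewrite -comb_inj_test // pi1_injectiveP.
- have [p pP] := answers_computable computable_bij_program; exists p => G H f cG cH.
  have [G0 GC] := graph_connected cG; have [H0 HC] := graph_connected cH.
  apply: (pP _ _ _ (bij_testE _ _)).
  rewrite -comb_bij_test //; split; first exact: homotopy_equivalence_bij.
  by case; exact: homotopy_equivalence_of_bij.
- have [p pP] := answers_computable computable_basis_program; exists p => n w.
  exact: (pP _ _ _ (bij_testE _ _) (basis_test w)).
Qed.
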